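(* There are absolute constants $c,C>0$ such that, for every integer $n\geq 3$, $$\frac{c}{\log n}\leq \kappa_n(\overline{\mathbb D},1)\leq \kappa_n(\mathbb T,1)\leq \frac{C}{\log n}.$$ Moreover, if for each $n$ the polynomial $p_n$ minimizes $\operatorname{Area}\Lambda_p(1)$ over all $p\in\mathcal P_n(\mathbb T)$, then for every $0<r<1$ there exists $n_r$ such that $$\sup_{|z|\leq r}|p_n(z)|\leq e\qquad\text{for all } n\geq n_r .$$ Consequently every sequence $(p_n)$ of such minimizers is locally bounded in $\mathbb D$ (uniformly bounded on each compact subset of $\mathbb D$), and hence is a normal family in $\mathbb D$.
   Context: $\mathbb D=\{z\in\mathbb C:|z|<1\}$ is the open unit disk, $\overline{\mathbb D}$ its closure, and $\mathbb T=\{z\in\mathbb C:|z|=1\}$ the unit circle. For a compact set $K\subset\mathbb C$, $\mathcal P_n(K)$ denotes the set of monic complex polynomials of degree exactly $n$ all of whose zeros lie in $K$. For a monic polynomial $p$ and $t>0$, $\Lambda_p(t)=\{z\in\mathbb C:|p(z)|<t\}$, and $\operatorname{Area}$ denotes planar Lebesgue measure. Define $$\kappa_n(K,t)=\inf_{p\in\mathcal P_n(K)}\operatorname{Area}\Lambda_p(t).$$ *)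

(* Defs.v *)
From HB Require Import structures.
From mathcomp Require Import all_boot all_order all_algebra.
From mathcomp Require Import all_classical all_reals all_analysis.
From mathcomp Require Import complex.

Set Implicit Arguments.
Unset Strict Implicit.
Unset Printing Implicit Defensive.

Import Order.TTheory GRing.Theory Num.Theory.
Import numFieldNormedType.Exports.

Local Open Scope classical_set_scope.
Local Open Scope ring_scope.
Local Open Scope complex_scope.

(* The ascription gives R[i] the topology that MathComp-Analysis puts on every
   numFieldType, here the one of the metric |z - w|. *)
Definition Cplx (R : realType) : numFieldType := R[i].

(* The modulus as an element of R; the norm `|z| of R[i] takes values in R[i]. *)
Definition cabs (R : realType) (z : R[i]) : R := ComplexField.Normc.normc z.

Definition disk (R : realType) : set (Cplx R) := [set z | cabs z < 1].

Definition closed_disk (R : realType) : set (Cplx R) := [set z | cabs z <= 1].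

Definition circle (R : realType) : set (Cplx R) := [set z | cabs z = 1].

Definition monic_zeros_in (R : realType) (n : nat) (K : set (Cplx R)) :
    set {poly R[i]} :=
  [set p | [/\ p \is monic, size p = n.+1 & forall z : R[i], root p z -> K z]].

Definition lemniscate (R : realType) (p : {poly R[i]}) (t : R) :
    set (Cplx R) :=
  [set z | cabs p.[z] < t].

Definition area (R : realType) (E : set (Cplx R)) : \bar R :=
  (@lebesgue_measure R \x @lebesgue_measure R)%E
    [set xy : R * R | E (xy.1 +i* xy.2)].

Definition kappa (R : realType) (n : nat) (K : set (Cplx R)) (t : R) : \bar R :=
  ereal_inf [set area (lemniscate p t) | p in monic_zeros_in n K].

Definition is_minimizer (R : realType) (n : nat) (K : set (Cplx R)) (t : R)
    (p : {poly R[i]}) : Prop :=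
  monic_zeros_in n K p /\
  forall q, monic_zeros_in n K q ->
    (area (lemniscate p t) <= area (lemniscate q t))%E.

Definition poly_fun (R : realType) (p : {poly R[i]}) : Cplx R -> Cplx R :=
  fun z => p.[z].

Definition locally_bounded_in (R : realType) (U : set (Cplx R))
    (F : set (Cplx R -> Cplx R)) : Prop :=
  forall K : set (Cplx R), compact K -> K `<=` U ->
    exists M : R, forall f, F f -> forall z, K z -> cabs (f z) <= M.

(* Normality in the sense of Montel with finite limits: the limit is not
   required to belong to the family. *)
Definition normal_family_in (R : realType) (U : set (Cplx R))
    (F : set (Cplx R -> Cplx R)) : Prop :=
  forall f : nat -> Cplx R -> Cplx R, (forall k, F (f k)) ->
    exists (s : nat -> nat) (g : Cplx R -> Cplx R),
      (forall i j, (i < j)%N -> (s i < s j)%N) /\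
      forall K : set (Cplx R), compact K -> K `<=` U ->
        {uniform K, (fun k => f (s k)) @ \oo --> g}.

(* Main.v *)
(* Area of {Re f < 0}.  Let Y(x) be the integral of ln(1+|f|^2) over the circle
   |z| = e^x, a convex function of x.  Where Re f >= 0 the function
   ln(1 + Re f + i Im f) is holomorphic, so the growth of Y is paid for by the
   set {Re f < 0}: a circle mean has no radial growth unless its harmonicity
   defect, supported there, is large.  Quantitatively, if Y doubles before x and
   again takes a step d to double, the part of {Re f < 0} met so far has
   logarithmic area at least c d^2.  When |f| is tiny at 0, at least L
   somewhere on |z| <= r0, and at most U on |z| <= r1, there are about
   ln ln(U/L) doublings between r0 and r1, and Cauchy-Schwarz on the steps gives
   area{|z| <= r1, Re f < 0} >= c / ln(2 + ln(U/L)).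

   Lower bound.  If the zeros a_i of p lie in the closed disk then |p| <= |b| on
   the disk, b = prod (1 - conj(a_i) z).  Take f close to 1 - 1/b: where
   Re f < 0 one has |b| < 1, and U/L is at most exponential in n.

   Upper bound.  Shifting poles in steps 1/k yields a polynomial H of degree
   16^O(k) with H(0) = 1 and |H| <= 1/2 on the disk off the strip
   |Im z| < 16/k.  With g = 1 + delta (1 - H), which has no zero in the closed
   disk, the polynomial p = g + z^n conj(g(1/conj z)) has all its zeros on the
   circle, and |p| >= 1 off the strip and a thin annulus.

   Interior bound.  If |p_n(z0)| > e at some |z0| <= r, apply the area bound to a
   truncated power series of log p_n: now U/L = O(n), so the area of
   {|p_n| < 1} is at least c_r / ln ln n, which contradicts the upper bound for
   large n.  Normality then follows from Cauchy estimates. *)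

Require Import Defs.
From mathcomp Require Import all_boot all_order all_algebra.
From mathcomp Require Import all_classical all_reals all_analysis.
From mathcomp Require Import complex.
From HB Require Import structures.
From mathcomp Require Import measurable_realfun.
From mathcomp Require Import ring lra zify.
From mathcomp Require cyclic separable cyclotomic.

Set Implicit Arguments.
Unset Strict Implicit.
Unset Printing Implicit Defensive.

Import Order.TTheory GRing.Theory Num.Theory.
Import numFieldNormedType.Exports.

Local Open Scope classical_set_scope.
Local Open Scope ring_scope.

Local Notation Re := complex.Re.
Local Notation Im := complex.Im.

(** * Integrals over a segment and their dependence on a parameter *)

Section Calculus.
Variable R : realType.
Local Notation mu := (@lebesgue_measure R).

(** In logarithmic coordinates the harmonicity defect of ln ([ks] (Re f) + i Im f) is of size theta
    |f'| / (1 + |f|), with theta supported on {Re f < 0}. A weighted AM-GM splits it into tau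
    theta^2, paid for by area, and |f'|^2 / (1 + |f|^2) over tau, to be controlled by growth. The
    Laplacian of ln (1 + |f|^2) is too small for this where |f| is large; that of [lw] (|f|^2),
    roughly the squared logarithm, is large enough, and its circle mean is again convex. If Y at
    most doubles over the next step d, a sub-mean value inequality turns Y into a pointwise bound,
    and the derivative of that mean is O(Y^2 / d^2). The right tau is of order Y / d^2, and then Y
    cancels: a doubling costs area d^2 whatever the size of Y, so only the number of doublings
    counts. All functions are polynomials, so 1/b and log p_n enter through truncated series, and a
    small positive constant added to f absorbs the truncation error. The polar formula is derived
    from invariance under multiplication, which leaves in it a constant known only to be positive
    and finite. *)

Definition cint (a b : R) (f : R -> R) : R := \int[mu]_(y in `[a, b]) f y.

Lemma continuous_integrable (a b : R) (f : R -> R) :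
  continuous f -> mu.-integrable `[a, b] (EFin \o f).
Proof.
move=> cf; apply: continuous_compact_integrable; first exact: segment_compact.
exact: continuous_subspaceT.
Qed.

Lemma le_cint (a b : R) (f g : R -> R) : continuous f -> continuous g ->
  (forall x, a <= x <= b -> f x <= g x) -> cint a b f <= cint a b g.
Proof.
move=> cf cg fg; apply: le_Rintegral => //.
all: exact: continuous_integrable.
Qed.

Lemma cintD (a b : R) (f g : R -> R) : continuous f -> continuous g ->
  cint a b (fun x => f x + g x) = cint a b f + cint a b g.
Proof.
by move=> cf cg; apply: RintegralD => //; apply: continuous_integrable.
Qed.

Lemma cintZ (a b c : R) (f : R -> R) : continuous f ->
  cint a b (fun x => c * f x) = c * cint a b f.
Proof. by move=> cf; apply: RintegralZl => //; apply: continuous_integrable. Qed.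

Lemma cint_cst (a b c : R) : a <= b -> cint a b (fun=> c) = (b - a) * c.
Proof.
move=> ab; rewrite /cint Rintegral_cst//= lebesgue_measure_itv/= lte_fin.
case: ltP => [_|ba]; first by rewrite -EFinD /= mulrC.
by rewrite (_ : b = a) ?subrr ?mul0r ?mulr0//; apply/eqP; rewrite eq_le ab ba.
Qed.

Lemma cint_ge0 (a b : R) (f : R -> R) :
  (forall x, a <= x <= b -> 0 <= f x) -> 0 <= cint a b f.
Proof. by move=> f0; apply: Rintegral_ge0 => x /=; rewrite in_itv/=; apply: f0. Qed.

Lemma eq_cint (a b : R) (f g : R -> R) : f =1 g -> cint a b f = cint a b g.
Proof. by move=> fg; congr cint; apply/funext. Qed.

Lemma cint_FTC (a b : R) (F f : R -> R) : a <= b -> continuous f ->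
  (forall x : R, is_derive x 1 F (f x)) -> cint a b f = F b - F a.
Proof.
move=> ab cf dF; move: ab; rewrite le_eqVlt => /predU1P[->|ab].
  by rewrite subrr /cint set_itv1 Rintegral_set1.
have cF : continuous F.
  by move=> x; apply/differentiable_continuous/derivable1_diffP; apply: ex_derive.
have := @continuous_FTC2 R f F a b ab.
rewrite /cint /Rintegral => ->//; first exact: continuous_subspaceT.
- split=> [x _||].
  + exact: ex_derive.
  + exact/cvg_at_right_filter/cF.
  + exact/cvg_at_left_filter/cF.
- by move=> x _; rewrite derive1E; apply: derive_val.
Qed.

Definition cont2 (H : R -> R -> R) := continuous (fun p : R * R => H p.1 p.2).

Lemma cont2_bounded (a b c d : R) (H : R -> R -> R) : cont2 H ->
  exists M, forall x y, a <= x <= b -> c <= y <= d -> `|H x y| <= M.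
Proof.
move=> cH.
have K : compact (`[a, b]%classic `*` `[c, d]%classic : set (R * R)).
  by apply: compact_setX; exact: segment_compact.
have cK : compact ((fun p : R * R => H p.1 p.2) @` (`[a, b]%classic `*` `[c, d]%classic)).
  apply: continuous_compact => //; exact: continuous_subspaceT.
have [M [_ HM]] := compact_bounded cK.
exists (M + 1) => x y xab ycd; apply: (HM (M + 1)); first by rewrite ltrDl.
by exists (x, y) => //=; split; rewrite /= in_itv.
Qed.

Lemma cont2_y (H : R -> R -> R) (x : R) : cont2 H -> continuous (H x).
Proof.
move=> cH y.
by apply: (@continuous2_cvg _ R R R (nbhs (y : R)) _ (fun=> x) id H x y (cH (x, y))); [exact: cvg_cst|exact: cvg_id].
Qed.

Lemma cont2_x (H : R -> R -> R) (y : R) : cont2 H -> continuous (H^~ y).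
Proof.
move=> cH x.
by apply: (@continuous2_cvg _ R R R (nbhs (x : R)) _ id (fun=> y) H x y (cH (x, y))); [exact: cvg_id|exact: cvg_cst].
Qed.

(** Compactness of [a - 1, a + 1] x [c, d] bounds [H] by a constant, which dominates the integrands
    near a. *)
Lemma cint_continuous (c d : R) (H : R -> R -> R) : cont2 H ->
  continuous (fun x => cint c d (H x)).
Proof.
move=> cH a.
have [M HM] := cont2_bounded (a - 1) (a + 1) c d cH.
have mB : measurable (`[c, d]%classic : set (measurableTypeR R)) by exact: measurable_itv.
have P1 x : (`](a - 1), (a + 1)[%classic : set R) x -> mu.-integrable `[c, d] (EFin \o H x).
  by move=> _; apply: continuous_integrable; apply: cont2_y.
have P2 : {ae mu, forall y, (`[c, d]%classic : set R) y ->
    {in (`](a - 1), (a + 1)[%classic : set R), continuous (H^~ y)}}.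
  by apply: aeW => y _ x _; apply: cont2_x.
have P3 : mu.-integrable `[c, d] (EFin \o (fun _ : R => M)).
  by apply: continuous_integrable => ?; apply: cvg_cst.
have P4 x : (`](a - 1), (a + 1)[%classic : set R) x ->
    {ae mu, forall y, (`[c, d]%classic : set R) y -> `|H x y| <= M}.
  rewrite /= in_itv/= => /andP[ax xa]; apply: aeW => y /=; rewrite in_itv/= => ycd.
  by apply: HM => //; rewrite (ltW ax) (ltW xa).
have := @continuity_under_integral R _ (measurableTypeR R) mu H `[c, d] mB (a - 1) (a + 1) P1 P2 (fun=> M) P3 P4.
by apply; rewrite inE /= in_itv/=; lra.
Qed.

Lemma is_derive_cint (c d : R) (H Hx : R -> R -> R) : cont2 H -> cont2 Hx ->
  (forall x y : R, is_derive x 1 (H^~ y) (Hx x y)) ->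
  forall a : R, is_derive a 1 (fun x => cint c d (H x)) (cint c d (Hx a)).
Proof.
move=> cH cHx dH a.
have [M HM] := cont2_bounded (a - 1) (a + 1) c d cHx.
(* [M] may be negative when [c, d] is empty, and the dominating function has to be nonnegative. *)
have M0 : 0 <= Num.max M 0 by rewrite le_max lexx orbT.
have E : partial1of2 H = Hx.
  by apply/funext => x; apply/funext => y; rewrite partial1of2E; apply: derive_val.
have ina : (`](a - 1), (a + 1)[%classic : set R) a by rewrite /= in_itv/=; lra.
have P1 x : (`](a - 1), (a + 1)[%classic : set R) x -> mu.-integrable `[c, d] (EFin \o H x).
  by move=> _; apply: continuous_integrable; apply: cont2_y.
have P2 x y : (`](a - 1), (a + 1)[%classic : set R) x -> (`[c, d]%classic : set R) y -> derivable (H^~ y) x 1.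
  by move=> _ _; apply: ex_derive.
have P3 : mu.-integrable `[c, d] (EFin \o (fun _ : R => Num.max M 0)).
  by apply: continuous_integrable => ?; apply: cvg_cst.
have P4 x y : (`](a - 1), (a + 1)[%classic : set R) x -> (`[c, d]%classic : set R) y -> `|partial1of2 H x y| <= Num.max M 0.
  rewrite E /= !in_itv/= => /andP[ax xa] ycd.
  by rewrite le_max HM// (ltW ax) (ltW xa).
have mB : measurable (`[c, d]%classic : set (measurableTypeR R)) by exact: measurable_itv.
have := @differentiation_under_integral R _ (measurableTypeR R) mu H `[c, d] mB a (a - 1) (a + 1) ina P1 P2 (fun=> Num.max M 0) (fun=> M0) P3 P4.
have := @derivable_under_integral R _ (measurableTypeR R) mu H `[c, d] mB a (a - 1) (a + 1) ina P1 P2 (fun=> Num.max M 0) (fun=> M0) P3 P4.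
rewrite E derive1E => d1 d2; apply: DeriveDef => //.
Qed.

End Calculus.

(** * The real-valued modulus, and exponential coordinates *)

Section Modulus.
Variable R : realType.
Implicit Types z w : R[i].

Lemma cabs_ge0 z : 0 <= cabs z.
Proof. by case: z => a b; exact: sqrtr_ge0. Qed.

Lemma cabs0 : cabs (0 : R[i]) = 0.
Proof. exact: ComplexField.Normc.normc0. Qed.

Lemma cabs1 : cabs (1 : R[i]) = 1.
Proof. exact: ComplexField.Normc.normc1. Qed.

Lemma cabsM z w : cabs (z * w) = cabs z * cabs w.
Proof. exact: ComplexField.Normc.normcM. Qed.

Lemma cabsV z : cabs z^-1 = (cabs z)^-1.
Proof. exact: ComplexField.Normc.normcV. Qed.

Lemma cabs_eq0 z : (cabs z == 0) = (z == 0).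
Proof.
apply/eqP/eqP => [|->]; last exact: cabs0.
exact: ComplexField.Normc.eq0_normc.
Qed.

Lemma cabs_gt0 z : (0 < cabs z) = (z != 0).
Proof. by rewrite lt_neqAle cabs_ge0 andbT eq_sym cabs_eq0. Qed.

Lemma cabsN z : cabs (- z) = cabs z.
Proof. by case: z => a b; rewrite /cabs /= !sqrrN. Qed.

Lemma cabs_sqr z : cabs z ^+ 2 = Re z ^+ 2 + Im z ^+ 2.
Proof. by case: z => a b; rewrite /cabs /= sqr_sqrtr// addr_ge0 ?sqr_ge0. Qed.

Lemma normC_cabs z : `|z| = (cabs z)%:C%C.
Proof. by case: z => a b; rewrite normc_def. Qed.

Lemma cabsD z w : cabs (z + w) <= cabs z + cabs w.
Proof. by have := ler_normD z w; rewrite !normC_cabs -raddfD lecR. Qed.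

Lemma cabsB z w : cabs (z - w) = cabs (w - z).
Proof. by rewrite -cabsN opprB. Qed.

Lemma cabsX z n : cabs (z ^+ n) = cabs z ^+ n.
Proof. by elim: n => [|n IH]; rewrite ?expr0 ?cabs1// !exprS cabsM IH. Qed.

Lemma cabs_sum I (r : seq I) (P : pred I) (F : I -> R[i]) :
  cabs (\sum_(i <- r | P i) F i) <= \sum_(i <- r | P i) cabs (F i).
Proof.
elim/big_rec2: _ => [|i y x _ h]; first by rewrite cabs0.
exact: le_trans (cabsD _ _) (lerD _ _).
Qed.

Lemma cabs_prod I (r : seq I) (P : pred I) (F : I -> R[i]) :
  cabs (\prod_(i <- r | P i) F i) = \prod_(i <- r | P i) cabs (F i).
Proof. by elim/big_rec2: _ => [|i y x _ h]; rewrite ?cabs1// cabsM h. Qed.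

Lemma Re_le_cabs z : Re z <= cabs z.
Proof.
by case: z => a b; rewrite (le_trans (ler_norm _))// -sqrtr_sqr ler_wsqrtr//= lerDl sqr_ge0.
Qed.

Lemma normRe_le_cabs z : `|Re z| <= cabs z.
Proof. by case: z => a b; rewrite -sqrtr_sqr ler_wsqrtr//= lerDl sqr_ge0. Qed.

Lemma normIm_le_cabs z : `|Im z| <= cabs z.
Proof. by case: z => a b; rewrite -sqrtr_sqr ler_wsqrtr//= lerDr sqr_ge0. Qed.

Lemma cabs_real (a : R) : cabs a%:C%C = `|a|.
Proof. by rewrite /cabs /= expr0n/= addr0 sqrtr_sqr. Qed.

Lemma cabs_nat n : cabs (n%:R : R[i]) = n%:R.
Proof. by rewrite -(rmorph_nat (@real_complex R)) cabs_real ger0_norm. Qed.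

Lemma cabs_conj z : cabs (conjc z) = cabs z.
Proof. by case: z => a b; rewrite /cabs /= sqrrN. Qed.

Lemma cabs_le_ReIm z : cabs z <= `|Re z| + `|Im z|.
Proof.
rewrite -(@ler_pXn2r _ 2)// ?nnegrE ?cabs_ge0 ?addr_ge0//.
by rewrite cabs_sqr sqrrD !real_normK ?num_real// addrAC lerDl mulrn_wge0// mulr_ge0.
Qed.

Lemma cReM z w : Re (z * w) = Re z * Re w - Im z * Im w.
Proof. by case: z => a b; case: w. Qed.

Lemma cImM z w : Im (z * w) = Re z * Im w + Im z * Re w.
Proof. by case: z => a b; case: w. Qed.

Lemma cReD z w : Re (z + w) = Re z + Re w.
Proof. by case: z => a b; case: w. Qed.

Lemma cImD z w : Im (z + w) = Im z + Im w.
Proof. by case: z => a b; case: w. Qed.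

Lemma cReN z : Re (- z) = - Re z. Proof. by case: z. Qed.

Lemma cImN z : Im (- z) = - Im z. Proof. by case: z. Qed.

(** A submultiplicative majorant of the sup norm on the closed unit disk, computed from the
    coefficients alone. *)
Definition pnorm (g : {poly R[i]}) : R := \sum_(i < size g) cabs g`_i.

Lemma pnorm_ge0 g : 0 <= pnorm g.
Proof. by apply: sumr_ge0 => i _; exact: cabs_ge0. Qed.

Lemma cabs_horner_le (g : {poly R[i]}) z : cabs z <= 1 -> cabs g.[z] <= pnorm g.
Proof.
move=> z1; rewrite horner_coef; apply: le_trans (cabs_sum _ _ _) _.
by apply: ler_sum => i _; rewrite cabsM cabsX ler_piMr ?cabs_ge0// exprn_ile1// cabs_ge0.
Qed.

(** The exponential of x + iy. In these coordinates circles are the lines of constant x, and the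
    Laplacian has constant coefficients. *)
Definition expi (x y : R) : R[i] := ((expR x * cos y) +i* (expR x * sin y))%C.

Lemma cabs_expi x y : cabs (expi x y) = expR x.
Proof.
rewrite /cabs /= !exprMn -mulrDr cos2Dsin2 mulr1 sqrtr_sqr ger0_norm// expR_ge0.
Qed.

Lemma expi_period x y : expi x (y + 2 * pi) = expi x y.
Proof. by rewrite /expi mulr_natl cosD2pi sinD2pi. Qed.

Lemma expi_surj z : z != 0 -> exists x y, z = expi x y.
Proof.
move=> z0; exists (ln (cabs z)).
have c0 : 0 < cabs z by rewrite cabs_gt0.
have [y hy] : exists y, cos y = Re z / cabs z /\ sin y = Im z / cabs z.
  have h1 : -1 <= Re z / cabs z <= 1.
    rewrite ler_pdivlMr// ler_pdivrMr// mulN1r mul1r -ler_norml; exact: normRe_le_cabs.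
  have h2 : (Im z / cabs z) ^+ 2 = 1 - (Re z / cabs z) ^+ 2.
    rewrite !exprMn !exprVn cabs_sqr; field.
    by rewrite -cabs_sqr expf_eq0 /= cabs_eq0.
  have := acosK h1; set t := acos _ => ct.
  have st : sin t ^+ 2 = (Im z / cabs z) ^+ 2 by rewrite sin2cos2 ct h2.
  move: st => /eqP; rewrite eqf_sqr => /orP[/eqP|/eqP] st; first by exists t.
  by exists (- t); rewrite cosN sinN ct st opprK.
exists y; rewrite /expi hy.1 hy.2 lnK ?posrE//.
by case: z z0 c0 {hy} => a b /= z0 c0; congr Complex; field; rewrite gt_eqF.
Qed.

End Modulus.

(** * Polynomials small off a strip *)

Section PoleShift.
Variable R : realType.
Local Notation C := R[i].
Implicit Types (p q g al be : {poly C}) (z y t : C).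

Lemma pnormE g n : (size g <= n)%N -> pnorm g = \sum_(i < n) cabs g`_i.
Proof.
move=> sn; rewrite /pnorm -(big_mkord xpredT (fun i => cabs g`_i)).
rewrite -(big_mkord xpredT (fun i => cabs g`_i)) [RHS](big_cat_nat (n := size g))//=.
rewrite [X in _ + X]big1_seq ?addr0// => i; rewrite mem_index_iota => /andP[_ /andP[si _]].
by rewrite nth_default ?cabs0.
Qed.

Lemma pnormD p q : pnorm (p + q) <= pnorm p + pnorm q.
Proof.
set n := maxn (size p) (size q).
have sp : (size p <= n)%N by rewrite leq_maxl.
have sq : (size q <= n)%N by rewrite leq_maxr.
have spq : (size (p + q)%R <= n)%N by exact: size_polyD.
rewrite (pnormE spq) (pnormE sp) (pnormE sq) -big_split/=; apply: ler_sum => i _.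
by rewrite coefD cabsD.
Qed.

Lemma pnormZ (c : C) p : pnorm (c *: p) = cabs c * pnorm p.
Proof.
rewrite (pnormE (size_scale_leq c p)) /pnorm big_distrr/=; apply: eq_bigr => i _.
by rewrite coefZ cabsM.
Qed.

Lemma pnorm0 : pnorm (0 : {poly C}) = 0.
Proof. by rewrite /pnorm size_poly0 big_ord0. Qed.

Lemma pnormMX p : pnorm (p * 'X) = pnorm p.
Proof.
have [->|p0] := eqVneq p 0; first by rewrite mul0r.
rewrite /pnorm size_mulX// big_ord_recl/= [X in cabs X + _](_ : _ = 0) ?cabs0 ?add0r; last first.
  by rewrite coefMX.
by apply: eq_bigr => i _; rewrite coefMX.
Qed.

Lemma pnormC (c : C) : pnorm c%:P = cabs c.
Proof.
have s1 : (size c%:P <= 1)%N by exact: size_polyC_leq1.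
by rewrite (pnormE s1) big_ord1 coefC.
Qed.

Lemma pnormMXaddC p (c : C) : pnorm (p * 'X + c%:P) = pnorm p + cabs c.
Proof.
have sn : (size (p * 'X + c%:P)%R <= (size p).+1)%N.
  by rewrite size_MXaddC; case: ifP.
rewrite (pnormE sn) big_ord_recl/= [X in cabs X + _](_ : _ = c); last first.
  by rewrite coefD coefMX coefC/= add0r.
rewrite addrC; congr (_ + _).
by apply: eq_bigr => i _; rewrite coefD coefMX coefC/= addr0.
Qed.

Lemma pnormM p q : pnorm (p * q) <= pnorm p * pnorm q.
Proof.
elim/poly_ind: q => [|q c IH]; first by rewrite mulr0 pnorm0 mulr0.
rewrite pnormMXaddC mulrDr mulrA [p * c%:P]mulrC mul_polyC mulrDr.
apply: le_trans (pnormD _ _) _; rewrite pnormMX pnormZ lerD//.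
by rewrite mulrC.
Qed.

Lemma pnorm_sum I (r : seq I) (P : pred I) (F : I -> {poly C}) :
  pnorm (\sum_(i <- r | P i) F i) <= \sum_(i <- r | P i) pnorm (F i).
Proof.
elim/big_rec2: _ => [|i y x _ h]; first by rewrite pnorm0.
exact: le_trans (pnormD _ _) (lerD _ _).
Qed.

(* If [y = al + be * y], then [trunc D i] approximates [y ^ i]. *)
Fixpoint trunc (al be : {poly C}) (D i : nat) : {poly C} :=
  if D is D'.+1 then
    if i is i'.+1 then al * trunc al be D' i' + be * trunc al be D' i'.+1 else 1
  else if i is _.+1 then 0 else 1.

(** Unrolling y = al + be y once writes the error at depth D + 1 as a combination of two errors at
    depth D with total weight |al| + |be| <= rho. At depth 0 the error is 0 or |y^i| <= 1. *)
Lemma trunc_error al be (rho : R) t y D i : y = al.[t] + be.[t] * y -> cabs y <= 1 ->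
  cabs al.[t] + cabs be.[t] <= rho -> cabs (y ^+ i - (trunc al be D i).[t]) <= rho ^+ D.
Proof.
move=> ye y1 hr; have r0 : 0 <= rho by apply: le_trans hr; rewrite addr_ge0 ?cabs_ge0.
elim: D i => [|D IH] [|i] /=; rewrite ?expr0 ?hornerC ?subrr ?cabs0//.
- by rewrite subr0 cabsX exprn_ile1// cabs_ge0.
- exact: exprn_ge0.
have -> : y ^+ i.+1 - (al * trunc al be D i + be * trunc al be D i.+1).[t] =
    al.[t] * (y ^+ i - (trunc al be D i).[t]) + be.[t] * (y ^+ i.+1 - (trunc al be D i.+1).[t]).
  have e : y ^+ i.+1 = al.[t] * y ^+ i + be.[t] * y ^+ i.+1.
    by rewrite [LHS]exprS [X in X * _]ye mulrDl -mulrA -exprS.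
  by rewrite hornerD !hornerM [X in X - _ = _]e; ring.
apply: le_trans (cabsD _ _) _; rewrite !cabsM [rho ^+ _]exprS.
apply: le_trans (_ : (cabs al.[t] + cabs be.[t]) * rho ^+ D <= _).
  by rewrite mulrDl; apply: lerD; apply: ler_wpM2l; [exact: cabs_ge0|exact: IH|exact: cabs_ge0|exact: IH].
by rewrite ler_wpM2r// exprn_ge0.
Qed.

Lemma size_trunc al be D i : (size al <= 2)%N -> (size be <= 2)%N ->
  (size (trunc al be D i) <= D.+1)%N.
Proof.
move=> sa sb; elim: D i => [|D IH] [|i].
- by rewrite size_poly1.
- by rewrite /= size_poly0.
- by rewrite size_poly1.
rewrite [trunc _ _ _ _]/=.
have st (c : {poly C}) j : (size c <= 2)%N -> (size (c * trunc al be D j)%R <= D.+2)%N.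
  move=> sc; apply: leq_trans (size_polyMleq _ _) _.
  rewrite -subn1 leq_subLR add1n -[D.+3]/(2 + D.+1)%N.
  exact: leq_add sc (IH j).
by apply: leq_trans (size_polyD _ _) _; rewrite geq_max !st.
Qed.

Lemma pnorm_trunc al be (A : R) D i : 1 <= A -> pnorm al + pnorm be <= A ->
  pnorm (trunc al be D i) <= A ^+ D.
Proof.
move=> A1 hA; have A0 : 0 <= A by exact: le_trans A1.
elim: D i => [|D IH] [|i] /=; rewrite ?expr0 ?pnorm0 ?pnormC ?cabs1//.
  exact: exprn_ege1.
apply: le_trans (pnormD _ _) _; rewrite exprS.
apply: le_trans (_ : (pnorm al + pnorm be) * A ^+ D <= _); last by rewrite ler_wpM2r// exprn_ge0.
by rewrite mulrDl; apply: lerD; apply: le_trans (pnormM _ _) _; rewrite ler_wpM2l// pnorm_ge0.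
Qed.

(** An approximation of g (y) with y = al / (1 - be), each power of y being replaced by its
    truncation. *)
Definition tcomp al be (D : nat) g : {poly C} := \sum_(i < size g) g`_i *: trunc al be D i.

Lemma tcomp_error al be (rho : R) D g t y : y = al.[t] + be.[t] * y -> cabs y <= 1 ->
  cabs al.[t] + cabs be.[t] <= rho ->
  cabs (g.[y] - (tcomp al be D g).[t]) <= pnorm g * rho ^+ D.
Proof.
move=> ye y1 hr; rewrite horner_coef /tcomp horner_sum -sumrB.
apply: le_trans (cabs_sum _ _ _) _; rewrite /pnorm big_distrl/=; apply: ler_sum => i _.
by rewrite hornerZ -mulrBr cabsM ler_wpM2l ?cabs_ge0// (trunc_error _ _ ye).
Qed.

Lemma size_tcomp al be D g : (size al <= 2)%N -> (size be <= 2)%N ->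
  (size (tcomp al be D g) <= D.+1)%N.
Proof.
move=> sa sb; apply: (leq_trans (size_sum _ _ _)); apply/bigmax_leqP => i _.
exact: leq_trans (size_scale_leq _ _) (size_trunc _ _ sa sb).
Qed.

Lemma pnorm_tcomp al be (A : R) D g : 1 <= A -> pnorm al + pnorm be <= A ->
  pnorm (tcomp al be D g) <= pnorm g * A ^+ D.
Proof.
move=> A1 hA; apply: le_trans (pnorm_sum _ _ _) _.
rewrite [pnorm g]/pnorm big_distrl/=; apply: ler_sum => i _.
by rewrite pnormZ ler_wpM2l ?cabs_ge0// pnorm_trunc.
Qed.

Section Strip.
Variable k : nat.
Hypothesis k0 : (0 < k)%N.
Let d : R := k%:R^-1.
(** Poles on the real axis, from 2d on in steps of d = 1/k. The function to be approximated is 2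
    [xx] 0, which is 1 at the origin and at most 1/8 in modulus where |Im z| >= 16 d. *)
Let a (j : nat) : R := (j.+2)%:R * d.
Let xx (j : nat) z : C := d%:C%C / ((a j)%:C%C - z).

Let d0 : 0 < d. Proof. by rewrite invr_gt0 ltr0n. Qed.

(** The points where the approximation is controlled: the origin, for the normalization, and the
    complement of the strip. All poles stay at distance at least 2d from them. *)
Definition strip_good z := z = 0 \/ 16 * d <= `|Im z|.

Let good_dist j z : strip_good z -> j.+2%:R * d <= cabs ((a j)%:C%C - z) \/
  16 * d <= cabs ((a j)%:C%C - z).
Proof.
case=> [->|h].
  by left; rewrite subr0 cabs_real ger0_norm// mulr_ge0// ltW.
right; apply: le_trans h _; apply: le_trans (normIm_le_cabs _).
by rewrite cImD cImN /= sub0r normrN.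
Qed.

Let xx_le j z : strip_good z -> (cabs (xx j z) <= j.+2%:R^-1 \/ cabs (xx j z) <= 16^-1) /\
  (a j)%:C%C - z != 0.
Proof.
move=> gz; have p : 0 < cabs ((a j)%:C%C - z).
  by case: (good_dist j gz); apply: lt_le_trans; rewrite mulr_gt0// ltr0n.
split; last by rewrite -cabs_gt0.
rewrite /xx cabsM cabsV cabs_real gtr0_norm//.
by case: (good_dist j gz) => h; [left|right];
  rewrite ler_pdivrMr// mulrC ler_pdivlMr ?ltr0n// mulrC.
Qed.

Let xx_le1 j z : strip_good z -> cabs (xx j z) <= 1.
Proof.
move=> /xx_le -/(_ j)[[|] h _]; apply: le_trans h _; rewrite invf_le1 ?ltr0n ?ler1n//.
Qed.

Let xx_le3 j z : strip_good z -> cabs (xx j.+1 z) <= 3^-1.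
Proof.
move=> /xx_le -/(_ j.+1)[[|] h _]; apply: le_trans h _; rewrite lef_pV2 ?posrE ?ltr0n ?ler_nat//.
Qed.

Let xx_le16 j z : 16 * d <= `|Im z| -> cabs (xx j z) <= 16^-1.
Proof.
move=> h; have h2 : 16 * d <= cabs ((a j)%:C%C - z).
  apply: le_trans h _; apply: le_trans (normIm_le_cabs _).
  by rewrite cImD cImN /= sub0r normrN.
have p : 0 < cabs ((a j)%:C%C - z) by apply: lt_le_trans h2; rewrite mulr_gt0.
rewrite /xx cabsM cabsV cabs_real gtr0_norm// ler_pdivrMr// mulrC ler_pdivlMr//.
by rewrite mulrC.
Qed.

Let xx_step j z : strip_good z -> xx j z = xx j.+1 z + xx j.+1 z * xx j z.
Proof.
move=> gz; have [_ h1] := xx_le j gz; have [_ h2] := xx_le j.+1 gz.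
have e : (a j.+1)%:C%C = (a j)%:C%C + d%:C%C :> C.
  by rewrite -raddfD /a -[in LHS]natr1 mulrDl mul1r.
rewrite /xx e in h2 *; field.
by rewrite h1 /=; move: h2; rewrite addrAC.
Qed.

(* [xx J = xx J.+1 * (1 + xx J)]: a polynomial in [xx J] is, up to a small error, a
   polynomial in [xx J.+1], so the pole moves from [a J] to [a J.+1]. *)
Lemma shift_poles J : exists g : {poly C}, [/\ (size g <= (16 ^ J).+1)%N,
  pnorm g <= 4 ^+ (16 ^ J) &
  forall z, strip_good z -> cabs (g.[xx J z] - 2 * xx 0 z) <= (1 - 2 ^- J) / 16].
Proof.
elim: J => [|J [g [sg ng hg]]].
  exists (2 *: 'X); rewrite expn0 expr1; split.
  - by apply: leq_trans (size_scale_leq _ _) _; rewrite size_polyX.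
  - rewrite pnormZ -['X]mul1r pnormMX -polyC1 pnormC cabs1 mulr1 cabs_nat.
    by rewrite ler_nat.
  - by move=> z _; rewrite hornerZ hornerX subrr cabs0 expr0 invr1 subrr mul0r.
exists (tcomp 'X 'X (16 ^ J.+1) g).
have nX : pnorm ('X : {poly C}) + pnorm ('X : {poly C}) <= 2.
  by rewrite -['X]mul1r pnormMX -polyC1 pnormC cabs1.
split.
- by apply: size_tcomp; rewrite size_polyX.
- apply: le_trans (pnorm_tcomp _ _ (ler1n _ 2) nX) _.
  apply: le_trans (_ : 4 ^+ (16 ^ J) * 2 ^+ (16 ^ J.+1) <= _).
    by rewrite ler_wpM2r// exprn_ge0.
  rewrite expnS; set N := (16 ^ J)%N.
  have -> : 4 = 2 ^+ 2 :> R by rewrite -natrX.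
  rewrite -!exprM -exprD ler_weXn2l ?ler1n//.
  by rewrite -mulnDl mulnA leq_mul2r orbT.
- move=> z gz.
  (* With al = be = ['X] evaluated at [xx J.+1], the contraction factor is 2 |[xx J.+1]| <= 2/3,
     because the pole [a J.+1] is at least 3d away. *)
  have E := @tcomp_error 'X 'X (2 / 3) (16 ^ J.+1) g (xx J.+1 z) (xx J z).
  have {}E : cabs (g.[xx J z] - (tcomp 'X 'X (16 ^ J.+1) g).[xx J.+1 z]) <=
      pnorm g * (2 / 3) ^+ (16 ^ J.+1).
    apply: E; rewrite ?hornerX; [exact: xx_step|exact: xx_le1|].
    by have := xx_le3 J gz; lra.
  have h := hg z gz.
  have {}E : cabs (g.[xx J z] - (tcomp 'X 'X (16 ^ J.+1) g).[xx J.+1 z]) <= 2 ^- J.+1 / 16.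
    apply: le_trans E _; apply: le_trans (_ : 4 ^+ (16 ^ J) * (2 / 3) ^+ (16 ^ J.+1) <= _).
      by rewrite ler_wpM2r// exprn_ge0.
    rewrite expnS exprM -exprMn.
    have q0 : 0 <= 4 * (2 / 3) ^+ 16 :> R by [].
    (* The ratio 16 between successive depths is chosen for this: sixteen factors 2/3 beat one
       factor 4 of the norm bound, with enough left to make the errors summable over J. *)
    have q1 : 4 * (2 / 3) ^+ 16 <= 32^-1 :> R by rewrite exprMn exprVn; lra.
    have q2 : 4 * (2 / 3) ^+ 16 <= 1 :> R by lra.
    apply: le_trans (_ : (4 * (2 / 3) ^+ 16) ^+ J.+1 <= _).
      by rewrite ler_wiXn2l// ltn_expl.
    rewrite (exprS (4 * _)) (exprS 2).
    have q3 : (4 * (2 / 3) ^+ 16) ^+ J <= 2^-1 ^+ J :> R.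
      by apply: lerXn2r; rewrite ?nnegrE//; lra.
    have q4 : 0 <= (2^-1) ^+ J :> R by rewrite exprn_ge0.
    have q5 : 0 <= (4 * (2 / 3) ^+ 16) ^+ J :> R by rewrite exprn_ge0.
    have -> : (2 * 2 ^+ J)^-1 / 16 = 32^-1 * 2^-1 ^+ J :> R.
      by rewrite invfM -exprVn; lra.
exact: (ler_pM q0 q5 q1 q3).
  have T := cabsD ((tcomp 'X 'X (16 ^ J.+1) g).[xx J.+1 z] - g.[xx J z]) (g.[xx J z] - 2 * xx 0 z).
  rewrite addrA subrK in T; apply: le_trans T _; rewrite cabsB in E.
  have : 2 ^- J = 2 * 2 ^- J.+1 :> R by rewrite exprS invfM mulrA divff ?mul1r.
  lra.
Qed.

(** After 4k steps of length 1/k the pole lies beyond 4. There y = d / (a_J - z) solves y = d / a_J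
    + (z / a_J) y with contraction factor at most 1/2 on the unit disk, so one more truncation
    yields a polynomial in z. Its value at 0 is within 1/8 of 1, and dividing by it normalizes. *)
Lemma strip_polynomial : exists H : {poly C}, [/\ H.[0] = 1,
  (size H <= (16 ^ (4 * k).+1).+1)%N, pnorm H <= 4 ^+ (16 ^ (4 * k).+1) &
  forall z, cabs z <= 1 -> 16 * d <= `|Im z| -> cabs H.[z] <= 2^-1].
Proof.
set J := (4 * k)%N; have [g [sg ng hg]] := shift_poles J.
have aJ : 4 <= a J.
  by rewrite /a ler_pdivlMr ?ltr0n// -natrM ler_nat /J ltnW.
have d1 : d <= 1 by rewrite invf_le1 ?ltr0n// ler1n.
pose al : {poly C} := (d / a J)%:C%C%:P.
pose be : {poly C} := ((a J)^-1)%:C%C *: 'X.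
pose D := (16 ^ J.+1)%N.
pose H0 := tcomp al be D g.
have nal : pnorm al = d / a J by rewrite pnormC cabs_real ger0_norm// divr_ge0 ?(ltW d0)//; lra.
have nX : pnorm ('X : {poly C}) = 1 by rewrite -['X]mul1r pnormMX -polyC1 pnormC cabs1.
have aV0 : 0 <= (a J)^-1 by rewrite invr_ge0; lra.
have nbe : pnorm be = (a J)^-1 by rewrite pnormZ nX mulr1 cabs_real ger0_norm.
have aV : (a J)^-1 <= 4^-1 by rewrite lef_pV2 ?posrE//; lra.
have sal : (size al <= 2)%N by apply: leq_trans (size_polyC_leq1 _) _.
have sbe : (size be <= 2)%N by apply: leq_trans (size_scale_leq _ _) _; rewrite size_polyX.
have dV : d / a J <= (a J)^-1 by rewrite ler_piMl.
have nH0 : pnorm H0 <= 4 ^+ (16 ^ J).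
  apply: le_trans (pnorm_tcomp _ _ (lexx 1) _) _; first by rewrite nal nbe; lra.
  by rewrite expr1n mulr1.
have E z : cabs z <= 1 -> strip_good z -> cabs (H0.[z] - 2 * xx 0 z) <= 8^-1.
  move=> z1 gz; have [_ nz] := xx_le J gz.
  have aJ0 : (a J)%:C%C != 0 :> C.
    by rewrite -cabs_gt0 cabs_real gtr0_norm; lra.
  have h1 : cabs (g.[xx J z] - H0.[z]) <= pnorm g * 2^-1 ^+ D.
    apply: tcomp_error.
    - have e2 : ((a J)^-1)%:C%C = ((a J)%:C%C)^-1 :> C by rewrite fmorphV.
      have e1 : (d / a J)%:C%C = d%:C%C / (a J)%:C%C :> C by rewrite rmorphM /= e2.
      rewrite /al /be hornerC hornerZ hornerX /xx e1 e2.
      move: nz aJ0; move: (a J)%:C%C d%:C%C => A B nz aJ0.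
      by field; rewrite nz aJ0.
    - exact: xx_le1.
    - rewrite /al /be hornerC hornerZ hornerX cabsM !cabs_real !ger0_norm//; last by rewrite divr_ge0 ?(ltW d0)//; lra.
      have : (a J)^-1 * cabs z <= (a J)^-1 by rewrite ler_piMr.
      by lra.
  have h2 : pnorm g * 2^-1 ^+ D <= 16^-1.
    apply: le_trans (_ : 4 ^+ (16 ^ J) * 2^-1 ^+ D <= _); first by rewrite ler_wpM2r// exprn_ge0.
    rewrite /D expnS exprM -exprMn.
    apply: le_trans (_ : (4 * 2^-1 ^+ 16) ^+ 1 <= _); last by rewrite expr1 exprVn; lra.
    by rewrite ler_wiXn2l// ?expn_gt0// exprVn; lra.
  have h3 := hg z gz.
  have J0 : 0 <= 2 ^- J :> R by rewrite invr_ge0 exprn_ge0.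
  have T := cabsD (H0.[z] - g.[xx J z]) (g.[xx J z] - 2 * xx 0 z).
  by rewrite addrA subrK in T; rewrite cabsB in h1; lra.
have g0 : strip_good 0 by left.
have x00 : 2 * xx 0 0 = 1.
  rewrite /xx subr0 /a rmorphM/= rmorph_nat.
  have dn0 : d%:C%C != 0 :> C by rewrite -cabs_gt0 cabs_real gtr0_norm.
  by field.
have E0 := E 0 _ g0; rewrite cabs0 x00 in E0; have {}E0 := E0 ler01.
have H0b : 7 / 8 <= cabs H0.[0].
  have := cabsD (- (H0.[0] - 1)) H0.[0]; rewrite opprB subrK cabs1 cabsB; lra.
exists (H0.[0]^-1 *: H0); split.
- by rewrite hornerZ mulVf// -cabs_gt0; lra.
- exact: leq_trans (size_scale_leq _ _) (size_tcomp _ _ _ _).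
- rewrite pnormZ cabsV; apply: le_trans (_ : (7 / 8)^-1 * 4 ^+ (16 ^ J) <= _).
    by apply: ler_pM; rewrite ?invr_ge0 ?cabs_ge0 ?pnorm_ge0// lef_pV2// posrE; lra.
  (* The factor 8/7 due to the normalization is absorbed by passing from the exponent 16^J to
     16^(J+1). *)
  rewrite expnS mulnC exprM.
  have N1 : 1 <= 4 ^+ (16 ^ J) :> R by rewrite exprn_ege1//; lra.
  rewrite (exprSr _ 15) ; set X := 4 ^+ _ in N1 *.
  have X15 : 4 <= X ^+ 15.
    have X4 : 4 <= X by rewrite /X -[leLHS]expr1 ler_weXn2l ?expn_gt0// ler1n.
    by apply: le_trans X4 _; rewrite -[leLHS]expr1 ler_weXn2l.
  nra.
- move=> z z1 iz; rewrite hornerZ cabsM cabsV.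
  have Ez := E z z1 (or_intror iz).
  have h := xx_le16 0 iz.
have T := cabsD (H0.[z] - 2 * xx 0 z) (2 * xx 0 z).
rewrite subrK cabsM cabs_nat in T.
have H0n : cabs H0.[0] != 0 by rewrite gt_eqF//; lra.
rewrite mulrC ler_pdivrMr; lra.
Qed.

End Strip.
End PoleShift.

(** * Cauchy estimates by averaging over roots of unity *)

Section CoefficientBound.
Variable R : realType.
Local Notation C := R[i].
Implicit Types (f g p : {poly C}) (z w : C).

Lemma prim_root_exists n : (0 < n)%N -> exists w : C, n.-primitive_root w.
Proof.
pose p : {poly C} := 'X^n - 1; have [r Dp] := closed_field_poly_normal p.
move=> n_gt0; rewrite (monicP _) ?monicXnsubC // scale1r in Dp.
have rn1 : all n.-unity_root r by apply/allP=> z; rewrite -root_prod_XsubC -Dp.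
have sz_r : (n < (size r).+1)%N by rewrite -(size_prod_XsubC r id) -Dp size_XnsubC.
have [|z] := hasP (cyclic.has_prim_root n_gt0 rn1 _ sz_r); last by exists z.
by rewrite -separable.separable_prod_XsubC -Dp cyclotomic.separable_Xn_sub_1 // pnatr_eq0 -lt0n.
Qed.

Lemma cabs_prim_root n w : n.-primitive_root w -> cabs w = 1.
Proof.
move=> pw; have n0 := prim_order_gt0 pw.
have /(congr1 (@cabs R)) := prim_expr_order pw; rewrite cabsX cabs1 => /eqP.
by rewrite pexpr_eq1 ?cabs_ge0// => /eqP.
Qed.

Lemma sum_prim_root n w k : n.-primitive_root w ->
  \sum_(j < n) (w ^+ k) ^+ j = if (n %| k)%N then n%:R else 0.
Proof.
move=> pw; case: ifPn => [nk|nk].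
  have /eqP-> : w ^+ k == 1 by rewrite -(prim_order_dvd pw).
  rewrite (eq_bigr (fun=> 1)) ?sumr_const ?card_ord// => j _; by rewrite expr1n.
have w1 : w ^+ k - 1 != 0 by rewrite subr_eq0 -(prim_order_dvd pw).
apply: (mulfI w1); rewrite mulr0 -subrX1 exprAC (prim_expr_order pw) expr1n subrr.
by [].
Qed.

(** A discrete Cauchy formula: for n above the degree, averaging f (r w^j) w^(-jk) over the n-th
    roots of unity isolates the coefficient of index k exactly. The exponent n - k stands for -k. *)
Lemma coef_le f (r m : R) k : 0 <= r -> (forall z, cabs z = r -> cabs f.[z] <= m) ->
  cabs f`_k * r ^+ k <= m.
Proof.
move=> r0 fm.
have m0 : 0 <= m by apply: le_trans (cabs_ge0 _) (fm r%:C%C _); rewrite cabs_real ger0_norm.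
have [kf|kf] := leqP (size f) k; first by rewrite nth_default// cabs0 mul0r.
set n := size f in kf; have n0 : (0 < n)%N by exact: leq_trans kf.
have [w pw] := prim_root_exists n0.
have w1 := cabs_prim_root pw.
have E : \sum_(j < n) f.[r%:C%C * w ^+ j] * (w ^+ (n - k)) ^+ j = n%:R * (f`_k * r%:C%C ^+ k).
  transitivity (\sum_(i < n) \sum_(j < n) f`_i * r%:C%C ^+ i * (w ^+ (i + (n - k))) ^+ j).
    rewrite exchange_big/=; apply: eq_bigr => j _; rewrite horner_coef big_distrl/=.
    apply: eq_bigr => i _; rewrite exprMn -!exprM -!mulrA; congr (_ * (_ * _)).
    by rewrite -exprD; congr (_ ^+ _); rewrite mulnDl mulnC.
  rewrite (bigD1 (Ordinal kf))//= [X in _ + X]big1 ?addr0; last first.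
    move=> i ik; rewrite -big_distrr/= sum_prim_root// ifN ?mulr0//.
    apply: contra ik => d; apply/eqP/val_inj => /=.
    have d2 : (n %| i + n - k)%N by rewrite -addnBA ?(ltnW kf).
    have ii : (i < n)%N by exact: ltn_ord.
    have [ik|ki] := ltnP i k.
      have : (0 < i + (n - k) < n)%N by rewrite addn_gt0 subn_gt0 kf orbT -[X in (_ < X)%N](subnKC (ltnW kf)) ltn_add2r.
      by move=> /andP[h1 h2]; move: (dvdn_leq h1 d); rewrite leqNgt h2.
    have e : (i + (n - k) = (i - k) + n)%N by rewrite addnBA ?(ltnW kf)// addnBAC.
    have : (n %| i - k)%N by move: d; rewrite e dvdn_addl.
    have : (i - k < n)%N by apply: leq_ltn_trans ii; exact: leq_subr.
    case: (posnP (i - k)) => [|h h1 h2]; last by move: (dvdn_leq h h2); rewrite leqNgt h1.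
    by move=> /eqP; rewrite subn_eq0 => ik _ _; apply/eqP; rewrite eqn_leq ik ki.
  by rewrite -big_distrr/= subnKC ?(ltnW kf)// sum_prim_root// dvdnn mulrC.
have nR : 0 < n%:R :> R by rewrite ltr0n.
rewrite -(ler_pM2l nR).
have -> : n%:R * (cabs f`_k * r ^+ k) = cabs (n%:R * (f`_k * r%:C%C ^+ k)).
  by rewrite !cabsM cabsX cabs_real ger0_norm// cabs_nat.
rewrite -E; apply: le_trans (cabs_sum _ _ _) _.
apply: le_trans (_ : \sum_(j < n) m <= _); last by rewrite sumr_const card_ord mulr_natl.
apply: ler_sum => j _; rewrite cabsM !cabsX w1 !expr1n mulr1.
by apply: fm; rewrite cabsM cabsX w1 expr1n mulr1 cabs_real ger0_norm.
Qed.

Lemma geom_half (t : R) n : 0 <= t -> t <= 2^-1 -> \sum_(i < n) t ^+ i.+1 <= 2 * t.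
Proof.
move=> t0 t1; suff : \sum_(i < n) t ^+ i.+1 <= 2 * t - 2 * t ^+ n.+1.
  by have := exprn_ge0 n.+1 t0; lra.
elim: n => [|n IH]; first by rewrite big_ord0 expr1 subrr.
rewrite big_ord_recr/=; have : t ^+ n.+2 <= 2^-1 * t ^+ n.+1.
  by rewrite exprS ler_wpM2r// exprn_ge0.
by move: IH; lra.
Qed.

(** The Cauchy estimates for the nonconstant terms sum to a geometric series of ratio t <= 1/2. *)
Lemma horner_near0 f (r m t : R) z : 0 < r -> (forall z, cabs z = r -> cabs f.[z] <= m) ->
  0 <= t -> t <= 2^-1 -> cabs z <= t * r -> cabs (f.[z] - f.[0]) <= 2 * t * m.
Proof.
move=> r0 fm t0 t1 zt.
have m0 : 0 <= m by apply: le_trans (cabs_ge0 _) (fm r%:C%C _); rewrite cabs_real ger0_norm// ltW.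
rewrite horner_coef0 (horner_coef_wide z (leqnSn (size f))) big_ord_recl expr0 mulr1.
rewrite addrAC subrr add0r; apply: le_trans (cabs_sum _ _ _) _.
apply: le_trans (_ : \sum_(i < size f) m * t ^+ i.+1 <= _); last first.
  by rewrite -big_distrr/= mulrC ler_wpM2r// geom_half.
apply: ler_sum => i _; rewrite lift0 cabsM cabsX.
apply: le_trans (_ : cabs f`_i.+1 * (t * r) ^+ i.+1 <= _).
  by rewrite ler_wpM2l ?cabs_ge0// lerXn2r ?nnegrE ?cabs_ge0 ?mulr_ge0// ltW.
rewrite exprMn mulrCA mulrC ler_wpM2r ?exprn_ge0//.
exact: coef_le (ltW r0) fm.
Qed.
End CoefficientBound.

(** * Circle means *)

Section PolyExp.
Variable R : realType.
Implicit Types (g : {poly R[i]}) (x y : R).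

Lemma is_deriveD' (f h : R -> R) (t a b : R) : is_derive t 1 f a -> is_derive t 1 h b ->
  is_derive t 1 (fun s => f s + h s) (a + b).
Proof. by move=> df dh; exact: (is_deriveD df dh). Qed.

Lemma is_deriveM' (f h : R -> R) (t a b : R) : is_derive t 1 f a -> is_derive t 1 h b ->
  is_derive t 1 (fun s => f s * h s) (a * h t + f t * b).
Proof.
move=> df dh; have := is_deriveM df dh.
by congr is_derive; rewrite /GRing.scale/= addrC mulrC.
Qed.

Lemma is_deriveZ' (c : R) (f : R -> R) (t a : R) : is_derive t 1 f a ->
  is_derive t 1 (fun s => c * f s) (c * a).
Proof. by move=> df; exact: (is_deriveZ c df). Qed.

Lemma is_deriveN' (f : R -> R) (t a : R) : is_derive t 1 f a ->
  is_derive t 1 (fun s => - f s) (- a).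
Proof. by move=> df; exact: (is_deriveN df). Qed.

Lemma is_derive_eq' (f : R -> R) (t a b : R) : is_derive t 1 f a -> a = b ->
  is_derive t 1 f b.
Proof. by move=> h <-. Qed.

Lemma is_derive_comp' (f h : R -> R) (t a b : R) : is_derive (h t) 1 f a ->
  is_derive t 1 h b -> is_derive t 1 (fun s => f (h s)) (a * b).
Proof. exact: is_derive1_comp. Qed.

Definition PU g x y := Re g.[expi x y].
Definition PV g x y := Im g.[expi x y].
(** The operator z d/dz. The x-derivative of g (e^(x+iy)) is [Dp g] at the same point and the
    y-derivative is i times that, so differentiation never leaves the polynomials. *)
Definition Dp g : {poly R[i]} := g^`() * 'X.

Lemma PU_step g c x y :
  PU (g * 'X + c%:P) x y =
  PU g x y * (expR x * cos y) - PV g x y * (expR x * sin y) + Re c.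
Proof. by rewrite /PU /PV hornerMXaddC cReD cReM. Qed.

Lemma PV_step g c x y :
  PV (g * 'X + c%:P) x y =
  PU g x y * (expR x * sin y) + PV g x y * (expR x * cos y) + Im c.
Proof. by rewrite /PU /PV hornerMXaddC cImD cImM. Qed.

Lemma Dp_step g c : Dp (g * 'X + c%:P) = (Dp g + g) * 'X + 0%:P.
Proof. by rewrite /Dp derivMXaddC addr0 addrC. Qed.

Lemma PUD g h x y : PU (g + h) x y = PU g x y + PU h x y.
Proof. by rewrite /PU hornerD cReD. Qed.

Lemma PVD g h x y : PV (g + h) x y = PV g x y + PV h x y.
Proof. by rewrite /PV hornerD cImD. Qed.

Lemma PU0 x y : PU 0 x y = 0. Proof. by rewrite /PU horner0. Qed.
Lemma PV0 x y : PV 0 x y = 0. Proof. by rewrite /PV horner0. Qed.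

Lemma is_derive_cst' (c t : R) : is_derive t 1 (fun=> c) 0.
Proof. exact: is_derive_cst. Qed.

Lemma is_derive_expcos_x y x : is_derive x 1 (fun s => expR s * cos y) (expR x * cos y).
Proof.
apply: is_derive_eq' (is_deriveM' (is_derive_expR x) (is_derive_cst' (cos y) x)) _.
by rewrite mulr0 addr0.
Qed.

Lemma is_derive_expsin_x y x : is_derive x 1 (fun s => expR s * sin y) (expR x * sin y).
Proof.
apply: is_derive_eq' (is_deriveM' (is_derive_expR x) (is_derive_cst' (sin y) x)) _.
by rewrite mulr0 addr0.
Qed.

(** The Horner step mixes real and imaginary parts, hence the joint induction. *)
Lemma PUV_dx g x y : is_derive x 1 (PU g ^~ y) (PU (Dp g) x y) /\
  is_derive x 1 (PV g ^~ y) (PV (Dp g) x y).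
Proof.
elim/poly_ind: g => [|g c [IU IV]].
  rewrite /Dp linear0 mul0r PU0 PV0.
  rewrite (_ : PU 0 ^~ y = fun=> 0); last by apply/funext => s; rewrite PU0.
  rewrite (_ : PV 0 ^~ y = fun=> 0); last by apply/funext => s; rewrite PV0.
  by split; exact: is_derive_cst'.
have C := is_derive_expcos_x y x; have S := is_derive_expsin_x y x.
split.
- rewrite (_ : PU (g * 'X + c%:P) ^~ y = fun s =>
    PU g s y * (expR s * cos y) + - (PV g s y * (expR s * sin y)) + Re c); last first.
    by apply/funext => s; rewrite PU_step.
  apply: is_derive_eq' (is_deriveD' (is_deriveD' (is_deriveM' IU C) (is_deriveN' (is_deriveM' IV S))) (is_derive_cst' _ _)) _.
  by rewrite Dp_step PU_step PUD PVD /=; ring.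
- rewrite (_ : PV (g * 'X + c%:P) ^~ y = fun s =>
    PU g s y * (expR s * sin y) + PV g s y * (expR s * cos y) + Im c); last first.
    by apply/funext => s; rewrite PV_step.
  apply: is_derive_eq' (is_deriveD' (is_deriveD' (is_deriveM' IU S) (is_deriveM' IV C)) (is_derive_cst' _ _)) _.
  by rewrite Dp_step PV_step PUD PVD /=; ring.
Qed.

Lemma is_derive_expcos_y x y : is_derive y 1 (fun s => expR x * cos s) (- (expR x * sin y)).
Proof.
apply: is_derive_eq' (is_deriveZ' (expR x) (is_derive_cos y)) _.
by rewrite mulrN.
Qed.

Lemma is_derive_expsin_y x y : is_derive y 1 (fun s => expR x * sin s) (expR x * cos y).
Proof. exact: (is_deriveZ' (expR x) (is_derive_sin y)). Qed.

Lemma PUV_dy g x y : is_derive y 1 (PU g x) (- PV (Dp g) x y) /\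
  is_derive y 1 (PV g x) (PU (Dp g) x y).
Proof.
elim/poly_ind: g => [|g c [IU IV]].
  rewrite /Dp linear0 mul0r PU0 PV0 oppr0.
  rewrite (_ : PU 0 x = fun=> 0); last by apply/funext => s; rewrite PU0.
  rewrite (_ : PV 0 x = fun=> 0); last by apply/funext => s; rewrite PV0.
  by split; exact: is_derive_cst'.
have C := is_derive_expcos_y x y; have S := is_derive_expsin_y x y.
split.
- rewrite (_ : PU (g * 'X + c%:P) x = fun s =>
    PU g x s * (expR x * cos s) + - (PV g x s * (expR x * sin s)) + Re c); last first.
    by apply/funext => s; rewrite PU_step.
  apply: is_derive_eq' (is_deriveD' (is_deriveD' (is_deriveM' IU C) (is_deriveN' (is_deriveM' IV S))) (is_derive_cst' _ _)) _.
  by rewrite Dp_step PV_step PUD PVD /=; ring.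
- rewrite (_ : PV (g * 'X + c%:P) x = fun s =>
    PU g x s * (expR x * sin s) + PV g x s * (expR x * cos s) + Im c); last first.
    by apply/funext => s; rewrite PV_step.
  apply: is_derive_eq' (is_deriveD' (is_deriveD' (is_deriveM' IU S) (is_deriveM' IV C)) (is_derive_cst' _ _)) _.
  by rewrite Dp_step PU_step PUD PVD /=; ring.
Qed.

Lemma PU_dx g x y : is_derive x 1 (PU g ^~ y) (PU (Dp g) x y).
Proof. by have [] := PUV_dx g x y. Qed.
Lemma PV_dx g x y : is_derive x 1 (PV g ^~ y) (PV (Dp g) x y).
Proof. by have [] := PUV_dx g x y. Qed.
Lemma PU_dy g x y : is_derive y 1 (PU g x) (- PV (Dp g) x y).
Proof. by have [] := PUV_dy g x y. Qed.
Lemma PV_dy g x y : is_derive y 1 (PV g x) (PU (Dp g) x y).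
Proof. by have [] := PUV_dy g x y. Qed.

Lemma cont2_cst (c : R) : cont2 (fun _ _ : R => c).
Proof. by move=> p; exact: cvg_cst. Qed.

Lemma cont2D (F G : R -> R -> R) : cont2 F -> cont2 G -> cont2 (fun x y => F x y + G x y).
Proof. by move=> cF cG p; apply: cvgD; [exact: cF|exact: cG]. Qed.

Lemma cont2M (F G : R -> R -> R) : cont2 F -> cont2 G -> cont2 (fun x y => F x y * G x y).
Proof. by move=> cF cG p; apply: cvgM; [exact: cF|exact: cG]. Qed.

Lemma cont2N (F : R -> R -> R) : cont2 F -> cont2 (fun x y => - F x y).
Proof. by move=> cF p; apply: cvgN; exact: cF. Qed.

Lemma cont2_comp (om : R -> R) (F : R -> R -> R) : cont2 F ->
  (forall x y, {for F x y, continuous om}) -> cont2 (fun x y => om (F x y)).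
Proof.
move=> cF co p; apply: (@continuous_comp _ _ _ (fun p : R * R => F p.1 p.2) om); first exact: cF.
exact: co.
Qed.

Lemma cont2_fst (f : R -> R) : continuous f -> cont2 (fun x _ => f x).
Proof.
move=> cf p; apply: (@continuous_comp _ _ _ (@fst R R) f); last exact: cf.
exact: cvg_fst.
Qed.

Lemma cont2_snd (f : R -> R) : continuous f -> cont2 (fun _ y => f y).
Proof.
move=> cf p; apply: (@continuous_comp _ _ _ (@snd R R) f); last exact: cf.
exact: cvg_snd.
Qed.

Lemma cont2_PUV g : cont2 (PU g) /\ cont2 (PV g).
Proof.
elim/poly_ind: g => [|g c [IU IV]].
  rewrite (_ : PU 0 = fun _ _ => 0); last by apply/funext => s; apply/funext => t; rewrite PU0.
  rewrite (_ : PV 0 = fun _ _ => 0); last by apply/funext => s; apply/funext => t; rewrite PV0.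
  by split; exact: cont2_cst.
have C : cont2 (fun x y : R => expR x * cos y).
  by apply: cont2M; [apply: cont2_fst; exact: continuous_expR|apply: cont2_snd; exact: continuous_cos].
have S : cont2 (fun x y : R => expR x * sin y).
  by apply: cont2M; [apply: cont2_fst; exact: continuous_expR|apply: cont2_snd; exact: continuous_sin].
split.
- rewrite (_ : PU _ = fun x y =>
    PU g x y * (expR x * cos y) + - (PV g x y * (expR x * sin y)) + Re c); last first.
    by apply/funext => s; apply/funext => t; rewrite PU_step.
  apply: cont2D; last exact: cont2_cst.
  by apply: cont2D; [exact: cont2M|apply: cont2N; exact: cont2M].
- rewrite (_ : PV _ = fun x y =>
    PU g x y * (expR x * sin y) + PV g x y * (expR x * cos y) + Im c); last first.
    by apply/funext => s; apply/funext => t; rewrite PV_step.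
  apply: cont2D; last exact: cont2_cst.
  by apply: cont2D; exact: cont2M.
Qed.

Lemma cont2_PU g : cont2 (PU g). Proof. by have [] := cont2_PUV g. Qed.
Lemma cont2_PV g : cont2 (PV g). Proof. by have [] := cont2_PUV g. Qed.

Lemma PU_period g x : PU g x (2 * pi) = PU g x 0.
Proof. by rewrite /PU -[X in expi x X]add0r expi_period. Qed.
Lemma PV_period g x : PV g x (2 * pi) = PV g x 0.
Proof. by rewrite /PV -[X in expi x X]add0r expi_period. Qed.

Definition sq g x y := PU g x y * PU g x y + PV g x y * PV g x y.

Lemma sqE g x y : sq g x y = cabs g.[expi x y] ^+ 2.
Proof. by rewrite cabs_sqr !expr2. Qed.

Lemma sq_ge0 g x y : 0 <= sq g x y.
Proof. by rewrite sqE sqr_ge0. Qed.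

Lemma cont2_sq g : cont2 (sq g).
Proof. by apply: cont2D; apply: cont2M; (exact: cont2_PU || exact: cont2_PV). Qed.

End PolyExp.

Section CircleMeans.
Variable R : realType.
Implicit Types (g : {poly R[i]}) (x y : R).

Lemma is_derive_continuous (f : R -> R) (t a : R) : is_derive t 1 f a -> {for t, continuous f}.
Proof.
move=> df; apply/differentiable_continuous/derivable1_diffP; exact: ex_derive.
Qed.

(** [Kx] and - [Ky] are the real and imaginary parts of conj(g) [Dp g], which explains [Kxy]; [Kx]
    and [Ky] are half the partial derivatives of |g|^2. *)
Definition Kx g x y := PU g x y * PU (Dp g) x y + PV g x y * PV (Dp g) x y.
Definition Ky g x y := PV g x y * PU (Dp g) x y - PU g x y * PV (Dp g) x y.

Lemma sq_dx g x y : is_derive x 1 (sq g ^~ y) (2 * Kx g x y).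
Proof.
have U := PU_dx g x y; have V := PV_dx g x y.
apply: is_derive_eq' (is_deriveD' (is_deriveM' U U) (is_deriveM' V V)) _.
by rewrite /Kx; ring.
Qed.

Lemma sq_dy g x y : is_derive y 1 (sq g x) (2 * Ky g x y).
Proof.
have U := PU_dy g x y; have V := PV_dy g x y.
apply: is_derive_eq' (is_deriveD' (is_deriveM' U U) (is_deriveM' V V)) _.
by rewrite /Ky; ring.
Qed.

Lemma Kx_dx g x y : is_derive x 1 (Kx g ^~ y)
  (sq (Dp g) x y + PU g x y * PU (Dp (Dp g)) x y + PV g x y * PV (Dp (Dp g)) x y).
Proof.
have U := PU_dx g x y; have V := PV_dx g x y.
have U1 := PU_dx (Dp g) x y; have V1 := PV_dx (Dp g) x y.
apply: is_derive_eq' (is_deriveD' (is_deriveM' U U1) (is_deriveM' V V1)) _.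
by rewrite /sq; ring.
Qed.

Lemma Ky_dy g x y : is_derive y 1 (Ky g x)
  (sq (Dp g) x y - PU g x y * PU (Dp (Dp g)) x y - PV g x y * PV (Dp (Dp g)) x y).
Proof.
have U := PU_dy g x y; have V := PV_dy g x y.
have U1 := PU_dy (Dp g) x y; have V1 := PV_dy (Dp g) x y.
apply: is_derive_eq' (is_deriveD' (is_deriveM' V U1) (is_deriveN' (is_deriveM' U V1))) _.
by rewrite /sq; ring.
Qed.

Lemma Kxy g x y : Kx g x y ^+ 2 + Ky g x y ^+ 2 = sq g x y * sq (Dp g) x y.
Proof. by rewrite /Kx /Ky /sq; ring. Qed.

Variables om om1 om2 : R -> R.
Hypothesis d1 : forall t : R, 0 <= t -> is_derive t 1 om (om1 t).
Hypothesis d2 : forall t : R, 0 <= t -> is_derive t 1 om1 (om2 t).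
Hypothesis c2 : forall t : R, 0 <= t -> {for t, continuous om2}.

Definition cmean g x := cint 0 (2 * pi) (fun y => om (sq g x y)).
Definition cmean1 g x := cint 0 (2 * pi) (fun y => om1 (sq g x y) * (2 * Kx g x y)).
(** The integrand is the Laplacian of om (|g|^2) in the variables x, y. *)
Definition cmean2 g x := cint 0 (2 * pi)
  (fun y => 4 * (sq (Dp g) x y * (om2 (sq g x y) * sq g x y + om1 (sq g x y)))).

Lemma cont2_om (f : R -> R) g : (forall t, 0 <= t -> {for t, continuous f}) ->
  cont2 (fun x y => f (sq g x y)).
Proof. by move=> cf; apply: cont2_comp; [exact: cont2_sq|move=> x y; apply: cf; exact: sq_ge0]. Qed.

Lemma cont_om t : 0 <= t -> {for t, continuous om}.
Proof. by move=> t0; exact: is_derive_continuous (d1 t0). Qed.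
Lemma cont_om1 t : 0 <= t -> {for t, continuous om1}.
Proof. by move=> t0; exact: is_derive_continuous (d2 t0). Qed.

Lemma cont2_Kx g : cont2 (Kx g).
Proof. by apply: cont2D; apply: cont2M; (exact: cont2_PU || exact: cont2_PV). Qed.

Lemma cont2Z (c : R) (F : R -> R -> R) : cont2 F -> cont2 (fun x y => c * F x y).
Proof. by move=> cF; apply: cont2M => //; exact: cont2_cst. Qed.

Lemma om_dx g x y : is_derive x 1 (fun s => om (sq g s y)) (om1 (sq g x y) * (2 * Kx g x y)).
Proof. exact: (@is_derive_comp' _ om (sq g ^~ y) _ _ _ (d1 (sq_ge0 g x y)) (sq_dx g x y)). Qed.

Lemma is_derive_cmean g x : is_derive x 1 (cmean g) (cmean1 g x).
Proof.
apply: (@is_derive_cint _ _ _ (fun x y => om (sq g x y))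
  (fun x y => om1 (sq g x y) * (2 * Kx g x y))).
- exact/cont2_om/cont_om.
- by apply: cont2M; [exact/cont2_om/cont_om1|apply: cont2Z; exact: cont2_Kx].
- exact: om_dx.
Qed.

Let Hxx g x y := om2 (sq g x y) * (2 * Kx g x y) * (2 * Kx g x y) + om1 (sq g x y) *
  (2 * (sq (Dp g) x y + PU g x y * PU (Dp (Dp g)) x y + PV g x y * PV (Dp (Dp g)) x y)).
Let Hyy g x y := om2 (sq g x y) * (2 * Ky g x y) * (2 * Ky g x y) + om1 (sq g x y) *
  (2 * (sq (Dp g) x y - PU g x y * PU (Dp (Dp g)) x y - PV g x y * PV (Dp (Dp g)) x y)).

Lemma om1_dx g x y : is_derive x 1 (fun s => om1 (sq g s y) * (2 * Kx g s y)) (Hxx g x y).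
Proof.
exact: is_deriveM' (@is_derive_comp' _ om1 (sq g ^~ y) _ _ _ (d2 (sq_ge0 g x y)) (sq_dx g x y))
  (is_deriveZ' 2 (Kx_dx g x y)).
Qed.

Lemma om1_dy g x y : is_derive y 1 (fun s => om1 (sq g x s) * (2 * Ky g x s)) (Hyy g x y).
Proof.
exact: is_deriveM' (@is_derive_comp' _ om1 (sq g x) _ _ _ (d2 (sq_ge0 g x y)) (sq_dy g x y))
  (is_deriveZ' 2 (Ky_dy g x y)).
Qed.

Lemma cont2_D2 g : cont2 (fun x y => PU g x y * PU (Dp (Dp g)) x y) /\
  cont2 (fun x y => PV g x y * PV (Dp (Dp g)) x y).
Proof. by split; apply: cont2M; (exact: cont2_PU || exact: cont2_PV). Qed.

Lemma cont2_Ky g : cont2 (Ky g).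
Proof.
by apply: cont2D; [|apply: cont2N]; apply: cont2M; (exact: cont2_PU || exact: cont2_PV).
Qed.

Lemma cont2_om12 g : cont2 (fun x y => om1 (sq g x y)) /\ cont2 (fun x y => om2 (sq g x y)).
Proof. by split; apply: cont2_om; [exact: cont_om1|exact: c2]. Qed.

Lemma cont2_Hxx g : cont2 (Hxx g).
Proof.
have [h1 h2] := cont2_D2 g; have [m1 m2] := cont2_om12 g.
have k : cont2 (fun x y => 2 * Kx g x y) by apply: cont2Z; exact: cont2_Kx.
apply: cont2D; first by apply: cont2M => //; exact: cont2M.
apply: cont2M => //; apply: cont2Z; apply: cont2D => //; apply: cont2D => //; exact: cont2_sq.
Qed.

Lemma cont2_Hyy g : cont2 (Hyy g).
Proof.
have [h1 h2] := cont2_D2 g; have [m1 m2] := cont2_om12 g.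
have k : cont2 (fun x y => 2 * Ky g x y) by apply: cont2Z; exact: cont2_Ky.
apply: cont2D; first by apply: cont2M => //; exact: cont2M.
apply: cont2M => //; apply: cont2Z; apply: cont2D; last exact: cont2N.
by apply: cont2D; [exact: cont2_sq|exact: cont2N].
Qed.

Lemma pi2_ge0 : 0 <= 2 * pi :> R.
Proof. by rewrite mulr_ge0// pi_ge0. Qed.

(** [Hyy] is the y-derivative of a periodic function and integrates to 0, so it may be added to
    [Hxx]. In the sum the second derivatives of g cancel and [Kxy] leaves the Laplacian. *)
Lemma is_derive_cmean1 g x : is_derive x 1 (cmean1 g) (cmean2 g x).
Proof.
have -> : cmean2 g x = cint 0 (2 * pi) (Hxx g x).
  have yy0 : cint 0 (2 * pi) (Hyy g x) = 0.
    rewrite (cint_FTC pi2_ge0 _ (fun y => om1_dy g x y)); last exact/cont2_y/cont2_Hyy.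
    by rewrite /Ky /sq !PU_period !PV_period subrr.
  transitivity (cint 0 (2 * pi) (Hxx g x) + cint 0 (2 * pi) (Hyy g x)); last by rewrite yy0 addr0.
  rewrite -cintD; [|exact/cont2_y/cont2_Hxx|exact/cont2_y/cont2_Hyy].
  apply: eq_cint => y.
  transitivity (om2 (sq g x y) * 4 * (Kx g x y ^+ 2 + Ky g x y ^+ 2) +
    om1 (sq g x y) * 4 * sq (Dp g) x y).
    by rewrite Kxy; ring.
  by rewrite /Hxx /Hyy; ring.
apply: (@is_derive_cint _ _ _ (fun x y => om1 (sq g x y) * (2 * Kx g x y)) (Hxx g));
  [|exact: cont2_Hxx|exact: om1_dx].
by apply: cont2M; [exact/cont2_om/cont_om1|apply: cont2Z; exact: cont2_Kx].
Qed.

Lemma cont2_lap g : cont2 (fun x y =>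
  4 * (sq (Dp g) x y * (om2 (sq g x y) * sq g x y + om1 (sq g x y)))).
Proof.
apply: cont2Z; apply: cont2M; first exact: cont2_sq.
apply: cont2D; last exact/cont2_om/cont_om1.
by apply: cont2M; [exact/cont2_om|exact: cont2_sq].
Qed.

Hypothesis lap_ge0 : forall t, 0 <= t -> 0 <= om2 t * t + om1 t.
Hypothesis om_homo : forall s t, 0 <= s -> s <= t -> om s <= om t.

Lemma is_derive_ndecr (f f' : R -> R) (a b : R) : (forall t : R, is_derive t 1 f (f' t)) ->
  (forall t, a < t < b -> 0 <= f' t) -> a <= b -> f a <= f b.
Proof.
move=> df f0 ab.
have cf : continuous f by move=> t; exact: is_derive_continuous (df t).
have [c + e] := MVT_segment ab (fun x _ => df x) (continuous_subspaceT cf).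
(* The mean value point may be an endpoint, where nothing is known about the sign of f'; a second
   application then gives an interior point. *)
rewrite in_itv/= => /andP[]; rewrite le_eqVlt => /predU1P[ac _|ac].
  move: ab; rewrite le_eqVlt => /predU1P[->//|ab'].
  have [c' + e'] := MVT ab' (fun x _ => df x) (continuous_subspaceT cf).
  by rewrite in_itv/= -subr_ge0 e' => /f0 h; rewrite mulr_ge0// subr_ge0 ltW.
rewrite le_eqVlt => /predU1P[cb|cb].
  move: ab; rewrite le_eqVlt => /predU1P[->//|ab'].
  have [c' + e'] := MVT ab' (fun x _ => df x) (continuous_subspaceT cf).
  by rewrite in_itv/= -subr_ge0 e' => /f0 h; rewrite mulr_ge0// subr_ge0 ltW.
by rewrite -subr_ge0 e mulr_ge0 ?subr_ge0// f0// ac cb.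
Qed.

Lemma cmean1_homo g a b : a <= b -> cmean1 g a <= cmean1 g b.
Proof.
apply: is_derive_ndecr => [t|t _]; first exact: is_derive_cmean1.
apply: cint_ge0 => y _; rewrite mulr_ge0// mulr_ge0 ?sq_ge0//.
by apply: lap_ge0; exact: sq_ge0.
Qed.

Lemma cmean_le g a : a <= 0 -> cmean g a <= 2 * pi * om (pnorm g ^+ 2).
Proof.
move=> a0; apply: le_trans (_ : cint 0 (2 * pi) (fun=> om (pnorm g ^+ 2)) <= _).
  apply: le_cint.
  - exact: (@cont2_y _ (fun x y => om (sq g x y)) a (@cont2_om om g cont_om)).
  - by move=> ?; exact: cvg_cst.
  - move=> y _; apply: om_homo; first exact: sq_ge0.
    rewrite sqE ler_pXn2r ?nnegrE ?cabs_ge0 ?pnorm_ge0//.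
    by apply: cabs_horner_le; rewrite cabs_expi -expR0 ler_expR.
by rewrite cint_cst ?subr0// pi2_ge0.
Qed.

(* A circle mean that is convex in the logarithm of the radius and bounded
   near the centre cannot decrease. *)
Lemma cmean1_ge0 g x : 0 <= cmean1 g x.
Proof.
have aux (m u v n : R) : u - v <= - (n + 1) -> m - u <= n -> v <= m -> False by move=> *; lra.
rewrite leNgt; apply/negP => lt0.
set M := 2 * pi * om (pnorm g ^+ 2).
set a := Num.min x 0.
have am : cmean1 g a < 0 by apply: le_lt_trans lt0; apply: cmean1_homo; rewrite ge_min lexx.
have a0 : a <= 0 by rewrite ge_min lexx orbT.
(* Moving back by [d], convexity raises the mean by at least |M - [cmean g a]| + 1, hence above its
   bound M. *)
pose d := (`|M - cmean g a| + 1) / - cmean1 g a.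
have d0 : 0 < d by rewrite divr_gt0 ?oppr_gt0// ltr_pwDr.
have cf : continuous (cmean g) by move=> t; exact: is_derive_continuous (is_derive_cmean g t).
have ad : a - d < a by rewrite ltrBlDr ltrDl.
have [c + e] := MVT ad (fun t _ => is_derive_cmean g t) (continuous_subspaceT cf).
rewrite in_itv/= => /andP[_ ca].
have hM : cmean g (a - d) <= M by apply: cmean_le; rewrite lerBlDr add0r (le_trans a0)// ltW.
have h1 : cmean1 g c <= cmean1 g a by apply: cmean1_homo; exact: ltW.
have h2 : cmean g a - cmean g (a - d) <= cmean1 g a * d.
  by rewrite e opprB addrC subrK ler_pM2r.
have h3 : cmean1 g a * d = - (`|M - cmean g a| + 1).
  by rewrite /d invrN !mulrN mulrCA mulfV ?mulr1 ?lt_eqF.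
rewrite h3 in h2; exact: aux h2 (ler_norm _) hM.
Qed.

Lemma cmean_homo g a b : a <= b -> cmean g a <= cmean g b.
Proof. by apply: is_derive_ndecr => [t|t _]; [exact: is_derive_cmean|exact: cmean1_ge0]. Qed.

Lemma cmean1_le g b s : 0 < s -> cmean1 g b * s <= cmean g (b + s) - cmean g b.
Proof.
move=> s0; have bs : b < b + s by rewrite ltrDl.
have cf : continuous (cmean g) by move=> t; exact: is_derive_continuous (is_derive_cmean g t).
have [c + e] := MVT bs (fun t _ => is_derive_cmean g t) (continuous_subspaceT cf).
rewrite in_itv/= => /andP[bc _].
by rewrite e addrC addKr ler_pM2r// cmean1_homo// ltW.
Qed.

(* The radii shrink to 0, where the mean tends to the value at the centre. *)
Lemma center_le_cmean g x : 2 * pi * om (cabs g.[0] ^+ 2) <= cmean g x.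
Proof.
rewrite leNgt; apply/negP => lt; set v := cabs _ ^+ 2 in lt.
have v0 : 0 <= v by rewrite sqr_ge0.
pose e := (2 * pi * om v - cmean g x) / (2 * pi) / 2.
have pi0 : 0 < 2 * pi :> R by rewrite mulr_gt0// pi_gt0.
have e0 : 0 < e by rewrite !divr_gt0// subr_gt0.
have /cvgrPdist_lt/(_ _ e0)[d /= d0 hd] := cont_om v0.
(* A Lipschitz bound for |g|^2 at the origin; [x0] is then taken so small that the circle of radius
   e^x0 stays within the continuity radius [d] of om. *)
have [C hC] : exists C, forall z : R[i], cabs z <= 1 -> `|v - cabs g.[z] ^+ 2| <= C * cabs z.
  elim/poly_ind: g @v v0 {lt e e0 hd} => [|h c _] v v0.
    by exists 0 => z _; rewrite /v !horner0 subrr normr0 mul0r.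
  exists (pnorm h * (pnorm h + cabs c + cabs c)) => z z1.
  rewrite /v !hornerMXaddC mulr0 add0r.
  have hz := cabs_horner_le h z1.
  have A := cabsD (h.[z] * z) c.
  have B := cabsD (h.[z] * z + c) (- (h.[z] * z)).
  rewrite addrAC subrr add0r cabsN in B; rewrite cabsM in A B.
  have h1 : cabs h.[z] * cabs z <= pnorm h * cabs z by rewrite ler_wpM2r ?cabs_ge0.
  have h2 : cabs h.[z] * cabs z <= pnorm h.
    by apply: le_trans (ler_piMr (cabs_ge0 _) z1) hz.
  have e1 : `|cabs c - cabs (h.[z] * z + c)| <= pnorm h * cabs z.
    by rewrite ler_norml; apply/andP; split; lra.
  have e2 : `|cabs c + cabs (h.[z] * z + c)| <= pnorm h + cabs c + cabs c.
    by rewrite ger0_norm ?addr_ge0 ?cabs_ge0//; lra.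
  by rewrite subr_sqr normrM [leRHS]mulrAC ler_pM.
have C0 : 0 <= `|C| by [].
pose x0 := Num.min (Num.min x 0) (ln (d / 2 / (`|C| + 1))).
have P0 : 0 < d / 2 / (`|C| + 1) by rewrite !divr_gt0// ltr_pwDr.
have x0x : x0 <= x by rewrite !ge_min lexx.
have x00 : x0 <= 0 by rewrite !ge_min lexx orbT.
have ex0 : expR x0 * (`|C| + 1) <= d / 2.
  by rewrite -ler_pdivlMr ?ltr_pwDr// -[leRHS]lnK ?posrE// ler_expR ge_min lexx orbT.
have le1 : forall y, om v - e <= om (sq g x0 y).
  move=> y; rewrite sqE.
  suff /hd : `|v - cabs g.[expi x0 y] ^+ 2| < d by rewrite ltr_norml => /andP[_]; lra.
  apply: le_lt_trans (hC _ _) _; rewrite cabs_expi; first by rewrite -expR0 ler_expR.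
  apply: le_lt_trans (_ : d / 2 < _); last by rewrite ltr_pdivrMr// ltr_pMr// ltr1n.
  apply: le_trans ex0; rewrite mulrC ler_wpM2l ?expR_ge0//.
  by rewrite (le_trans (ler_norm _))// lerDl.
have : 2 * pi * (om v - e) <= cmean g x.
  apply: le_trans (cmean_homo g x0x).
  rewrite -[X in X * _]subr0 -cint_cst ?pi2_ge0//; apply: le_cint => //.
    by move=> ?; exact: cvg_cst.
  exact: (@cont2_y _ (fun x y => om (sq g x y)) x0 (@cont2_om om g cont_om)).
have -> : 2 * pi * (om v - e) = 2 * pi * om v - (2 * pi * om v - cmean g x) / 2.
  have E (A P : R) : P != 0 -> P * (A / P / 2) = A / 2 by move=> ?; field.
  by rewrite mulrBr /e E// gt_eqF.
lra.
Qed.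

End CircleMeans.

(** * Polar coordinates *)

Section Polar.
Variable R : realType.
Local Notation mu := (@lebesgue_measure R).
Local Notation mu2 := (mu \x mu)%E.
Local Open Scope ereal_scope.

(** By uniqueness of Lebesgue measure it suffices that |a| times the pushforward measures half-open
    intervals correctly. For a < 0 the preimage is half-open on the other side, with the same
    length. *)
Lemma ge0_integral_affine (a c : R) (f : R -> \bar R) : a != 0%R ->
  measurable_fun [set: R] f -> (forall x, 0 <= f x) ->
  \int[mu]_x f (a * x + c)%R = (`|a|^-1)%:E * \int[mu]_x f x.
Proof.
move=> a0 mf f0.
pose phi (x : measurableTypeR R) : measurableTypeR R := (a * x + c)%R.
have mphi : measurable_fun [set: measurableTypeR R] phi.
  by apply: measurable_funD => //; exact: measurable_funM.
have na : (0 <= `|a|)%R by [].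
have nuE A : measurable A -> mu A = `|a|%:E * pushforward mu phi A.
  apply: (@lebesgue_measure_unique _ (mscale (NngNum na) (pushforward mu phi))) => //.
  move=> _ [[u v]] _ <-.
  rewrite /mscale /pushforward /=.
  have [a_gt0|a_lt0|a_eq0] := ltgtP 0%R a; last by rewrite -a_eq0 eqxx in a0.
  - rewrite [X in _ = _ * lebesgue_measure X](_ : _ = `]((u - c) / a)%R, ((v - c) / a)%R]%classic); last first.
      apply/seteqP; split=> x /=; rewrite !in_itv/= ltr_pdivrMr// ler_pdivlMr// ltrBlDr lerBrDr;
      by rewrite /phi (mulrC a).
    rewrite !lebesgue_measure_itv/= !lte_fin ltr_pM2r ?invr_gt0// ltrD2r.
    case: ifP => _; last by rewrite mule0.
    rewrite -!EFinD -EFinM gtr0_norm//; congr EFin; field.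
    by rewrite gt_eqF.
  - rewrite [X in _ = _ * lebesgue_measure X](_ : _ = `[((v - c) / a)%R, ((u - c) / a)%R[%classic); last first.
      apply/seteqP; split=> x /=; rewrite !in_itv/= ltr_ndivlMr// ler_ndivrMr// ltrBlDr lerBrDr;
      by rewrite /phi (mulrC a) andbC.
    rewrite !lebesgue_measure_itv/= !lte_fin ltr_nM2r ?invr_lt0// ltrD2r.
    case: ifP => _; last by rewrite mule0.
    rewrite -!EFinD -EFinM ltr0_norm//; congr EFin; field.
    by rewrite lt_eqF.
have E (mm : {measure set (measurableTypeR R) -> \bar R}) :
    (forall A, measurable A -> mu A = mm A) -> \int[mu]_x f x = \int[mm]_x f x.
  by move=> h; apply: eq_measure_integral => A mA _; exact: h.
rewrite (E (mscale (NngNum na) (pushforward mu phi)))// ge0_integral_mscale// ge0_integral_pushforward//.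
by rewrite preimage_setT muleA /= -EFinM mulVf ?mul1e// normr_eq0.
Qed.

Lemma ge0_integral_shift (c : R) (f : R -> \bar R) :
  measurable_fun [set: R] f -> (forall x, 0 <= f x) ->
  \int[mu]_x f (x + c)%R = \int[mu]_x f x.
Proof.
move=> mf f0; have := @ge0_integral_affine 1 c f (oner_neq0 _) mf f0.
by rewrite normr1 invr1 mul1e => <-; apply: eq_integral => x _; rewrite mul1r.
Qed.

Lemma ge0_integral_reflect (c : R) (f : R -> \bar R) :
  measurable_fun [set: R] f -> (forall x, 0 <= f x) ->
  \int[mu]_x f (c - x)%R = \int[mu]_x f x.
Proof.
move=> mf f0; have := @ge0_integral_affine (-1) c f _ mf f0.
rewrite normrN1 invr1 mul1e oppr_eq0 oner_eq0 => <- //.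
by apply: eq_integral => x _; rewrite mulN1r addrC.
Qed.

Lemma ge0_integral_itv_shift (u v c : R) (f : R -> \bar R) :
  measurable_fun [set: R] f -> (forall x, 0 <= f x) ->
  \int[mu]_(x in `[u, v]) f (x + c)%R = \int[mu]_(x in `[(u + c)%R, (v + c)%R]) f x.
Proof.
move=> mf f0; rewrite integral_mkcond [RHS]integral_mkcond.
rewrite -[RHS](@ge0_integral_shift c).
- apply: eq_integral => x _; rewrite !patchE.
  have -> // : (x \in `[u, v]%classic) = ((x + c)%R \in `[(u + c)%R, (v + c)%R]%classic).
  by apply/idP/idP; rewrite !inE/= !in_itv/= !lerD2r.
- by apply/(measurable_restrictT _ _).1 => //; exact: measurable_funTS.
- by move=> x; rewrite patchE; case: ifP.
Qed.

Lemma ge0_integral_itv_reflect (u v c : R) (f : R -> \bar R) :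
  measurable_fun [set: R] f -> (forall x, 0 <= f x) ->
  \int[mu]_(x in `[u, v]) f (c - x)%R = \int[mu]_(x in `[(c - v)%R, (c - u)%R]) f x.
Proof.
move=> mf f0; rewrite integral_mkcond [RHS]integral_mkcond.
rewrite -[RHS](@ge0_integral_reflect c).
- apply: eq_integral => x _; rewrite !patchE.
  have -> // : (x \in `[u, v]%classic) = ((c - x)%R \in `[(c - v)%R, (c - u)%R]%classic).
  by apply/idP/idP; rewrite !inE/= !in_itv/= !lerD2l !lerN2 andbC.
- by apply/(measurable_restrictT _ _).1 => //; exact: measurable_funTS.
- by move=> x; rewrite patchE; case: ifP.
Qed.

Lemma ge0_integral_itv_split (u v w : R) (f : R -> \bar R) : (u <= v)%R -> (v <= w)%R ->
  measurable_fun [set: R] f -> (forall x, 0 <= f x) ->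
  \int[mu]_(x in `[u, w]) f x = \int[mu]_(x in `[u, v]) f x + \int[mu]_(x in `[v, w]) f x.
Proof.
move=> uv vw mf f0.
rewrite (@itv_bndbnd_setU _ _ (BLeft u) (BRight v) (BRight w)) ?bnd_simp//.
rewrite ge0_integral_setU//=.
- congr (_ + _); rewrite integral_itv_obnd_cbnd//; exact: measurable_funTS.
- exact: measurable_funTS.
- by apply/disj_setPLR => x /=; rewrite !in_itv/= => /andP[_ xv] /andP[vx _]; rewrite leNgt vx in xv.
Qed.

(** The part of [c, T + c] beyond T is moved back by one period. *)
Lemma ge0_integral_periodic_shift (T c : R) (f : R -> \bar R) : (0 <= c <= T)%R ->
  measurable_fun [set: R] f -> (forall x, 0 <= f x) -> (forall x, f (x + T)%R = f x) ->
  \int[mu]_(x in `[0%R, T]) f (x + c)%R = \int[mu]_(x in `[0%R, T]) f x.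
Proof.
move=> /andP[c0 cT] mf f0 fT; rewrite ge0_integral_itv_shift// add0r.
have T0 : (0 <= T)%R by exact: le_trans cT.
rewrite (@ge0_integral_itv_split c T (T + c)%R)//; last by rewrite lerDl.
rewrite [RHS](@ge0_integral_itv_split 0 c T)// addeC; congr (_ + _).
rewrite -[X in `[X, _]]add0r [X in `[_, X]]addrC -ge0_integral_itv_shift//.
by apply: eq_integral => x _; rewrite fT.
Qed.

Lemma ge0_integral_periodic_reflect (T c : R) (f : R -> \bar R) : (0 <= c <= T)%R ->
  measurable_fun [set: R] f -> (forall x, 0 <= f x) -> (forall x, f (x + T)%R = f x) ->
  \int[mu]_(x in `[0%R, T]) f (c - x)%R = \int[mu]_(x in `[0%R, T]) f x.
Proof.
move=> cT mf f0 fT; rewrite -[RHS](ge0_integral_periodic_shift cT)//.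
transitivity (\int[mu]_(x in `[0%R, T]) f (T - x + c)%R).
  by apply: eq_integral => x _; rewrite -[LHS]fT; congr f; rewrite addrC addrA addrAC.
rewrite (@ge0_integral_itv_reflect 0 T T (fun x => f (x + c)%R)) ?subrr ?subr0//.
apply: measurableT_comp => //; exact: measurable_funD.
Qed.

End Polar.

(** * Plane Lebesgue measure under complex multiplication *)

Section PolarFormula.
Variable R : realType.
Local Notation mu := (@lebesgue_measure R).
Local Notation mu2 := (mu \x mu)%E.
Local Open Scope ereal_scope.
Implicit Types (z w : R * R) (h : R * R -> \bar R).

(** Complex multiplication, exponential and squared modulus are restated on [R * R], the type that
    carries the product measure. *)
Definition mulc w z : R * R := (w.1 * z.1 - w.2 * z.2, w.1 * z.2 + w.2 * z.1)%R.
Definition expc z : R * R := (expR z.1 * cos z.2, expR z.1 * sin z.2)%R.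
Definition nsq w : R := (w.1 ^+ 2 + w.2 ^+ 2)%R.

Lemma expcD z w : expc (z.1 + w.1, z.2 + w.2)%R = mulc (expc z) (expc w).
Proof.
by rewrite /expc /mulc /= expRD cosD sinD; congr pair; rewrite ?mulrA; ring.
Qed.

Lemma mulcC z w : mulc z w = mulc w z.
Proof. by rewrite /mulc; congr pair; rewrite ?mulrA; ring. Qed.

Lemma mulcA z w v : mulc z (mulc w v) = mulc (mulc z w) v.
Proof. by rewrite /mulc /=; congr pair; ring. Qed.

Lemma expcN z w : mulc (mulc w (expc z)) (expc (- z.1, - z.2)%R) = w.
Proof.
rewrite -mulcA -expcD /= !subrr /mulc /expc /= expR0 cos0 sin0.
by case: w => a b /=; congr pair; ring.
Qed.

Lemma nsq_expc z : nsq (expc z) = expR (2 * z.1).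
Proof. by rewrite /nsq /expc /= !exprMn -mulrDr cos2Dsin2 mulr1 expRM_natl. Qed.

Lemma nsq_ge0 w : (0 <= nsq w)%R.
Proof. by rewrite addr_ge0// sqr_ge0. Qed.

Lemma integral2_xy h : measurable_fun [set: R * R] h -> (forall z, 0 <= h z) ->
  \int[mu2]_z h z = \int[mu]_x \int[mu]_y h (x, y).
Proof. by move=> mh h0; rewrite fubini_tonelli1. Qed.

Lemma integral2_yx h : measurable_fun [set: R * R] h -> (forall z, 0 <= h z) ->
  \int[mu2]_z h z = \int[mu]_y \int[mu]_x h (x, y).
Proof. by move=> mh h0; rewrite fubini_tonelli1// -fubini_tonelli. Qed.

Lemma measurable_mulc d (T : measurableType d) (f g : T -> R * R) :
  measurable_fun [set: T] f -> measurable_fun [set: T] g ->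
  measurable_fun [set: T] (fun t => mulc (f t) (g t)).
Proof.
move=> mf mg.
have f1 : measurable_fun [set: T] (fun t => (f t).1) by exact: measurableT_comp measurable_fst mf.
have f2 : measurable_fun [set: T] (fun t => (f t).2) by exact: measurableT_comp measurable_snd mf.
have g1 : measurable_fun [set: T] (fun t => (g t).1) by exact: measurableT_comp measurable_fst mg.
have g2 : measurable_fun [set: T] (fun t => (g t).2) by exact: measurableT_comp measurable_snd mg.
apply/measurable_fun_pair.
- by apply: measurable_funB; exact: measurable_funM.
- by apply: measurable_funD; exact: measurable_funM.
Qed.

Lemma measurable_expc d (T : measurableType d) (f : T -> R * R) :
  measurable_fun [set: T] f -> measurable_fun [set: T] (fun t => expc (f t)).
Proof.
move=> mf.
have f1 : measurable_fun [set: T] (fun t => (f t).1) by exact: measurableT_comp measurable_fst mf.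
have f2 : measurable_fun [set: T] (fun t => (f t).2) by exact: measurableT_comp measurable_snd mf.
have me : measurable_fun [set: T] (fun t => expR (f t).1).
  by apply: measurableT_comp f1; exact: measurable_expR.
apply/measurable_fun_pair.
- apply: measurable_funM => //; apply: measurableT_comp f2.
  by apply: continuous_measurable_fun; exact: continuous_cos.
- apply: measurable_funM => //; apply: measurableT_comp f2.
  by apply: continuous_measurable_fun; exact: continuous_sin.
Qed.

(** The linear map is split into one-dimensional affine substitutions inside iterated integrals. For
    a != 0 they are p = a x - b y at fixed y, then q = k y + (b / a) p at fixed p with k = (a^2 +
    b^2) / a; the two factors multiply to a^2 + b^2. For a = 0 the coordinates are only exchanged
    and scaled. *)
Lemma ge0_integral_mulc w h : nsq w != 0%R ->
  measurable_fun [set: R * R] h -> (forall z, 0 <= h z) ->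
  \int[mu2]_z h (mulc w z) = ((nsq w)^-1)%:E * \int[mu2]_z h z.
Proof.
case: w => a b nz mh h0.
have mm : measurable_fun [set: R * R] (fun z => h (mulc (a, b) z)).
  by apply: (measurableT_comp mh); apply: measurable_mulc => //; exact: measurable_id.
have pm (f g : R -> R) : measurable_fun [set: R] f -> measurable_fun [set: R] g ->
    measurable_fun [set: R] (fun x => h (f x, g x)).
  by move=> mf mg; apply: (measurableT_comp mh); exact/measurable_fun_pair.
have maff (k c : R) : measurable_fun [set: R] (fun x : R => k * x + c)%R.
  by apply: measurable_funD => //; exact: measurable_funM.
rewrite integral2_yx// /mulc /=.
have [a0|a0] := eqVneq a 0%R.
  subst a.
  have b0 : b != 0%R by apply: contra nz => /eqP->; rewrite /nsq /= expr0n/= addr0.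
  pose G (y : R) := \int[mu]_x h (y, x).
  have mG : measurable_fun [set: R] G by exact: (@measurable_fun_fubini_tonelli_F _ _ _ _ _ mu h mh h0).
  have G0 y : 0 <= G y by exact: integral_ge0.
  transitivity (\int[mu]_y (`|b|^-1%:E * G (- b * y + 0)%R)).
    apply: eq_integral => y _; rewrite /G -(@ge0_integral_affine _ b 0) ?addr0//.
    - by apply: eq_integral => x _; rewrite !mul0r !add0r addr0 mulNr.
    - by apply: pm => //; exact: measurable_cst.
  have mGb : measurable_fun [set: R] (fun y => G (- b * y + 0)%R).
    by apply: (measurableT_comp mG); exact: maff.
  rewrite ge0_integralZl//=.
  rewrite ge0_integral_affine ?oppr_eq0// -integral2_xy// muleA -EFinM normrN.
  by congr (EFin _ * _); rewrite /nsq /= expr0n/= add0r -invfM -normrM -expr2 ger0_norm ?sqr_ge0.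
pose G (p : R) := \int[mu]_q h (p, q).
have mG : measurable_fun [set: R] G by exact: (@measurable_fun_fubini_tonelli_F _ _ _ _ _ mu h mh h0).
have G0 y : 0 <= G y by exact: integral_ge0.
pose k := ((a ^+ 2 + b ^+ 2) / a)%R.
have k0 : k != 0%R by rewrite mulf_neq0 ?invr_eq0.
pose H (z : R * R) := h (z.2, k * z.1 + b / a * z.2)%R.
have mH : measurable_fun [set: R * R] H.
  apply: (measurableT_comp mh); apply/measurable_fun_pair => //.
  by apply: measurable_funD; exact: measurable_funM.
have sH (q : R) : measurable_fun [set: R] (fun p : R => H (q, p)).
  apply: (pm id (fun p => k * q + b / a * p)%R) => //.
  by apply: measurable_funD => //; exact: measurable_funM.
transitivity (\int[mu]_q (`|a|^-1%:E * \int[mu]_p H (q, p))).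
  apply: eq_integral => q _.
  rewrite -(@ge0_integral_affine _ a (- (b * q))%R (fun p => H (q, p)))//; last first.
    by move=> x; exact: h0.
  apply: eq_integral => p _; rewrite /H /k /=; congr (h (_, _)).
  by field.
have mH' : measurable_fun [set: R] (fun q => \int[mu]_p H (q, p)).
  exact: (@measurable_fun_fubini_tonelli_F _ _ _ _ _ mu H mH (fun=> h0 _)).
rewrite ge0_integralZl//=; last by move=> q _; apply: integral_ge0 => p _; exact: h0.
rewrite (@fubini_tonelli _ _ _ _ _ mu mu H)//; last by move=> z; exact: h0.
transitivity (`|a|^-1%:E * \int[mu]_y (`|k|^-1%:E * G y)).
  congr (_ * _); apply: eq_integral => p _; rewrite /G -(@ge0_integral_affine _ k (b / a * p))//.
  by apply: pm => //; exact: measurable_cst.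
rewrite ge0_integralZl//=.
rewrite -integral2_xy// muleA -EFinM; congr (EFin _ * _).
rewrite -invfM -normrM /k mulrCA divff// mulr1 ger0_norm//.
exact: (nsq_ge0 (a, b)).
Qed.

End PolarFormula.

Lemma measurable_fun_section d1 d2 d3 (T1 : measurableType d1) (T2 : measurableType d2)
    (U : measurableType d3) (F : T1 * T2 -> U) (x : T1) :
  measurable_fun [set: T1 * T2] F -> measurable_fun [set: T2] (fun y => F (x, y)).
Proof.
move=> mF; apply: (measurableT_comp mF).
by apply: measurable_fun_pair; [exact: measurable_cst|exact: measurable_id].
Qed.

(* The library's product measure carries a canonical sigma-finite structure
   only for pairs of subprobabilities, hence this copy. *)
Section PlaneMeasure.
Variable R : realType.
Local Notation mu := (@lebesgue_measure R).

Definition leb2 : set (measurableTypeR R * measurableTypeR R) -> \bar R := (mu \x mu)%E.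

HB.instance Definition _ := Measure.copy leb2 (mu \x mu)%E.

Let leb2_sigma_finite : sigma_finite setT leb2.
Proof.
have /sigma_finiteP[F [TF ndF Foo]] := sigma_finiteT mu.
exists (fun n => F n `*` F n).
  rewrite -setXTT TF predeqE => -[x y]; split.
    move=> [/= [n _ Fnx] [k _ Fky]]; exists (maxn n k) => //; split.
    - by move: x Fnx; exact/subsetPset/ndF/leq_maxl.
    - by move: y Fky; exact/subsetPset/ndF/leq_maxr.
  by move=> [n _ []/= ? ?]; split; exists n.
move=> k; have [mF Fk] := Foo k; split; first exact: measurableX.
by rewrite /leb2 product_measure1E// lte_mul_pinfty// ge0_fin_numE.
Qed.

HB.instance Definition _ := Measure_isSigmaFinite.Build _ _ _ leb2 leb2_sigma_finite.

End PlaneMeasure.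
Arguments leb2 {R}.

(** * The polar formula up to a constant *)

Section PolarFormula2.
Variable R : realType.
Local Notation mu := (@lebesgue_measure R).
Local Notation mu2 := (mu \x mu)%E.
Local Open Scope ereal_scope.
Implicit Types (z w : R * R) (h : R * R -> \bar R).

(** The angle is kept within one period because the periodic shift and reflection take their offset
    there. *)
Lemma expc_surj w : nsq w != 0%R -> exists z : R * R, (0 <= z.2 <= 2 * pi)%R /\ w = expc z.
Proof.
case: w => a b nz.
have c0 : ((a +i* b)%C != (0 : R[i]))%R.
  apply: contra nz; rewrite eq_complex /= => /andP[/eqP-> /eqP->].
  by rewrite /nsq /= expr0n /= addr0.
have cp : (0 < cabs (a +i* b)%C)%R by rewrite cabs_gt0.
have h1 : (-1 <= a / cabs (a +i* b)%C <= 1)%R.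
  rewrite ler_pdivlMr// ler_pdivrMr// mulN1r mul1r -ler_norml.
  exact: (normRe_le_cabs (a +i* b)%C).
have h2 : ((b / cabs (a +i* b)%C) ^+ 2 = 1 - (a / cabs (a +i* b)%C) ^+ 2)%R.
  rewrite !exprMn !exprVn cabs_sqr /=; field.
  exact: nz.
have ct := acosK h1; have t0 := acos_ge0 h1; have tpi := acos_lepi h1.
set t := acos _ in ct t0 tpi.
have pi0 := pi_ge0 R.
have /eqP : (sin t ^+ 2 = (b / cabs (a +i* b)%C) ^+ 2)%R by rewrite sin2cos2 ct h2.
rewrite eqf_sqr => /orP[/eqP|/eqP] st.
  exists (ln (cabs (a +i* b)%C), t); split; first by rewrite /= t0/=; lra.
  by rewrite /expc /= lnK ?posrE// ct st; congr pair; rewrite mulrC ?mulNr divfK// gt_eqF.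
exists (ln (cabs (a +i* b)%C), (- t + pi *+ 2)%R); split.
  by rewrite /= -mulr_natl; apply/andP; split; lra.
by rewrite /expc /= cosD2pi sinD2pi cosN sinN lnK ?posrE// ct st opprK; congr pair; rewrite mulrC ?mulNr divfK// gt_eqF.
Qed.

Lemma ge0_integral2Zl (c : \bar R) h : measurable_fun [set: R * R] h -> (forall z, 0 <= h z) ->
  0 <= c -> \int[mu2]_z (c * h z) = c * \int[mu2]_z h z.
Proof. by move=> mh h0 c0; rewrite ge0_integralZl. Qed.

Lemma ge0_integral1Zl (c : \bar R) (f : R -> \bar R) : measurable_fun [set: R] f ->
  (forall x, 0 <= f x) -> 0 <= c -> \int[mu]_x (c * f x) = c * \int[mu]_x f x.
Proof. by move=> mh h0 c0; rewrite ge0_integralZl. Qed.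

Lemma polar_ge0 (h : R * R -> \bar R) : (forall z, 0 <= h z) ->
  0 <= \int[mu]_x \int[mu]_(y in `[0%R, (2 * pi)%R]) h (expc (x, y)).
Proof. by move=> h0; apply: integral_ge0 => x _; exact: integral_ge0. Qed.

(** Integration in logarithmic polar coordinates: this is invariant under multiplication of the
    argument by a nonzero number, like the measure dA / |z|^2. *)
Definition polar h : \bar R := \int[mu]_x \int[mu]_(y in `[0%R, (2 * pi)%R]) h (expc (x, y)).

Let D : set R := `[0%R, (2 * pi)%R]%classic.
Let s (y : R) : \bar R := (\1_D y)%:E.
(** A set of area 1 on which [nsq] stays between 1 and 5; its indicator [k] is the auxiliary weight
    of the double integral. *)
Let Q : set (R * R) := `[1%R, 2%R]%classic `*` `[0%R, 1%R]%classic.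
Let k z : \bar R := (\1_Q z)%:E.

Let mD : measurable (D : set (measurableTypeR R)).
Proof. exact: measurable_itv. Qed.

Let mQ : measurable Q.
Proof. by apply: measurableX; exact: measurable_itv. Qed.

Let ms : measurable_fun [set: R] s.
Proof. by apply/measurable_EFinP; exact: measurable_indic. Qed.

Let mk : measurable_fun [set: R * R] k.
Proof. by apply/measurable_EFinP; exact: measurable_indic. Qed.

Let s0 y : 0 <= s y. Proof. by rewrite lee_fin. Qed.
Let k0 z : 0 <= k z. Proof. by rewrite lee_fin. Qed.

Lemma integral_indicE (f : R -> \bar R) :
  \int[mu]_(y in D) f y = \int[mu]_y (s y * f y).
Proof.
rewrite integral_mkcond; apply: eq_integral => y _; rewrite patchE /s indicE.
by case: ifP => _; rewrite ?mul1e ?mul0e.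
Qed.

Let mh_expc h : measurable_fun [set: R * R] h ->
  measurable_fun [set: R * R] (fun z => h (expc z)).
Proof. by move=> mh; apply: (measurableT_comp mh); apply: measurable_expc. Qed.

Let mpair h (x : R) : measurable_fun [set: R * R] h -> measurable_fun [set: R] (fun y => h (x, y)).
Proof. by move=> mh; apply: (measurableT_comp mh); exact/measurable_fun_pair. Qed.

Let msnd (f : R -> \bar R) : measurable_fun [set: R] f ->
  measurable_fun [set: R * R] (fun z => f z.2).
Proof. by move=> mf; exact: (measurableT_comp mf). Qed.

Lemma measurable_angular h : measurable_fun [set: R * R] h -> (forall z, 0 <= h z) ->
  measurable_fun [set: R] (fun x => \int[mu]_(y in D) h (expc (x, y))).
Proof.
move=> mh h0; pose F z := s z.2 * h (expc z).
have mF : measurable_fun [set: R * R] F by apply: emeasurable_funM; [exact: msnd|exact: mh_expc].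
have F0 z : 0 <= F z by rewrite mule_ge0.
have -> : (fun x => \int[mu]_(y in D) h (expc (x, y))) = (fun x => \int[mu]_y F (x, y)).
  by apply/funext => x; rewrite integral_indicE.
exact: (@measurable_fun_fubini_tonelli_F _ _ _ _ _ mu F mF F0).
Qed.

Let expc_per x y : expc (x, y + 2 * pi)%R = expc (x, y) :> R * R.
Proof. by rewrite /expc /= mulr_natl cosD2pi sinD2pi. Qed.

Lemma polar_shift h (w : R * R) : (0 <= w.2 <= 2 * pi)%R ->
  measurable_fun [set: R * R] h -> (forall z, 0 <= h z) ->
  \int[mu]_x \int[mu]_(y in D) h (expc (x + w.1, y + w.2)%R) = polar h.
Proof.
move=> w2 mh h0.
pose Phi x := \int[mu]_(y in D) h (expc (x, y)).
transitivity (\int[mu]_x Phi (x + w.1)%R).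
  apply: eq_integral => x _.
  apply: (@ge0_integral_periodic_shift _ _ _ (fun y => h (expc (x + w.1, y)%R))) => //.
    exact: mpair (mh_expc mh).
  by move=> y; rewrite expc_per.
apply: ge0_integral_shift; first exact: measurable_angular.
by move=> x; exact: integral_ge0.
Qed.

(** Its true value is 1; the estimates rely only on its being positive and finite. *)
Definition polar_const : \bar R :=
  \int[mu]_x ((expR (2 * x))%:E * \int[mu]_(y in D) k (expc (x, y))).

Let measurable_expR2 : measurable_fun [set: R] (fun x : R => (expR (2 * x))%:E).
Proof.
apply/measurable_EFinP; apply: (measurableT_comp (@measurable_expR R)).
exact: measurable_funM.
Qed.

Let measurable_expRN2 : measurable_fun [set: R] (fun x : R => (expR (- (2 * x)))%:E).
Proof.
apply/measurable_EFinP; apply: (measurableT_comp (@measurable_expR R)).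
by apply: measurable_funN; exact: measurable_funM.
Qed.

Let measurable_expcN : measurable_fun [set: R * R] (fun z : R * R => expc (- z.1, - z.2)%R).
Proof.
apply: measurable_expc; apply/measurable_fun_pair; apply: measurable_funN.
  exact: measurable_fst.
exact: measurable_snd.
Qed.

Let nsq_k z : k z != 0 -> (1 <= nsq z <= 5)%R.
Proof.
rewrite /k indicE; case: (boolP (z \in Q)); last by rewrite eqxx.
rewrite inE /Q => -[/=]; rewrite !in_itv/= => /andP[a b] /andP[c d] _.
by rewrite /nsq; nra.
Qed.

Lemma measurable_nsqV : measurable_fun [set: R * R] (fun z => ((nsq z)^-1)%:E).
Proof.
have -> : (fun z : R * R => ((nsq z)^-1)%:E) = (fun z => (nsq z `^ (- 1)%R)%R%:E).
  by apply/funext => z; rewrite powR_inv1// nsq_ge0.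
apply/measurable_EFinP; apply: (measurableT_comp (@measurable_powR R (- 1)%R)).
by apply: measurable_funD; apply: measurable_funX; [exact: measurable_fst|exact: measurable_snd].
Qed.

Lemma polar_const_ge0 : 0 <= polar_const.
Proof.
apply: integral_ge0 => x _; apply: mule_ge0; first by rewrite lee_fin expR_ge0.
by apply: integral_ge0 => y _; exact: k0.
Qed.

(** The integrand of the double integral behind [polarE]. [S] is the same integrand after the
    substitution w = z e^zeta, with Jacobian e^(-2 Re zeta). *)
Let T h (z zeta : R * R) := k z * s zeta.2 * h (mulc z (expc zeta)).

Let S h (zeta w : R * R) := s zeta.2 * (expR (- (2 * zeta.1)))%:E *
  (k (mulc w (expc (- zeta.1, - zeta.2)%R)) * h w).

Let T0 h : (forall z, 0 <= h z) -> forall z zeta, 0 <= T h z zeta.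
Proof. by move=> h0 z zeta; rewrite /T !mule_ge0. Qed.

Let S0 h : (forall z, 0 <= h z) -> forall z zeta, 0 <= S h z zeta.
Proof. by move=> h0 z zeta; rewrite /S !mule_ge0// lee_fin expR_ge0. Qed.

Let mT h : measurable_fun [set: R * R] h ->
  measurable_fun [set: (R * R) * (R * R)] (fun p => T h p.1 p.2).
Proof.
move=> mh; apply: emeasurable_funM; first apply: emeasurable_funM.
- exact: (measurableT_comp mk measurable_fst).
- exact: (measurableT_comp (msnd ms) measurable_snd).
- apply: (measurableT_comp mh); apply: measurable_mulc; first exact: measurable_fst.
  by apply: measurable_expc; exact: measurable_snd.
Qed.

Let mS h : measurable_fun [set: R * R] h ->
  measurable_fun [set: (R * R) * (R * R)] (fun p => S h p.1 p.2).
Proof.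
move=> mh; have m11 : measurable_fun [set: (R * R) * (R * R)] (fun p => p.1.1).
  exact: (measurableT_comp measurable_fst measurable_fst).
apply: emeasurable_funM; first apply: emeasurable_funM.
- exact: (measurableT_comp (msnd ms) measurable_fst).
- exact: (measurableT_comp measurable_expRN2 m11).
- apply: emeasurable_funM; last exact: (measurableT_comp mh measurable_snd).
  apply: (measurableT_comp mk); apply: measurable_mulc; first exact: measurable_snd.
  exact: (measurableT_comp measurable_expcN measurable_fst).
Qed.

Let integral_k : \int[mu2]_z k z = 1.
Proof.
rewrite integral_indic// setIT.
rewrite [LHS](_ : _ = mu `[1%R, 2%R]%classic * mu `[0%R, 1%R]%classic); last first.
  by apply: (@product_measure1E _ _ _ _ _ mu mu); exact: measurable_itv.
rewrite !lebesgue_measure_itv/= !lte_fin ltr1n ltr01 -!EFinD subr0 -EFinM.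
by congr EFin; ring.
Qed.

(** On the support of [k] the point z is some e^w, and multiplication by z translates zeta by w,
    which [polar_shift] absorbs. *)
Let integral_T_zeta h z : measurable_fun [set: R * R] h -> (forall z, 0 <= h z) ->
  \int[mu2]_zeta T h z zeta = polar h * k z.
Proof.
move=> mh h0; have [kz|kz] := eqVneq (k z) 0.
  rewrite kz mule0 -[RHS](@integral0 _ _ _ mu2 setT).
  by apply: eq_integral => zeta _; rewrite /T kz !mul0e.
have k1 : k z = 1 by move: kz; rewrite /k indicE; case: (z \in Q); rewrite ?eqxx.
have nz : nsq z != 0%R by have /andP[h1 _] := nsq_k kz; rewrite gt_eqF//; lra.
have [w [w2 zw]] := expc_surj nz.
have mTz : measurable_fun [set: R * R] (T h z) := measurable_fun_section z (mT mh).
rewrite k1 mule1 -(polar_shift w2 mh h0) (integral2_xy mTz (T0 h0 z)).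
apply: eq_integral => x _; rewrite integral_indicE; apply: eq_integral => y _.
by rewrite /T k1 mul1e zw -expcD /= addrC (addrC w.2).
Qed.

Let integral_T_z h zeta : measurable_fun [set: R * R] h -> (forall z, 0 <= h z) ->
  \int[mu2]_z T h z zeta = \int[mu2]_w S h zeta w.
Proof.
move=> mh h0.
pose F w := k (mulc w (expc (- zeta.1, - zeta.2)%R)) * h w.
have mF : measurable_fun [set: R * R] F.
  apply: emeasurable_funM; last exact: mh.
  apply: (measurableT_comp mk); apply: measurable_mulc; first exact: measurable_id.
  exact: measurable_cst.
have F0 w : 0 <= F w by exact: mule_ge0.
transitivity (s zeta.2 * \int[mu2]_z F (mulc (expc zeta) z)).
  have mF' : measurable_fun [set: R * R] (fun z => F (mulc (expc zeta) z)).
    apply: (measurableT_comp mF); apply: measurable_mulc; last exact: measurable_id.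
    exact: measurable_cst.
  rewrite -(ge0_integral2Zl mF' (fun z => F0 _) (s0 _)).
  apply: eq_integral => z _; rewrite /T /F (mulcC _ z) expcN.
  by rewrite -muleA muleCA.
have nz : nsq (expc zeta) != 0%R by rewrite nsq_expc gt_eqF ?expR_gt0.
rewrite (ge0_integral_mulc nz mF F0) nsq_expc muleA -expRN.
by rewrite -(ge0_integral2Zl mF F0) ?mule_ge0 ?lee_fin ?expR_ge0.
Qed.

Let B w (zeta : R * R) := s zeta.2 * (expR (- (2 * zeta.1)))%:E *
  k (mulc w (expc (- zeta.1, - zeta.2)%R)).

Let mB w : measurable_fun [set: R * R] (B w).
Proof.
apply: emeasurable_funM; first apply: emeasurable_funM.
- exact: (msnd ms).
- exact: (measurableT_comp measurable_expRN2 measurable_fst).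
- apply: (measurableT_comp mk); apply: measurable_mulc; first exact: measurable_cst.
  exact: measurable_expcN.
Qed.

Let B0 w z : 0 <= B w z.
Proof. by rewrite /B !mule_ge0 ?lee_fin ?expR_ge0. Qed.

Let k_origin : k (0, 0)%R = 0.
Proof.
rewrite /k indicE memNset// /Q /= !in_itv/= => -[/andP[]].
by rewrite ler10.
Qed.

(** For w = e^om, the reflection zeta -> om - zeta turns the weight e^(-2 Re zeta) into e^(2 Re
    zeta) / |w|^2, and the remaining integral no longer depends on w. *)
Let integral_B w : \int[mu2]_zeta B w zeta = polar_const * ((nsq w)^-1)%:E.
Proof.
have [nw|nw] := eqVneq (nsq w) 0%R.
  have [w1 w2] : w.1 = 0%R /\ w.2 = 0%R.
    have h1 := sqr_ge0 w.1; have h2 := sqr_ge0 w.2; move: nw; rewrite /nsq => nw.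
    by split; apply/eqP; rewrite -sqrf_eq0; apply/eqP; lra.
  (* At w = 0 both sides vanish, since the inverse of 0 is 0 and [k] vanishes at the origin. *)
  rewrite nw invr0 mule0 -[RHS](@integral0 _ _ _ mu2 setT); apply: eq_integral => zeta _.
  by rewrite /B /mulc w1 w2 !mul0r subr0 addr0 k_origin mule0.
have [om [om2 ->]] := expc_surj nw.
rewrite (integral2_xy (mB _) (@B0 _)).
pose Psi x := \int[mu]_(y in D) k (expc (x, y)).
have mPsi : measurable_fun [set: R] Psi by exact: measurable_angular.
have Psi0 x : 0 <= Psi x by exact: integral_ge0.
pose G x := (expR (2 * x))%:E * Psi x.
have mG : measurable_fun [set: R] G by exact: emeasurable_funM.
have G0 x : 0 <= G x by rewrite mule_ge0 ?lee_fin ?expR_ge0.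
have mG' : measurable_fun [set: R] (fun x => G (om.1 - x)%R).
  by apply: (measurableT_comp mG); exact: measurable_funB.
transitivity (\int[mu]_x (((nsq (expc om))^-1)%:E * G (om.1 - x)%R)); last first.
  rewrite (ge0_integral1Zl mG' (fun x => G0 _)) ?lee_fin ?invr_ge0 ?nsq_ge0 //.
  by rewrite (ge0_integral_reflect _ mG G0) muleC.
apply: eq_integral => x _.
rewrite nsq_expc -expRN /G muleA -EFinM -expRD.
rewrite (_ : (- (2 * om.1) + 2 * (om.1 - x) = - (2 * x))%R); last by ring.
pose kf (y : R) := k (expc (om.1 - x, y)%R).
have mkf : measurable_fun [set: R] kf := mpair _ (mh_expc mk).
have kf0 y : 0 <= kf y by exact: k0.
have kf_per y : kf (y + 2 * pi)%R = kf y by rewrite /kf expc_per.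
rewrite /Psi -/(kf _) -(ge0_integral_periodic_reflect om2 mkf kf0 kf_per).
have mq : measurable_fun [set: R] (fun y => s y * kf (om.2 - y)%R).
  apply: emeasurable_funM; first exact: ms.
  by apply: (measurableT_comp mkf); exact: measurable_funB.
have q0 y : 0 <= s y * kf (om.2 - y)%R by exact: mule_ge0.
have e0 : 0 <= (expR (- (2 * x)))%:E by rewrite lee_fin expR_ge0.
rewrite integral_indicE -(ge0_integral1Zl mq q0 e0).
by apply: eq_integral => y _; rewrite /B /kf -expcD /= -muleA muleCA.
Qed.

(* Up to the constant, both sides integrate [h] against the Haar measure of the
   multiplicative group of the plane: [k z h (z e^zeta)] is integrated over
   [(z, zeta)] in both orders. *)
Lemma polarE h : measurable_fun [set: R * R] h -> (forall z, 0 <= h z) ->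
  polar h = polar_const * \int[mu2]_z (((nsq z)^-1)%:E * h z).
Proof.
move=> mh h0.
have E1 : \int[mu2]_z \int[mu2]_zeta T h z zeta = polar h.
  transitivity (\int[mu2]_z (polar h * k z)).
    by apply: eq_integral => z _; exact: integral_T_zeta.
  by rewrite (ge0_integral2Zl mk k0 (polar_ge0 h0)) integral_k mule1.
have E2 : \int[mu2]_z \int[mu2]_zeta T h z zeta = \int[mu2]_zeta \int[mu2]_z T h z zeta.
  exact: (@fubini_tonelli _ _ _ _ _ (@leb2 R) (@leb2 R) _ (mT mh) (fun p => T0 h0 _ _)).
have c0 := polar_const_ge0.
rewrite -E1 E2.
transitivity (\int[mu2]_zeta \int[mu2]_w S h zeta w).
  by apply: eq_integral => zeta _; exact: integral_T_z.
transitivity (\int[mu2]_w \int[mu2]_zeta S h zeta w).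
  exact: (@fubini_tonelli _ _ _ _ _ (@leb2 R) (@leb2 R) _ (mS mh) (fun p => S0 h0 _ _)).
have mnh : measurable_fun [set: R * R] (fun z => ((nsq z)^-1)%:E * h z) by exact: (emeasurable_funM measurable_nsqV mh).
have nh0 z : 0 <= ((nsq z)^-1)%:E * h z by rewrite mule_ge0 ?lee_fin ?invr_ge0 ?nsq_ge0.
rewrite -(ge0_integral2Zl mnh nh0 c0).
apply: eq_integral => w _.
rewrite muleA -integral_B muleC -(ge0_integral2Zl (mB w) (@B0 w) (h0 w)).
by apply: eq_integral => zeta _; rewrite /S /B muleA muleC.
Qed.

Let integral_1 : \int[mu]_(y in D) 1 = (2 * pi)%:E.
Proof.
rewrite integral_cst//= mul1e lebesgue_measure_itv/= lte_fin mulr_gt0 ?pi_gt0//.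
by rewrite -EFinB subr0.
Qed.

(** Otherwise [polarE] would give [polar] the value 0 at the constant 1, where it is infinite. *)
Lemma polar_const_gt0 : 0 < polar_const.
Proof.
rewrite lt_neqAle polar_const_ge0 andbT eq_sym; apply/negP => /eqP c_eq0.
have := @polarE (fun=> 1) (measurable_cst _) (fun=> lee01).
rewrite c_eq0 mul0e /polar integral_1 integral_cst//= -set_itvNyy lebesgue_measure_itv/=.
by rewrite mulry gtr0_sg ?mulr_gt0 ?pi_gt0// mul1e.
Qed.

(** The support of [k] forces 1 <= e^(2x) <= 5, hence 0 <= x <= 2: the x-integrand is bounded and of
    bounded support. *)
Lemma polar_const_lty : polar_const < +oo.
Proof.
pose U : set R := `[0%R, 2%R]%classic.
have mU0 : measurable (U : set (measurableTypeR R)) by exact: measurable_itv.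
have mU : measurable_fun [set: R] (fun x => (\1_U x)%:E : \bar R).
  by apply/measurable_EFinP; exact: measurable_indic.
have mcU : measurable_fun [set: R] (fun x => (5 * (2 * pi))%:E * (\1_U x)%:E : \bar R).
  by apply: emeasurable_funM; [exact: measurable_cst|exact: mU].
apply: le_lt_trans (_ : \int[mu]_x ((5 * (2 * pi))%:E * (\1_U x)%:E) < +oo).
  apply: ge0_le_integral => //=.
  - move=> x _; apply: mule_ge0; first by rewrite lee_fin expR_ge0.
    by apply: integral_ge0 => y _; exact: k0.
  - by apply: emeasurable_funM; [exact: measurable_expR2|exact: measurable_angular].
  move=> x _.
  have pi0 : (0 <= 2 * pi :> R)%R by exact: pi2_ge0.
  have [[y kxy]|nk] := pselect (exists y, k (expc (x, y)) != 0).
    have := nsq_k kxy; rewrite nsq_expc /= => /andP[l1 l5].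
    have x0 : (0 <= x)%R by move: l1; rewrite -[X in (X <= _)%R]expR0 ler_expR; lra.
    have x2 : (x <= 2)%R by have := expR_ge1Dx (2 * x)%R; lra.
    rewrite indicE mem_set ?mule1 /U/= ?in_itv/= ?x0//.
    apply: le_trans (_ : 5%:E * (2 * pi)%:E <= _) => //.
    have le_k : \int[mu]_(y in D) k (expc (x, y)) <= (2 * pi)%:E.
      rewrite -integral_1; apply: ge0_le_integral => //.
        have mkx : measurable_fun [set: R] (fun y => k (expc (x, y))) := mpair x (mh_expc mk).
        exact: (measurable_funTS mkx).
      by move=> t _; rewrite /k lee_fin indicE; case: (_ \in _).
    apply: lee_pmul; [by rewrite lee_fin expR_ge0| |by rewrite lee_fin|exact: le_k].
    by apply: integral_ge0 => y' _; exact: k0.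
  rewrite (_ : \int[mu]_(y in D) k (expc (x, y)) = 0).
    by rewrite mule0 mule_ge0// lee_fin mulr_ge0.
  rewrite -[RHS](@integral0 _ _ _ mu D); apply: eq_integral => y _.
  by apply/eqP; apply/negPn/negP => h; apply: nk; exists y.
rewrite ge0_integral1Zl; [|exact: mU|by move=> x; rewrite lee_fin|
  by rewrite lee_fin mulr_ge0// pi2_ge0].
rewrite integral_indic//= setIT /U lebesgue_measure_itv/= lte_fin ltr0n /=.
by rewrite -EFinB -EFinM ltry.
Qed.

End PolarFormula2.

(** * The area of Re f < 0 *)

Section SignedMean.
Variable R : realType.
Implicit Types (g : {poly R[i]}) (x y t u : R).

Definition lg t : R := ln (1 + t).
Definition lg1 t : R := (1 + t)^-1.
Definition lg2 t : R := - (1 + t) ^- 2.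
(** Chosen so that the Laplacian of [lw] (|g|^2) is at least 4 |[Dp g]|^2 / (1 + |g|^2), one power
    of 1 + |g|^2 better than for [lg], while [lw] grows only like the square of [lg]. *)
Definition lw t : R := lg t * lg t + lg t.
Definition lw1 t : R := (2 * lg t + 1) * (1 + t)^-1.
Definition lw2 t : R := (1 - 2 * lg t) * (1 + t) ^- 2.

Lemma is_derive_inv' (f : R -> R) t a : is_derive t 1 f a -> f t != 0 ->
  is_derive t 1 (fun s => (f s)^-1) (- (f t) ^- 2 * a).
Proof. by move=> df ft; exact: (is_deriveV ft df). Qed.

Lemma is_derive_id' t : is_derive t 1 (fun s : R => s) 1.
Proof. exact: is_derive_id. Qed.

Lemma is_derive_1D t : is_derive t 1 (fun s : R => 1 + s) 1.
Proof.
by apply: is_derive_eq' (is_deriveD' (is_derive_cst' 1 t) (is_derive_id' t)) _; rewrite add0r.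
Qed.

Lemma is_derive_lg t : 0 <= t -> is_derive t 1 lg (lg1 t).
Proof.
move=> t0; have p : 0 < 1 + t by rewrite ltr_pwDl.
by apply: is_derive_eq' (is_derive_comp' (is_derive1_ln p) (is_derive_1D t)) _; rewrite mulr1.
Qed.

Lemma is_derive_lg1 t : 0 <= t -> is_derive t 1 lg1 (lg2 t).
Proof.
move=> t0; have p : 1 + t != 0 by rewrite gt_eqF// ltr_pwDl.
by apply: is_derive_eq' (is_derive_inv' (is_derive_1D t) p) _; rewrite mulr1.
Qed.

Lemma is_derive_lw t : 0 <= t -> is_derive t 1 lw (lw1 t).
Proof.
move=> t0; have d := is_derive_lg t0.
apply: is_derive_eq' (is_deriveD' (is_deriveM' d d) d) _.
by rewrite /lw1 /lg1; ring.
Qed.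

Lemma is_derive_lw1 t : 0 <= t -> is_derive t 1 lw1 (lw2 t).
Proof.
move=> t0; have p : 1 + t != 0 by rewrite gt_eqF// ltr_pwDl.
have d := is_derive_lg t0.
have d1 := is_deriveD' (is_deriveZ' 2 d) (is_derive_cst' 1 t).
have d2 : is_derive t 1 (fun s : R => (1 + s)^-1) (lg2 t) by exact: is_derive_lg1.
apply: is_derive_eq' (is_deriveM' d1 d2) _.
by rewrite /lw2 /lg1 /lg2 -exprVn; ring.
Qed.

Lemma continuous_invX2 t : 0 <= t -> {for t, continuous (fun s : R => (1 + s) ^- 2)}.
Proof.
move=> t0; have p : 1 + t != 0 by rewrite gt_eqF// ltr_pwDl.
apply: (@is_derive_continuous _ _ _ (- ((1 + t) ^+ 2) ^- 2 * (2 * (1 + t)))).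
apply: (@is_derive_inv' (fun s => (1 + s) ^+ 2)); last by rewrite expf_neq0.
have d := is_derive_1D t.
rewrite (_ : (fun s : R => (1 + s) ^+ 2) = (fun s => (1 + s) * (1 + s))); last first.
  by apply/funext => s; rewrite expr2.
by apply: is_derive_eq' (is_deriveM' d d) _; ring.
Qed.

Lemma continuous_lg2 t : 0 <= t -> {for t, continuous lg2}.
Proof. by move=> t0; apply: cvgN; exact: continuous_invX2. Qed.

Lemma continuous_lw2 t : 0 <= t -> {for t, continuous lw2}.
Proof.
move=> t0; apply: cvgM; last exact: continuous_invX2.
apply: cvgB; first exact: cvg_cst.
apply: cvgM; first exact: cvg_cst.
exact: is_derive_continuous (is_derive_lg t0).
Qed.

Lemma lg_ge0 t : 0 <= t -> 0 <= lg t.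
Proof. by move=> t0; rewrite ln_ge0// lerDl. Qed.

Lemma lg_homo s t : 0 <= s -> s <= t -> lg s <= lg t.
Proof.
by move=> s0 st; rewrite ler_ln ?posrE ?lerD2l// ltr_pwDl// (le_trans s0).
Qed.

Lemma lw_homo s t : 0 <= s -> s <= t -> lw s <= lw t.
Proof.
move=> s0 st; have h := lg_homo s0 st; have h0 := lg_ge0 s0.
by apply: lerD => //; apply: ler_pM.
Qed.

Lemma lap_lg t : 0 <= t -> lg2 t * t + lg1 t = (1 + t) ^- 2.
Proof.
move=> t0; have p : 1 + t != 0 by rewrite gt_eqF// ltr_pwDl.
by rewrite /lg2 /lg1; field.
Qed.

Lemma lap_lw t : 0 <= t -> lw2 t * t + lw1 t = (1 + 2 * t + 2 * lg t) * (1 + t) ^- 2.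
Proof.
move=> t0; have p : 1 + t != 0 by rewrite gt_eqF// ltr_pwDl.
by rewrite /lw2 /lw1; field.
Qed.

Lemma lap_lg_ge0 t : 0 <= t -> 0 <= lg2 t * t + lg1 t.
Proof. by move=> t0; rewrite lap_lg// invr_ge0 exprn_ge0// addr_ge0. Qed.

Lemma lap_lw_ge t : 0 <= t -> (1 + t)^-1 <= lw2 t * t + lw1 t.
Proof.
move=> t0; have p : 0 < 1 + t by rewrite ltr_pwDl.
rewrite lap_lw// expr2 invfM mulrA ler_pMl ?invr_gt0// ler_pdivlMr// mul1r.
have := lg_ge0 t0; lra.
Qed.

Lemma lap_lw_ge0 t : 0 <= t -> 0 <= lw2 t * t + lw1 t.
Proof. by move=> t0; apply: le_trans (lap_lw_ge t0); rewrite invr_ge0 addr_ge0. Qed.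

Definition Ym g x := cmean lg g x.
Definition Wm g x := cmean lw g x.
Definition Wm1 g x := cmean1 lw1 g x.
Definition Wm2 g x := cmean2 lw1 lw2 g x.

Lemma is_derive_Wm1 g x : is_derive x 1 (Wm1 g) (Wm2 g x).
Proof. exact: (is_derive_cmean1 (@is_derive_lw1) (@continuous_lw2)). Qed.

Lemma cont2_lw2 g : cont2 (fun x y =>
  4 * (sq (Dp g) x y * (lw2 (sq g x y) * sq g x y + lw1 (sq g x y)))).
Proof. exact: (@cont2_lap _ lw1 lw2 (@is_derive_lw1) (@continuous_lw2) g). Qed.

Lemma continuous_Wm2 g : continuous (Wm2 g).
Proof. exact: (@cint_continuous _ 0 (2 * pi) _ (@cont2_lw2 g)). Qed.

Lemma Ym_homo g a b : a <= b -> Ym g a <= Ym g b.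
Proof.
exact: (cmean_homo (@is_derive_lg) (@is_derive_lg1) (@continuous_lg2) (@lap_lg_ge0) (@lg_homo)).
Qed.

Lemma Ym_continuous g : continuous (Ym g).
Proof.
move=> x; exact: (is_derive_continuous (is_derive_cmean (@is_derive_lg) (@is_derive_lg1) g x)).
Qed.

Lemma center_le_Ym g x : 2 * pi * lg (cabs g.[0] ^+ 2) <= Ym g x.
Proof.
exact: (center_le_cmean (@is_derive_lg) (@is_derive_lg1) (@continuous_lg2) (@lap_lg_ge0) (@lg_homo)).
Qed.

Lemma Wm1_le g b s : 0 < s -> Wm1 g b * s <= Wm g (b + s).
Proof.
move=> s0; apply: le_trans (_ : Wm g (b + s) - Wm g b <= _).
  exact: (cmean1_le (@is_derive_lw) (@is_derive_lw1) (@continuous_lw2) (@lap_lw_ge0)).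
rewrite gerBl; apply: cint_ge0 => y _.
have h := lg_ge0 (sq_ge0 g b y).
by rewrite addr_ge0// mulr_ge0.
Qed.

Lemma Wm1_ge0 g x : 0 <= Wm1 g x.
Proof.
exact: (cmean1_ge0 (@is_derive_lw) (@is_derive_lw1) (@continuous_lw2) (@lap_lw_ge0) (@lw_homo)).
Qed.

(** The square of the negative part of u, a C^1 function written without case distinction. *)
Definition qneg u : R := (u * u - u * `|u|) / 2.

Lemma is_derive_mul_norm t : is_derive t 1 (fun u : R => u * `|u|) (2 * `|t|).
Proof.
have [t0|t0|->] := ltgtP t 0.
- rewrite ltr0_norm//; apply: (@near_eq_is_derive _ _ _ (fun u => - (u * u))).
    near=> u; rewrite ltr0_norm ?mulrN//.
    by near: u; exact: lt_nbhsl.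
  by apply: is_derive_eq' (is_deriveN' (is_deriveM' (is_derive_id' t) (is_derive_id' t))) _; ring.
- rewrite gtr0_norm//; apply: (@near_eq_is_derive _ _ _ (fun u => u * u)).
    near=> u; rewrite gtr0_norm//.
    by near: u; exact: lt_nbhsr.
  by apply: is_derive_eq' (is_deriveM' (is_derive_id' t) (is_derive_id' t)) _; ring.
(* At 0 the difference quotient of u |u| is |u| itself, which is continuous. *)
- rewrite normr0 mulr0; apply/is_derive1_caratheodory; exists (fun z => `|z|).
  split; [by move=> z; rewrite normr0 mulr0 !subr0 mulrC| |by rewrite normr0].
  exact: norm_continuous.
Unshelve. all: end_near. Qed.

Lemma is_derive_qneg u : is_derive u 1 qneg (u - `|u|).
Proof.
have d := is_deriveM' (is_derive_id' u) (is_derive_id' u).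
have e := is_derive_mul_norm u.
apply: is_derive_eq' (is_deriveM' (is_deriveD' d (is_deriveN' e)) (is_derive_cst' 2^-1 u)) _.
by field.
Qed.

Lemma qneg_pos u : 0 <= u -> qneg u = 0.
Proof. by move=> u0; rewrite /qneg ger0_norm// subrr mul0r. Qed.

Lemma qneg_neg u : u <= 0 -> qneg u = u ^+ 2.
Proof. by move=> u0; rewrite /qneg ler0_norm// mulrN opprK expr2; field. Qed.

Lemma qneg_ge0 u : 0 <= qneg u.
Proof. by have [/qneg_pos->|/ltW/qneg_neg->] := leP 0 u; rewrite ?sqr_ge0. Qed.

Definition rneg u : R := Num.sqrt (1 + qneg u).

Lemma rneg_ge1 u : 1 <= rneg u.
Proof. by rewrite -[leLHS]sqrtr1 ler_wsqrtr// lerDl qneg_ge0. Qed.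

Lemma sqr_rneg u : rneg u ^+ 2 = 1 + qneg u.
Proof. by rewrite sqr_sqrtr// addr_ge0// qneg_ge0. Qed.

(* A C^1 function that is 1 + u on u >= 0, so that ln (ks (Re g) + i Im g) is
   holomorphic wherever Re g > 0, and that stays positive with ks u + |w|
   comparable to 1 + |u + i w|. *)
Definition ks u : R := u + 2 * rneg u - 1.
(** [ks] has derivative 1 - theta, so theta measures the departure from holomorphy; it vanishes for
    u >= 0 and never exceeds 2. *)
Definition theta u : R := (`|u| - u) / rneg u.

Lemma is_derive_ks u : is_derive u 1 ks (1 - theta u).
Proof.
have q0 : 0 < 1 + qneg u by rewrite ltr_pwDl// qneg_ge0.
have dq : is_derive u 1 (fun s => 1 + qneg s) (u - `|u|).
  by apply: is_derive_eq' (is_deriveD' (is_derive_cst' 1 u) (is_derive_qneg u)) _; rewrite add0r.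
have dr : is_derive u 1 rneg _ := @is_derive_comp' R Num.sqrt (fun s => 1 + qneg s) u _ _ (is_derive1_sqrt q0) dq.
apply: is_derive_eq' (is_deriveD' (is_deriveD' (is_derive_id' u) (is_deriveZ' 2 dr)) (is_derive_cst' (-1) u)) _.
have r0 : rneg u != 0 by rewrite gt_eqF// (lt_le_trans ltr01)// rneg_ge1.
by rewrite /theta -/(rneg u); field.
Qed.

Lemma theta_pos u : 0 <= u -> theta u = 0.
Proof. by move=> u0; rewrite /theta ger0_norm// subrr mul0r. Qed.

Lemma theta_ge0 u : 0 <= theta u.
Proof. by rewrite divr_ge0 ?sqrtr_ge0// subr_ge0 ler_norm. Qed.

Lemma theta_le2 u : theta u <= 2.
Proof.
have [u0|u0] := leP 0 u; first by rewrite theta_pos.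
have r1 := rneg_ge1 u; have r2 := sqr_rneg u.
rewrite (qneg_neg (ltW u0)) in r2.
rewrite /theta ler_pdivrMr ?(lt_le_trans ltr01)// ltr0_norm//; nra.
Qed.

Lemma ks_gt0_bounds u : [/\ 0 < ks u, 1 + u ^+ 2 <= 4 * ks u ^+ 2 & ks u ^+ 2 <= 9 * (1 + u ^+ 2)].
Proof.
have r1 := rneg_ge1 u; have r2 := sqr_rneg u; rewrite /ks.
have [u0|u0] := leP 0 u.
  rewrite (qneg_pos u0) in r2.
  have -> : rneg u = 1 by rewrite /rneg qneg_pos// addr0 sqrtr1.
  by split; rewrite ?expr2; nra.
rewrite (qneg_neg (ltW u0)) in r2.
(* From (1 - u)^2 <= 2 (1 + u^2); it makes [ks u] at least half of [rneg u]. *)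
have h : 1 - u <= 3 / 2 * rneg u.
  rewrite -(@ler_pXn2r _ 2)// ?nnegrE; [|lra|lra].
  rewrite exprMn r2 !expr2; have := sqr_ge0 (1 + u); rewrite expr2; nra.
rewrite expr2 in r2; split; [lra| |rewrite !expr2; nra].
have hk : rneg u <= 2 * (u + 2 * rneg u - 1) by lra.
rewrite expr2 -r2; nra.
Qed.

Definition modR u (w : R) := ks u ^+ 2 + w ^+ 2.

Lemma modR_bounds u w : 1 + (u * u + w * w) <= 4 * modR u w /\
  modR u w <= 9 * (1 + (u * u + w * w)).
Proof.
have [_ h1 h2] := ks_gt0_bounds u; rewrite /modR -!expr2.
by have := sqr_ge0 w; have := sqr_ge0 u; split; lra.
Qed.

Lemma modR_gt0 u w : 0 < modR u w.
Proof. by have [h _ _] := ks_gt0_bounds u; rewrite ltr_pwDl ?sqr_ge0// exprn_gt0. Qed.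

(** [vf] and [af] are the real and imaginary parts of the logarithm of [ks] (Re g) + i Im g.
    Positivity of [ks] lets an arctangent give the argument globally, so [af] is periodic in y. *)
Definition vf g x y := ln (modR (PU g x y) (PV g x y)) / 2.
Definition af g x y := atan (PV g x y / ks (PU g x y)).

Definition vfx g x y :=
  (ks (PU g x y) * ((1 - theta (PU g x y)) * PU (Dp g) x y) + PV g x y * PV (Dp g) x y)
  / modR (PU g x y) (PV g x y).
Definition afy g x y :=
  (ks (PU g x y) * PU (Dp g) x y + PV g x y * ((1 - theta (PU g x y)) * PV (Dp g) x y))
  / modR (PU g x y) (PV g x y).

Lemma vf_dx g x y : is_derive x 1 (vf g ^~ y) (vfx g x y).
Proof.
have dU := PU_dx g x y; have dV := PV_dx g x y.
have dk := @is_derive_comp' _ ks (PU g ^~ y) x _ _ (is_derive_ks (PU g x y)) dU.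
have dR : is_derive x 1 (fun s => modR (PU g s y) (PV g s y)) _ :=
  is_deriveD' (is_deriveM' dk dk) (is_deriveM' dV dV).
have h := is_deriveM' (@is_derive_comp' R (@ln R) (fun s => modR (PU g s y) (PV g s y)) x _ _
  (is_derive1_ln (modR_gt0 (PU g x y) (PV g x y))) dR) (is_derive_cst' 2^-1 x). apply: is_derive_eq' h _.
have r0 : modR (PU g x y) (PV g x y) != 0 by rewrite gt_eqF// modR_gt0.
by rewrite /vfx; field.
Qed.

Lemma af_dy g x y : is_derive y 1 (af g x) (afy g x y).
Proof.
have dU := PU_dy g x y; have dV := PV_dy g x y.
have [k0 _ _] := ks_gt0_bounds (PU g x y).
have k0' : ks (PU g x y) != 0 by rewrite gt_eqF.
have dk := @is_derive_comp' _ ks (PU g x) y _ _ (is_derive_ks (PU g x y)) dU.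
have dq := is_deriveM' dV (@is_derive_inv' (fun s => ks (PU g x s)) _ _ dk k0').
have h := @is_derive_comp' R (@atan R) (fun s => PV g x s / ks (PU g x s)) y _ _ (is_derive1_atan _) dq.
apply: is_derive_eq' h _.
have r0 : ks (PU g x y) ^+ 2 + PV g x y ^+ 2 != 0 by rewrite gt_eqF// modR_gt0.
by rewrite /afy /modR; field; rewrite k0' r0.
Qed.

Lemma continuous_ks : continuous ks.
Proof. by move=> u; exact: is_derive_continuous (is_derive_ks u). Qed.

Lemma continuous_theta : continuous theta.
Proof.
move=> u; apply: cvgM.
  by apply: cvgB; [exact: norm_continuous|exact: cvg_id].
apply: cvgV; first by rewrite gt_eqF// (lt_le_trans ltr01)// rneg_ge1.
have q0 : 0 < 1 + qneg u by rewrite ltr_pwDl// qneg_ge0.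
have dq : is_derive u 1 (fun s => 1 + qneg s) (u - `|u|).
  by apply: is_derive_eq' (is_deriveD' (is_derive_cst' 1 u) (is_derive_qneg u)) _; rewrite add0r.
exact: is_derive_continuous (@is_derive_comp' R Num.sqrt (fun s => 1 + qneg s) u _ _ (is_derive1_sqrt q0) dq).
Qed.

Lemma cont2_theta g : cont2 (fun x y => theta (PU g x y)).
Proof. by apply: cont2_comp; [exact: cont2_PU|move=> x y; exact: continuous_theta]. Qed.

Lemma cont2_ks g : cont2 (fun x y => ks (PU g x y)).
Proof. by apply: cont2_comp; [exact: cont2_PU|move=> x y; exact: continuous_ks]. Qed.

Lemma cont2_modR g : cont2 (fun x y => modR (PU g x y) (PV g x y)).
Proof.
by apply: cont2D; apply: cont2M; (exact: cont2_ks || exact: cont2_PV).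
Qed.

Lemma cont2_div (F G : R -> R -> R) : cont2 F -> cont2 G -> (forall x y, G x y != 0) ->
  cont2 (fun x y => F x y / G x y).
Proof. by move=> cF cG G0 p; apply: cvgM; [exact: cF|apply: cvgV => //; exact: cG]. Qed.

Let cont2_1theta g : cont2 (fun x y => 1 - theta (PU g x y)).
Proof. by apply: cont2D; [exact: cont2_cst|apply: cont2N; exact: cont2_theta]. Qed.

Lemma cont2_vfx g : cont2 (vfx g).
Proof.
apply: cont2_div; [|exact: cont2_modR|by move=> x y; rewrite gt_eqF// modR_gt0].
apply: cont2D; last by apply: cont2M; exact: cont2_PV.
apply: cont2M; first exact: cont2_ks.
by apply: cont2M; [exact: cont2_1theta|exact: cont2_PU].
Qed.

Lemma cont2_afy g : cont2 (afy g).
Proof.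
apply: cont2_div; [|exact: cont2_modR|by move=> x y; rewrite gt_eqF// modR_gt0].
apply: cont2D; first by apply: cont2M; [exact: cont2_ks|exact: cont2_PU].
apply: cont2M; first exact: cont2_PV.
by apply: cont2M; [exact: cont2_1theta|exact: cont2_PV].
Qed.

Lemma cont2_vf g : cont2 (vf g).
Proof.
apply: cont2M; last exact: cont2_cst.
apply: cont2_comp; first exact: cont2_modR.
move=> x y; apply: is_derive_continuous (is_derive1_ln _); exact: modR_gt0.
Qed.

(* Off {Re g < 0} the function [vf] is harmonic with conjugate [af]. *)
Lemma vfx_afy_le g x y tau : 0 < tau ->
  vfx g x y - afy g x y <= tau * theta (PU g x y) ^+ 2 +
    (4 * tau)^-1 * (4 * (sq (Dp g) x y * (lw2 (sq g x y) * sq g x y + lw1 (sq g x y)))).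
Proof.
move=> tau0; have s0 := sq_ge0 g x y; have s1 := sq_ge0 (Dp g) x y.
have rp := modR_gt0 (PU g x y) (PV g x y).
have [rb _] := modR_bounds (PU g x y) (PV g x y).
set r := modR _ _ in rp rb *; set th := theta _.
set k := ks (PU g x y); set w := PV g x y; set u1 := PU (Dp g) x y; set w1 := PV (Dp g) x y.
have -> : vfx g x y - afy g x y = - th * (k * u1 - w * w1) / r.
  by rewrite /vfx /afy -/r -/th -/k -/w -/u1 -/w1; field; rewrite gt_eqF.
(* Weighted AM-GM, after Cauchy-Schwarz in the form (k u1 - w w1)^2 <= r |[Dp g]|^2. *)
have A : - th * (k * u1 - w * w1) / r <= tau * th ^+ 2 + (4 * tau)^-1 * (sq (Dp g) x y / r).
  have e : (k * u1 - w * w1) ^+ 2 <= r * sq (Dp g) x y.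
    have := sqr_ge0 (k * w1 + w * u1).
    by rewrite /r /modR /sq -/k -/w -/u1 -/w1; nra.
  set X := k * u1 - w * w1 in e *.
  have e2 : (X / r) ^+ 2 <= sq (Dp g) x y / r.
    rewrite exprMn exprVn ler_pdivrMr ?exprn_gt0//.
    by rewrite [r ^+ 2]expr2 mulrA divfK ?gt_eqF// mulrC.
  apply: le_trans (_ : tau * th ^+ 2 + (4 * tau)^-1 * (X / r) ^+ 2 <= _); last first.
    by rewrite lerD2l ler_wpM2l// invr_ge0 mulr_ge0// ltW.
  rewrite -subr_ge0.
  have -> : tau * th ^+ 2 + (4 * tau)^-1 * (X / r) ^+ 2 - - th * X / r =
    (4 * tau)^-1 * (2 * tau * th + X / r) ^+ 2 by field; rewrite !gt_eqF.
  by rewrite mulr_ge0 ?sqr_ge0// invr_ge0 mulr_ge0// ltW.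
apply: le_trans A _; rewrite lerD2l ler_wpM2l ?invr_ge0 ?mulr_ge0 ?(ltW tau0)//.
(* Here 1 + |g|^2 <= 4 r trades r for 1 + |g|^2, and [lap_lw_ge] recovers the Laplacian of [lw]. *)
rewrite mulrCA ler_wpM2l//; apply: le_trans (_ : 4 * (1 + sq g x y)^-1 <= _); last first.
  by rewrite ler_wpM2l// lap_lw_ge.
by rewrite ler_pdivlMr ?ltr_pwDl// mulrC ler_pdivrMr.
Qed.

Definition Lm g x := cint 0 (2 * pi) (vf g x).
(** The quantity that area has to pay for: theta^2 is at most 4 and vanishes where Re g >= 0. *)
Definition Th g a b := cint a b (fun x => cint 0 (2 * pi) (fun y => theta (PU g x y) ^+ 2)).

Lemma cont2_theta2 g : cont2 (fun x y => theta (PU g x y) ^+ 2).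
Proof. by apply: cont2M; exact: cont2_theta. Qed.

Let c2y (H : R -> R -> R) (x : R) (cH : cont2 H) : continuous (H x) := @cont2_y _ H x cH.

(** On each circle [afy] integrates to 0, being the derivative of a periodic function, so
    [vfx_afy_le] bounds the radial derivative of [Lm]. Integration over x turns the Laplacian term
    into an increment of [Wm1]. *)
Lemma Lm_incr g a b tau : 0 < tau -> a <= b ->
  Lm g b - Lm g a <= tau * Th g a b + (4 * tau)^-1 * (Wm1 g b - Wm1 g a).
Proof.
move=> tau0 ab.
have cL : continuous (fun x => cint 0 (2 * pi) (vfx g x)).
  by apply: cint_continuous; exact: cont2_vfx.
have ct : continuous (fun x => cint 0 (2 * pi) (fun y => theta (PU g x y) ^+ 2)).
  by apply: (@cint_continuous _ _ _ (fun x y => _)); exact: cont2_theta2.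
have cW := @continuous_Wm2 g.
have ct' : continuous (fun x => tau * cint 0 (2 * pi) (fun y => theta (PU g x y) ^+ 2)).
  by move=> x; apply: cvgM; [exact: cvg_cst|exact: ct].
have cW' : continuous (fun x => (4 * tau)^-1 * Wm2 g x).
  by move=> x; apply: cvgM; [exact: cvg_cst|exact: cW].
have dL x : is_derive x 1 (Lm g) (cint 0 (2 * pi) (vfx g x)).
  by apply: is_derive_cint; [exact: cont2_vf|exact: cont2_vfx|exact: vf_dx].
rewrite -(cint_FTC ab cL dL) -(cint_FTC ab cW (@is_derive_Wm1 g)) -!cintZ// -cintD//.
apply: le_cint => //; first by move=> x; apply: cvgD; [exact: ct'|exact: cW'].
move=> x _.
have ca : continuous (afy g x).
  exact: (@c2y _ x (@cont2_afy g)).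
have a0 : cint 0 (2 * pi) (afy g x) = 0.
  rewrite (cint_FTC (pi2_ge0 R) ca (fun y => af_dy g x y)).
  by rewrite /af PU_period PV_period subrr.
rewrite -[leLHS]subr0 -[X in _ - X]a0 -mulN1r -(cintZ 0 (2 * pi) (-1) ca).
have cA : continuous (fun y => -1 * afy g x y).
  by move=> y; apply: cvgM; [exact: cvg_cst|exact: ca].
have cT : continuous (fun y => theta (PU g x y) ^+ 2) by exact: (@c2y _ x (@cont2_theta2 g)).
have cT' : continuous (fun y => tau * theta (PU g x y) ^+ 2).
  by move=> y; apply: cvgM; [exact: cvg_cst|exact: cT].
have cWx := @c2y _ x (@cont2_lw2 g).
have cWx' : continuous (fun y => (4 * tau)^-1 *
    (4 * (sq (Dp g) x y * (lw2 (sq g x y) * sq g x y + lw1 (sq g x y))))).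
  by move=> y; apply: cvgM; [exact: cvg_cst|exact: cWx].
rewrite -cintD//; last exact: (@c2y _ x (@cont2_vfx g)).
rewrite /Wm2 /cmean2 -!cintZ// -cintD//; apply: le_cint.
- by move=> y; apply: cvgD; [exact: (@c2y _ x (@cont2_vfx g))|exact: cA].
- by move=> y; apply: cvgD; [exact: cT'|exact: cWx'].
- by move=> y _; rewrite mulN1r; exact: vfx_afy_le.
Qed.

(** The total loss in comparing [vf] with [lg] (|g|^2) / 2 on two circles: 2 pi ln 2 from below and
    2 pi ln 3 from above. *)
Definition c6 : R := 2 * pi * ln 6.

Lemma Lm_Ym g x : Ym g x / 2 - 2 * pi * ln 2 <= Lm g x /\ Lm g x <= Ym g x / 2 + 2 * pi * ln 3.
Proof.
have cl : continuous (fun y => lg (sq g x y)).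
  apply: (@c2y _ x (@cont2_om _ lg g _)) => t t0.
  exact: is_derive_continuous (is_derive_lg t0).
have cl' : continuous (fun y => 2^-1 * lg (sq g x y)).
  by move=> y; apply: cvgM; [exact: cvg_cst|exact: cl].
have cc (c : R) : continuous (fun _ : R => c) by move=> ?; exact: cvg_cst.
have cv : continuous (vf g x) by exact: (@c2y _ x (@cont2_vf g)).
have e (c : R) : Ym g x / 2 + 2 * pi * c = cint 0 (2 * pi) (fun y => 2^-1 * lg (sq g x y) + c).
  by rewrite cintD// cintZ// cint_cst ?subr0 ?pi2_ge0// mulrC.
have r0 y := modR_gt0 (PU g x y) (PV g x y).
have [ln23] : (0 < 2 :> R) /\ (0 < 3 :> R) by [].
move=> ln3; split.
  rewrite -mulrN e; apply: le_cint => //.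
    by move=> y; apply: cvgD; [exact: cl'|exact: cc].
  move=> y _; rewrite /vf /lg.
  have [h _] := modR_bounds (PU g x y) (PV g x y).
  have s0 := sq_ge0 g x y.
  have : ln (1 + sq g x y) <= ln (4 * modR (PU g x y) (PV g x y)).
    by rewrite ler_ln// posrE ?mulr_gt0// ltr_pwDl.
  rewrite lnM ?posrE// (_ : 4 = 2 ^+ 2) ?lnXn// -?natrX//.
  rewrite mulr2n; lra.
rewrite e; apply: le_cint => //.
  by move=> y; apply: cvgD; [exact: cl'|exact: cc].
move=> y _; rewrite /vf /lg.
have [_ h] := modR_bounds (PU g x y) (PV g x y).
have s0 := sq_ge0 g x y.
have : ln (modR (PU g x y) (PV g x y)) <= ln (9 * (1 + sq g x y)).
  by rewrite ler_ln// posrE ?mulr_gt0// ltr_pwDl.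
rewrite lnM ?posrE ?ltr_pwDl// (_ : 9 = 3 ^+ 2) ?lnXn// -?natrX//.
rewrite mulr2n; lra.
Qed.

Lemma Ym_incr g a b tau : 0 < tau -> a <= b ->
  (Ym g b - Ym g a) / 2 - c6 <= tau * Th g a b + (4 * tau)^-1 * Wm1 g b.
Proof.
move=> tau0 ab; have h := Lm_incr g tau0 ab.
have [h1 _] := Lm_Ym g b; have [_ h2] := Lm_Ym g a.
have h3 : (4 * tau)^-1 * (Wm1 g b - Wm1 g a) <= (4 * tau)^-1 * Wm1 g b.
  by rewrite ler_wpM2l ?invr_ge0 ?mulr_ge0 ?(ltW tau0)// gerBl Wm1_ge0.
have -> : c6 = 2 * pi * ln 2 + 2 * pi * ln 3.
  by rewrite /c6 -mulrDr -lnM ?posrE// -natrM.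
move: h h1 h2 h3; move: (Ym g b) (Ym g a) (Lm g b) (Lm g a) (2 * pi * ln 2) (2 * pi * ln 3).
move: (tau * Th g a b) ((4 * tau)^-1 * Wm1 g b) ((4 * tau)^-1 * (Wm1 g b - Wm1 g a)).
by move=> *; lra.
Qed.

End SignedMean.

(** * A sub-mean value inequality for ln (1 + |g|^2) *)

Section SubMean.
Variable R : realType.
Local Notation mu := (@lebesgue_measure R).
Local Notation mu2 := (mu \x mu)%E.
Implicit Types (g : {poly R[i]}) (z w : R * R) (x y a b s : R).

Definition toC w : R[i] := (w.1 +i* w.2)%C.

Definition nsqp g w : R := Re g.[toC w] * Re g.[toC w] + Im g.[toC w] * Im g.[toC w].

Lemma cabs_toC w : cabs (toC w) ^+ 2 = nsq w.
Proof. by rewrite cabs_sqr. Qed.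

Lemma nsqpE g w : nsqp g w = cabs g.[toC w] ^+ 2.
Proof. by rewrite cabs_sqr !expr2. Qed.

Lemma nsqp_ge0 g w : 0 <= nsqp g w.
Proof. by rewrite nsqpE sqr_ge0. Qed.

Lemma measurable_horner g :
  measurable_fun [set: R * R] (fun w => (Re g.[toC w], Im g.[toC w]) : R * R).
Proof.
elim/poly_ind: g => [|p c IH].
  rewrite (_ : (fun _ => _) = (fun=> (0, 0))); first exact: measurable_cst.
  by apply/funext => w; rewrite horner0.
have m := measurable_mulc IH (@measurable_id _ _ [set: R * R]).
have m1 : measurable_fun [set: R * R] (fun w => (mulc (Re p.[toC w], Im p.[toC w]) w).1).
  exact: measurableT_comp measurable_fst m.
have m2 : measurable_fun [set: R * R] (fun w => (mulc (Re p.[toC w], Im p.[toC w]) w).2).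
  exact: measurableT_comp measurable_snd m.
rewrite (_ : (fun _ => _) = (fun w => ((mulc (Re p.[toC w], Im p.[toC w]) w).1 + Re c,
    (mulc (Re p.[toC w], Im p.[toC w]) w).2 + Im c))).
  apply/measurable_fun_pair; apply: measurable_funD; [exact: m1|exact: measurable_cst|exact: m2|exact: measurable_cst].
apply/funext => w; rewrite hornerMXaddC cReD cImD cReM cImM.
by congr pair.
Qed.

Lemma measurable_Re g : measurable_fun [set: R * R] (fun w => Re g.[toC w]).
Proof. exact: (measurableT_comp measurable_fst (measurable_horner g)). Qed.

Lemma measurable_Im g : measurable_fun [set: R * R] (fun w => Im g.[toC w]).
Proof. exact: (measurableT_comp measurable_snd (measurable_horner g)). Qed.

Lemma measurable_nsqp g : measurable_fun [set: R * R] (nsqp g).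
Proof.
by apply: measurable_funD; apply: measurable_funM; (exact: measurable_Re || exact: measurable_Im).
Qed.

Lemma measurable_nsq : measurable_fun [set: R * R] (@nsq R).
Proof.
rewrite (_ : (@nsq R) = nsqp 'X); first exact: measurable_nsqp.
by apply/funext => w; rewrite nsqpE hornerX cabs_toC.
Qed.

Lemma cint_EFin a b (f : R -> R) : continuous f ->
  (cint a b f)%:E = (\int[mu]_(x in `[a, b]) (f x)%:E)%E.
Proof.
move=> cf; rewrite /cint /Rintegral fineK//.
by apply: integrable_fin_num => //; exact: continuous_integrable.
Qed.

Definition ann a b : set (R * R) := [set z | expR (2 * a) <= nsq z <= expR (2 * b)].

Lemma measurable_ann a b : measurable (ann a b).
Proof.
rewrite (_ : ann a b = [set: R * R] `&` (@nsq R) @^-1` `[expR (2 * a), expR (2 * b)]%classic).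
  by apply: measurable_nsq => //; exact: measurable_itv.
by rewrite setTI; apply/seteqP; split => z /=; rewrite in_itv.
Qed.

Lemma ann_expc a b x y : (expc (x, y) \in ann a b) = (a <= x <= b).
Proof. by apply/idP/idP; rewrite inE /ann/= nsq_expc/= !ler_expR !ler_pM2l. Qed.

Lemma polar_annulus (F : R * R -> R) a b : cont2 (fun x y => F (expc (x, y))) ->
  polar (fun z => (\1_(ann a b) z * F z)%:E) =
  (cint a b (fun x => cint 0 (2 * pi) (fun y => F (expc (x, y)))))%:E.
Proof.
move=> cF; have cG : continuous (fun x => cint 0 (2 * pi) (fun y => F (expc (x, y)))).
  exact: (@cint_continuous R 0 (2 * pi) (fun x y => F (expc (x, y))) cF).
rewrite (cint_EFin _ _ cG) /polar [RHS]integral_mkcond; apply: eq_integral => x _.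
rewrite patchE mem_setE in_itv/=; case: ifP => xab.
  rewrite cint_EFin; last exact: (@cont2_y _ (fun x y => F (expc (x, y))) x cF).
  by apply: eq_integral => y _; rewrite indicE ann_expc xab mul1r.
rewrite integral0_eq// => y _; by rewrite indicE ann_expc xab mul0r.
Qed.

Lemma integral2_shift w (h : R * R -> \bar R) : measurable_fun [set: R * R] h ->
  (forall z, 0 <= h z)%E ->
  (\int[mu2]_z h (z.1 + w.1, z.2 + w.2)%R = \int[mu2]_z h z)%E.
Proof.
move=> mh h0.
have mw : measurable_fun [set: R * R] (fun z => (z.1 + w.1, z.2 + w.2) : R * R).
  apply/measurable_fun_pair; apply: measurable_funD;
    [exact: measurable_fst|exact: measurable_cst|exact: measurable_snd|exact: measurable_cst].
rewrite integral2_xy; [|exact: measurableT_comp mh mw|by []].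
rewrite (integral2_xy mh h0).
have mx x : measurable_fun [set: R] (fun y => h (x, y)) by exact: (measurable_fun_section x mh).
transitivity (\int[mu]_x (fun x => \int[mu]_y h (x, y)) (x + w.1)%R)%E.
  apply: eq_integral => x _ /=.
  exact: (@ge0_integral_shift _ w.2 (fun y => h ((x + w.1)%R, y)) (mx _)).
apply: ge0_integral_shift => [|x]; last exact: integral_ge0.
exact: (@measurable_fun_fubini_tonelli_F _ _ _ _ _ mu h mh h0).
Qed.

Lemma expR_lower s : 0 <= s -> s <= 2^-1 -> expR (- (2 * s)) <= 1 - s.
Proof.
move=> s0 s1; rewrite expRN -[leLHS]mul1r ler_pdivrMr ?expR_gt0//.
apply: le_trans (_ : (1 - s) * (1 + 2 * s) <= _); first by nra.
by rewrite ler_wpM2l ?expR_ge1Dx//; lra.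
Qed.

(** By e^(-2s) <= 1 - s and 1 + s <= e^s, the disk of radius s e^x about e^(x+iy) fits between the
    radii e^(x-2s) and e^(x+s). *)
Lemma disk_ann x y s z : 0 < s -> s <= 2^-1 ->
  nsq (z.1 - (expc (x, y)).1, z.2 - (expc (x, y)).2) <= expR (2 * (x + ln s)) ->
  z \in ann (x - 2 * s) (x + s).
Proof.
move=> s0 s1 h; set c := expc (x, y) in h.
have cc : cabs (toC c) = expR x.
  by apply/eqP; rewrite -(@eqrXn2 _ 2)// ?cabs_ge0 ?expR_ge0// cabs_toC nsq_expc/= expRM_natl.
have e : toC z = toC (z.1 - c.1, z.2 - c.2) + toC c.
  by rewrite /toC /=; simpc; rewrite !subrK; case: z {h}.
have h1 : cabs (toC (z.1 - c.1, z.2 - c.2)) <= s * expR x.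
  rewrite -(@ler_pXn2r _ 2)// ?nnegrE ?cabs_ge0 ?mulr_ge0 ?(ltW s0) ?expR_ge0//.
  by rewrite cabs_toC (le_trans h)// expRM_natl expRD lnK ?posrE// mulrC.
have e0 := expR_ge0 x.
have h2 := cabsD (toC (z.1 - c.1, z.2 - c.2)) (toC c).
have h3 := cabsD (toC z) (- toC (z.1 - c.1, z.2 - c.2)).
rewrite /ann inE/= -!cabs_toC ![expR (2 * _)]expRM_natl !ler_pXn2r ?nnegrE ?cabs_ge0 ?expR_ge0//.
apply/andP; split.
  rewrite expRD; have := ler_wpM2l e0 (expR_lower (ltW s0) s1).
  rewrite {1}e addrAC subrr add0r cabsN cc in h3; lra.
rewrite cc in h2; rewrite e expRD; have := ler_wpM2l e0 (expR_ge1Dx s); lra.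
Qed.

Lemma Ym_ge0 g x : 0 <= Ym g x.
Proof. by apply: cint_ge0 => y _; rewrite lg_ge0// sq_ge0. Qed.

(** Subharmonicity bounds the value at c = e^(x+iy) by means over small circles about c. Averaged
    over radii they become an area integral, which is enlarged to an annulus about 0; there [Ym] is
    monotone. *)
Lemma submean g x y s : 0 < s -> s <= 2^-1 ->
  lg (sq g x y) <= 3 * expR 3 / s * Ym g (x + s).
Proof.
move=> s0 s1.
have i1 : x - 2 * s <= x + s by lra.
have i2 : x + s - (x - 2 * s) <= 3 * s by lra.
have i3 : 2 * (s + 1) <= 3 by lra.
have i4 : 1 <= 2 * pi :> R by have := pi_ge2 R; lra.
set c := expc (x, y).
pose g' := g \Po ('X + (toC c)%:P).
have g'E w : nsqp g' w = nsqp g (w.1 + c.1, w.2 + c.2).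
  by rewrite !nsqpE /g' horner_comp hornerD hornerX hornerC.
pose F p w := lg (nsqp p w).
have F0 p w : 0 <= F p w by rewrite lg_ge0// nsqp_ge0.
have cF p : cont2 (fun x y => F p (expc (x, y))).
  have h : cont2 (fun x y => lg (sq p x y)).
    apply: (@cont2_om _ (@lg R) p) => t t0; exact: is_derive_continuous (is_derive_lg t0).
  exact: h.
have mF p : measurable_fun [set: R * R] (F p).
  apply: (measurableT_comp (@measurable_ln R)); apply: measurable_funD; first exact: measurable_cst.
  exact: measurable_nsqp.
have mI a b : measurable_fun [set: R * R] (fun z => \1_(ann a b) z : R).
  by apply: measurable_indic; exact: measurable_ann.
have mIF p a b : measurable_fun [set: R * R] (fun z => (\1_(ann a b) z * F p z)%:E).
  by apply/measurable_EFinP; apply: measurable_funM; [exact: mI|exact: mF].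
have IF0 p a b z : (0 <= (\1_(ann a b) z * F p z)%:E)%E by rewrite lee_fin mulr_ge0.
(* The circles about c have radii between s e^x / e and s e^x. *)
set a' := x + ln s - 1; set b' := x + ln s.
have ab' : a' <= b' by rewrite gerBl.
have cY p : continuous (Ym p) by exact: Ym_continuous.
have S1 : 2 * pi * lg (sq g x y) <= cint a' b' (Ym g').
  apply: le_trans (_ : cint a' b' (fun=> 2 * pi * lg (sq g x y)) <= _).
    by rewrite cint_cst// /a' opprB addrC subrK mul1r.
  apply: le_cint => // [?|t _]; first exact: cvg_cst.
  apply: le_trans (center_le_Ym g' t).
  by rewrite /g' horner_comp hornerD hornerX hornerC add0r sqE.
(* The largest value of 1 / |z - c|^2 on the small annulus, divided by the least value of 1 / |z|^2
   on the large one. *)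
pose c0 := expR (2 * (x + s) - 2 * a').
have c0p : 0 <= c0 by exact: expR_ge0.
have S2 : cint a' b' (Ym g') <= c0 * cint (x - 2 * s) (x + s) (Ym g).
  have P p a b : (cint a b (Ym p))%:E = polar (fun z => (\1_(ann a b) z * F p z)%:E).
    exact: esym (polar_annulus a b (cF p)).
  have key (u v : R) (p q : \bar R) : (u%:E = p -> v%:E = q -> p <= c0%:E * q -> (u <= c0 * v)%R)%E.
    by move=> <- <-; rewrite -EFinM lee_fin.
  apply: (key _ _ _ _ (etrans (P g' a' b') (polarE (mIF g' a' b') (IF0 g' a' b')))
    (etrans (P g (x - 2 * s) (x + s))
      (polarE (mIF g (x - 2 * s) (x + s)) (IF0 g (x - 2 * s) (x + s))))).
  pose B : set (R * R) := [set z | nsq z <= expR (2 * b')].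
  have mB : measurable B.
    rewrite (_ : B = [set: R * R] `&` (@nsq R) @^-1` `]-oo, expR (2 * b')]%classic).
      by apply: measurable_nsq => //; exact: measurable_itv.
    by rewrite setTI; apply/seteqP; split => z /=; rewrite in_itv.
  pose G (z : R * R) := (\1_B (z.1 - c.1, z.2 - c.2) * F g z)%:E.
  have mG : measurable_fun [set: R * R] G.
    apply/measurable_EFinP; apply: measurable_funM; last exact: mF.
    apply: (measurableT_comp (measurable_indic mB)).
    by apply/measurable_fun_pair; apply: measurable_funB;
      [exact: measurable_fst|exact: measurable_cst|exact: measurable_snd|exact: measurable_cst].
  have G0 z : (0 <= G z)%E by rewrite lee_fin mulr_ge0.
  have k0 := @polar_const_ge0 R.
  have mV : measurable_fun [set: R * R] (fun z => ((nsq z)^-1)%:E) := @measurable_nsqV R.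
  have mW w : measurable_fun [set: R * R] (fun z => (z.1 + w.1, z.2 + w.2) : R * R).
    by apply/measurable_fun_pair; apply: measurable_funD;
      [exact: measurable_fst|exact: measurable_cst|exact: measurable_snd|exact: measurable_cst].
  have E1 : (\int[mu2]_z (((nsq z)^-1)%:E * (\1_(ann a' b') z * F g' z)%:E) <=
      (expR (- (2 * a')))%:E * \int[mu2]_z G z)%E.
    rewrite -(integral2_shift c mG G0) -ge0_integral2Zl; first last.
    - by rewrite lee_fin expR_ge0.
    - by move=> z; exact: G0.
    - exact: measurableT_comp mG (mW c).
    apply: ge0_le_integral => //.
    - by move=> z _; rewrite mule_ge0// lee_fin invr_ge0 nsq_ge0.
    - by apply: emeasurable_funM; [exact: mV|exact: mIF].
    - by apply: emeasurable_funM; [exact: measurable_cst|exact: measurableT_comp mG (mW c)].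
    move=> [u v] _; rewrite /G -!EFinM lee_fin /= !addrK.
    have [|zA] := boolP ((u, v) \in ann a' b'); last first.
      by rewrite !indicE (negbTE zA) mul0r mulr0 mulr_ge0 ?expR_ge0// mulr_ge0 ?lg_ge0 ?nsqp_ge0.
    move=> zA; rewrite !indicE zA; have /set_mem/andP[z1 z2] := zA.
    rewrite mem_set// mul1r mul1r /F g'E /= ler_wpM2r ?lg_ge0 ?nsqp_ge0//.
    by rewrite expRN lef_pV2// posrE ?expR_gt0// (lt_le_trans _ z1)// expR_gt0.
  have E2 : (\int[mu2]_z G z <= (expR (2 * (x + s)))%:E * \int[mu2]_z (((nsq z)^-1)%:E *
      (\1_(ann (x - 2 * s) (x + s)) z * F g z)%:E))%E.
    rewrite -ge0_integral2Zl; first last.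
    - by rewrite lee_fin expR_ge0.
    - by move=> z; rewrite mule_ge0// lee_fin invr_ge0 nsq_ge0.
    - by apply: emeasurable_funM; [exact: mV|exact: mIF].
    apply: ge0_le_integral => //.
      apply: emeasurable_funM; [exact: measurable_cst|].
      by apply: emeasurable_funM; [exact: mV|exact: mIF].
    move=> z _; rewrite /G -!EFinM lee_fin.
    have [|zB] := boolP ((z.1 - c.1, z.2 - c.2) \in B); last first.
      rewrite [X in X * _ <= _]indicE (negbTE zB) mul0r mulr_ge0 ?expR_ge0//.
      by rewrite mulr_ge0 ?invr_ge0 ?nsq_ge0// mulr_ge0 ?lg_ge0 ?nsqp_ge0.
    move=> zB'; rewrite [X in X * _ <= _]indicE zB'; have /set_mem zB := zB'.
    have zA := disk_ann s0 s1 zB.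
    rewrite indicE zA !mul1r mulrA ler_peMl ?F0//.
    have /set_mem/andP[z1 z2] := zA.
    by rewrite ler_pdivlMr ?mul1r// (lt_le_trans _ z1)// expR_gt0.
  have -> : c0%:E = ((expR (- (2 * a')))%:E * (expR (2 * (x + s)))%:E)%E.
    by rewrite /c0 expRD mulrC.
  apply: le_trans (lee_wpmul2l k0 E1) _.
  rewrite muleCA -muleA; apply: lee_wpmul2l; first by rewrite lee_fin expR_ge0.
  apply: le_trans (lee_wpmul2l k0 E2) _.
  by rewrite muleCA.
have S3 : cint (x - 2 * s) (x + s) (Ym g) <= 3 * s * Ym g (x + s).
  apply: le_trans (_ : cint (x - 2 * s) (x + s) (fun=> Ym g (x + s)) <= _).
    apply: le_cint; [exact: cY|by move=> ?; exact: cvg_cst|].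
    by move=> t /andP[_ ts]; exact: Ym_homo.
  by rewrite (cint_cst _ i1); exact: (ler_wpM2r (Ym_ge0 g (x + s)) i2).
have Y0 := Ym_ge0 g (x + s).
have S4 : c0 <= expR 3 / s ^+ 2.
  rewrite /c0 (_ : _ - _ = 2 * (s + 1) - 2 * ln s); last by rewrite /a'; ring.
  rewrite expRD expRN [expR (2 * ln s)]expRM_natl lnK ?posrE//.
  by rewrite ler_wpM2r ?invr_ge0 ?sqr_ge0// ler_expR.
have l0 := lg_ge0 (sq_ge0 g x y).
have S5 : lg (sq g x y) <= 2 * pi * lg (sq g x y).
  by rewrite ler_peMl.
apply: le_trans S5 _; apply: le_trans S1 _; apply: le_trans S2 _.
apply: le_trans (_ : c0 * (3 * s * Ym g (x + s)) <= _); first by rewrite ler_wpM2l.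
apply: le_trans (_ : expR 3 / s ^+ 2 * (3 * s * Ym g (x + s)) <= _).
  by rewrite ler_wpM2r// mulr_ge0// mulr_ge0// ltW.
rewrite (_ : _ * (3 * s * _) = 3 * expR 3 / s * Ym g (x + s))//.
by field; rewrite gt_eqF.
Qed.

End SubMean.

(** * The cost of doubling the circle mean *)

Section DoublingChain.
Variable R : realType.
Implicit Types (g : {poly R[i]}) (a b c d s x y : R).

Lemma cint_split a b c (f : R -> R) : continuous f -> (forall x, 0 <= f x) ->
  a <= b -> b <= c -> cint a c f = cint a b f + cint b c f.
Proof.
move=> cf f0 ab bc; apply: EFin_inj; rewrite EFinD !cint_EFin//.
apply: ge0_integral_itv_split => //; apply/measurable_EFinP.
exact: continuous_measurable_fun.
Qed.

Let ct g : continuous (fun x => cint 0 (2 * pi) (fun y => theta (PU g x y) ^+ 2)).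
Proof. exact: (@cint_continuous R 0 (2 * pi) (fun x y => theta (PU g x y) ^+ 2) (@cont2_theta2 _ g)). Qed.

Let t0 g x : 0 <= cint 0 (2 * pi) (fun y => theta (PU g x y) ^+ 2).
Proof. by apply: cint_ge0 => y _; exact: sqr_ge0. Qed.

Lemma Th_ge0 g a b : 0 <= Th g a b.
Proof. by apply: cint_ge0 => x _; exact: t0. Qed.

Lemma Th_split g a b c : a <= b -> b <= c -> Th g a c = Th g a b + Th g b c.
Proof. exact: cint_split (@ct g) (@t0 g). Qed.

Lemma Th_le g a b c : a <= b -> b <= c -> Th g a b <= Th g a c.
Proof. by move=> ab bc; rewrite (Th_split g ab bc) lerDl Th_ge0. Qed.

Lemma Wm_le g x M : (forall y, lg (sq g x y) <= M) -> Wm g x <= (M + 1) * Ym g x.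
Proof.
move=> lM; have cl (f : R -> R) : (forall t, 0 <= t -> {for t, continuous f}) ->
    continuous (fun y => f (sq g x y)).
  move=> cf; exact: (@cont2_y _ (fun x y => f (sq g x y)) x (@cont2_om _ f g cf)).
have c1 := cl (@lg R) (fun t t0 => is_derive_continuous (is_derive_lg t0)).
have c2 := cl (@lw R) (fun t t0 => is_derive_continuous (is_derive_lw t0)).
rewrite /Wm /Ym /cmean -cintZ//; apply: le_cint => //.
  by move=> y; apply: cvgM; [exact: cvg_cst|exact: c1].
move=> y _; have l0 := lg_ge0 (sq_ge0 g x y).
by rewrite /lw -[X in _ + X]mul1r -mulrDl ler_wpM2r// lerD2r.
Qed.

Local Opaque Ym Wm Wm1 Th c6 sq.

Lemma submean_const : exists2 K : R, 0 < K & forall g x y s, 0 < s -> s <= 2^-1 ->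
  lg (sq g x y) <= K / s * Ym g (x + s).
Proof. by exists (3 * expR 3); [rewrite mulr_gt0 ?expR_gt0|exact: submean]. Qed.

(** Taken from an existence statement, so that later arithmetic sees only its sign and its
    inequality. *)
Definition sub_const : R := s2val (cid2 submean_const).
Definition curv_const : R := 2 * (1 + 2 * sub_const).

Lemma sub_const_gt0 : 0 < sub_const. Proof. by rewrite /sub_const; case: cid2. Qed.
Lemma sub_constP g x y s : 0 < s -> s <= 2^-1 -> lg (sq g x y) <= sub_const / s * Ym g (x + s).
Proof. by rewrite /sub_const; case: cid2 => K /= _; exact. Qed.
Lemma curv_const_gt0 : 0 < curv_const. Proof. by have := sub_const_gt0; rewrite /curv_const; lra. Qed.

(** Convexity gives s [Wm1] (b) <= [Wm] (b + s). On the circle b + s the sub-mean inequality bounds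
    [lg] by (K / s) [Ym] (b + 2s) <= 2 K Y / s with Y = [Ym] (b), so [Wm] there is at most (2 K Y /
    s + 1) 2 Y; finally s <= 1 <= Y. *)
Lemma Wm1_doubling g b s : 0 < s -> s <= 2^-1 -> 1 <= Ym g b -> Ym g (b + 2 * s) <= 2 * Ym g b ->
  Wm1 g b <= curv_const * Ym g b ^+ 2 / s ^+ 2.
Proof.
move=> s0 s1 Y1 Y2; have K0 := sub_const_gt0.
have e2 : b + s + s = b + 2 * s by rewrite mulr_natl mulr2n addrA.
have h1 := Wm1_le g b s0.
have Y0 := Ym_ge0 g (b + s).
have Y3 : Ym g (b + s) <= 2 * Ym g b by apply: le_trans Y2; apply: Ym_homo; rewrite lerD2l ler_peMl ?(ltW s0)// ler1n.
have h2 y : lg (sq g (b + s) y) <= sub_const / s * (2 * Ym g b).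
  apply: le_trans (sub_constP g (b + s) y s0 s1) _.
  apply: ler_wpM2l; first exact: (divr_ge0 (ltW K0) (ltW s0)).
  rewrite e2; exact: Y2.
have h3 := Wm_le h2; move: h1 h2 h3 Y0 Y1 Y2 Y3 K0; rewrite /curv_const.
move: (Ym g (b + 2 * s)) (Ym g (b + s)) (Ym g b) (Wm1 g b) (Wm g (b + s)) sub_const.
move=> Y2 Y1 Y W1 W K h1 _ h3 p1 p2 p3 p4 p5.
rewrite ler_pdivlMr ?exprn_gt0// expr2 mulrA.
apply: le_trans (_ : ((K / s * (2 * Y) + 1) * Y1) * s <= _).
  by rewrite ler_wpM2r ?(ltW s0)//; apply: le_trans h1 _.
apply: le_trans (_ : ((K / s * (2 * Y) + 1) * (2 * Y)) * s <= _).
  rewrite ler_wpM2r ?(ltW s0)// ler_wpM2l// addr_ge0//.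
  by rewrite mulr_ge0 ?divr_ge0 ?(ltW s0) ?(ltW p5)//; lra.
have -> : (K / s * (2 * Y) + 1) * (2 * Y) * s = 2 * Y * (K * (2 * Y) + s).
  by field; rewrite gt_eqF.
rewrite expr2; nra.
Qed.

(** Above this level [Ym] is at least 1 and the additive loss [c6] is at most an eighth of it. *)
Definition thr : R := 8 * `|c6 R| + 1.
(** 576 = 64 * 9: the choice of tau in [Th_doubling] gives s^2 / (64 [curv_const]), and s is a third
    of the step. *)
Definition chain_const : R := (576 * curv_const)^-1.

Lemma chain_const_gt0 : 0 < chain_const.
Proof. by rewrite invr_gt0; apply: mulr_gt0; [rewrite ltr0n|exact: curv_const_gt0]. Qed.

(** With Y = [Ym] (b), the growth term of [Ym_incr] is at least Y/4 - Y/8. [tau] makes the curvature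
    term at most Y/16, so tau [Th] >= Y/16, and Y cancels against the factor Y in [tau]. *)
Lemma Th_doubling g a b c : a <= b -> b <= c -> c - b <= 1 -> 2 * Ym g a <= Ym g b ->
  Ym g c <= 2 * Ym g b -> thr <= Ym g b -> chain_const * (c - b) ^+ 2 <= Th g a b.
Proof.
move=> ab; rewrite le_eqVlt => /predU1P[->|bc] d1 Yab Ycb Yb.
  by rewrite subrr expr0n/= mulr0 Th_ge0.
have [s [s0 s1 s2 sE]] : exists s, [/\ 0 < s, s <= 2^-1, 2 * s <= c - b & c - b = 3 * s].
  by exists ((c - b) / 3); move: bc d1 => {Yab Ycb Yb} bc d1; split; lra.
have D0 := curv_const_gt0.
have n0 := normr_ge0 (c6 R).
have Y1 : 1 <= Ym g b by apply: le_trans Yb; rewrite /thr lerDr; exact: mulr_ge0.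
have Y2 : Ym g (b + 2 * s) <= 2 * Ym g b.
  by apply: le_trans Ycb; apply: Ym_homo; rewrite -lerBrDl; exact: s2.
have W := Wm1_doubling s0 s1 Y1 Y2.
have Y0 : 0 < Ym g b by exact: lt_le_trans ltr01 Y1.
pose tau := 4 * curv_const * Ym g b / s ^+ 2.
have tau0 : 0 < tau.
  apply: divr_gt0; last exact: exprn_gt0.
  by apply: mulr_gt0; [apply: mulr_gt0|].
have I := Ym_incr g tau0 ab.
have tau1 : 0 <= (4 * tau)^-1 by rewrite invr_ge0; apply: mulr_ge0; [rewrite ler0n|exact: ltW].
have W2 := ler_wpM2l tau1 W.
have nc := ler_norm (c6 R).
move: I W2 Yab Yb n0 nc tau0; rewrite sE /chain_const /tau /thr.
move: (Th g a b) (Wm1 g b) (Ym g a) (Ym g b) (c6 R) curv_const Y0 D0 s0.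
move=> t w ya y c6 D y0 D0 s0; clear -t w ya y c6 D y0 D0 s0 => I W2 h1 h2 h3 h4 tau0.
have E : (4 * (4 * D * y / s ^+ 2))^-1 * (D * y ^+ 2 / s ^+ 2) = y / 16.
  by field; rewrite !gt_eqF.
rewrite E in W2.
have -> : (576 * D)^-1 * (3 * s) ^+ 2 = y / 16 / (4 * D * y / s ^+ 2).
  by field; rewrite !gt_eqF.
rewrite ler_pdivrMr// [leRHS]mulrC; move: (_ * t) (_^-1 * w) I W2 => ? ? ? ?.
by move: `|c6| h2 h3 h4 => *; lra.
Qed.

(** If [Ym] more than doubles on [b, c], cut at a point x where it has just doubled. The step x - b
    is charged to [a, b], and the remaining step c - x, by induction, to [b, c], with b and x in the
    roles of a and b. *)
Lemma Th_chain g J a b c : a <= b -> b <= c -> c - b <= 1 -> 2 * Ym g a <= Ym g b ->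
  thr <= Ym g b -> Ym g c <= 2 ^+ J.+1 * Ym g b ->
  chain_const * (c - b) ^+ 2 / J.+1%:R <= Th g a c.
Proof.
have K0 := chain_const_gt0.
have base J' a' b' c' : a' <= b' -> b' <= c' -> c' - b' <= 1 -> 2 * Ym g a' <= Ym g b' ->
    thr <= Ym g b' -> Ym g c' <= 2 * Ym g b' ->
    chain_const * (c' - b') ^+ 2 / J'.+1%:R <= Th g a' c'.
  move=> ab bc d1 Yab Yb Yc; apply: le_trans (Th_le g ab bc).
  apply: le_trans (Th_doubling ab bc d1 Yab Yc Yb).
  apply: ler_piMr; first exact: (mulr_ge0 (ltW K0) (sqr_ge0 _)).
  by rewrite invf_le1 ?ltr0n ?ler1n.
elim: J a b c => [|J IH] a b c ab bc d1 Yab Yb Yc.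
  by apply: base => //; rewrite expr1 in Yc.
have [Ycb|Ycb] := leP (Ym g c) (2 * Ym g b); first exact: base.
have Y0 : 0 < Ym g b.
  by apply: lt_le_trans Yb; rewrite /thr ltr_wpDl// mulr_ge0.
have Y1 : Ym g b <= 2 * Ym g b.
  by apply: ler_peMl; [exact: ltW Y0|rewrite ler1n].
have [x /[!in_itv]/= /andP[bx xc] Yx] : exists2 x, x \in `[b, c] & Ym g x = 2 * Ym g b.
  apply: IVT; first exact: bc.
    by apply: continuous_subspaceT => ?; exact: Ym_continuous.
  have YY := Ym_homo g bc; rewrite (min_l YY) (max_r YY); apply/andP; split; last exact: ltW Ycb.
  exact: Y1.
have H1 : chain_const * (x - b) ^+ 2 <= Th g a b.
  apply: (@Th_doubling g a b x ab bx); [|exact: Yab| |exact: Yb].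
    by apply: le_trans d1; rewrite lerD2r; exact: xc.
  by rewrite Yx; exact: lexx.
have H2 : chain_const * (c - x) ^+ 2 / J.+1%:R <= Th g b c.
  apply: (IH b x c bx xc).
  - by apply: le_trans d1; rewrite lerD2l lerN2; exact: bx.
  - by rewrite Yx; exact: lexx.
  - by rewrite Yx; exact: le_trans Yb Y1.
  - by rewrite Yx mulrA -exprSr; exact: Yc.
rewrite (Th_split g ab bc); apply: le_trans (lerD H1 H2).
rewrite -(natr1 J.+1) -!(mulrA chain_const) -mulrDr ler_wpM2l ?(ltW K0)//.
have j0 : 0 < J.+1%:R :> R by rewrite ltr0n.
have -> : c - b = (x - b) + (c - x) by ring.
move: J.+1%:R j0 (x - b) (c - x) => j j0 u v.
(* Cauchy-Schwarz: (u + v)^2 <= (j + 1) (u^2 + v^2 / j). *)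
rewrite ler_pdivrMr ?ltr_wpDr// -(ler_pM2r j0) -subr_ge0.
have -> : (u ^+ 2 + v ^+ 2 / j) * (j + 1) * j - (u + v) ^+ 2 * j = (u * j - v) ^+ 2.
  by field; rewrite gt_eqF.
exact: sqr_ge0.
Qed.

End DoublingChain.

(** * From logarithmic area to planar area *)

Section NegativeArea.
Variable R : realType.
Local Notation mu := (@lebesgue_measure R).
Local Notation mu2 := (mu \x mu)%E.
Implicit Types (f g : {poly R[i]}) (z w : R * R) (a b c s x y r : R).

Definition negset g r : set (R * R) := [set w | cabs (toC w) <= r /\ Re g.[toC w] < 0].

Lemma measurable_cabs g : measurable_fun [set: R * R] (fun w => cabs g.[toC w]).
Proof.
rewrite (_ : (fun _ => _) = (fun w => Num.sqrt (nsqp g w))).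
  by apply: measurableT_comp (measurable_nsqp g); exact: continuous_measurable_fun (@sqrt_continuous R).
by apply/funext => w; rewrite nsqpE sqrtr_sqr ger0_norm// cabs_ge0.
Qed.

Lemma measurable_cabs_toC : measurable_fun [set: R * R] (fun w => cabs (toC w)).
Proof.
rewrite (_ : (fun _ => _) = (fun w => cabs ('X : {poly R[i]}).[toC w])); first exact: measurable_cabs.
by apply/funext => w; rewrite hornerX.
Qed.

Lemma measurable_preimage_itv (F : R * R -> R) (i : interval R) : measurable_fun [set: R * R] F ->
  measurable [set w | F w \in i].
Proof.
move=> mF; rewrite (_ : [set w | _] = [set: R * R] `&` F @^-1` [set` i]); last by rewrite setTI.
by apply: mF => //; exact: measurable_itv.
Qed.

Lemma measurable_negset g r : measurable (negset g r).
Proof.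
rewrite (_ : negset g r = [set w | cabs (toC w) \in `]-oo, r]] `&`
    [set w | Re g.[toC w] \in `]-oo, 0[]).
  apply: measurableI; apply: measurable_preimage_itv; [exact: measurable_cabs_toC|exact: measurable_Re].
by apply/seteqP; split => w /=; rewrite /negset /= !in_itv/=.
Qed.

(** On the annulus the density 1 / |z|^2 is at most e^(-2a), and theta^2 <= 4 is supported on {Re g
    < 0}. *)
Lemma Th_le_area g a b : ((Th g a b)%:E <=
  polar_const R * ((4 * expR (- (2 * a)))%:E * mu2 (negset g (expR b))))%E.
Proof.
pose F w := theta (Re g.[toC w]) ^+ 2.
have mF : measurable_fun [set: R * R] F.
  apply: measurable_funX; apply: measurableT_comp (measurable_Re g).
  exact: continuous_measurable_fun (@continuous_theta R).
have mIF : measurable_fun [set: R * R] (fun z => (\1_(ann a b) z * F z)%:E).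
  apply/measurable_EFinP; apply: measurable_funM; last exact: mF.
  by apply: measurable_indic; exact: measurable_ann.
have IF0 z : (0 <= (\1_(ann a b) z * F z)%:E)%E by rewrite lee_fin mulr_ge0// sqr_ge0.
have -> : (Th g a b)%:E = polar (fun z => (\1_(ann a b) z * F z)%:E).
  exact: esym (polar_annulus a b (@cont2_theta2 R g)).
rewrite (polarE mIF IF0); apply: lee_wpmul2l; first exact: polar_const_ge0.
have mN := measurable_negset g (expR b).
have -> : mu2 (negset g (expR b)) = (\int[mu2]_z (\1_(negset g (expR b)) z)%:E)%E.
  by rewrite integral_indic// setIT.
rewrite -ge0_integral2Zl; first last.
- by rewrite lee_fin mulr_ge0// expR_ge0.
- by move=> z; rewrite lee_fin.
- by apply/measurable_EFinP; exact: measurable_indic.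
apply: ge0_le_integral.
- exact: measurableT.
- by move=> z _; apply: mule_ge0; [rewrite lee_fin invr_ge0 nsq_ge0|exact: IF0].
- by apply: emeasurable_funM; [exact: measurable_nsqV|exact: mIF].
- apply: emeasurable_funM; [exact: measurable_cst|].
  by apply/measurable_EFinP; exact: measurable_indic.
move=> z _; rewrite -!EFinM lee_fin.
have [zA|zA] := boolP (z \in ann a b); last first.
  by rewrite indicE (negbTE zA) mul0r mulr0 mulr_ge0// mulr_ge0// expR_ge0.
have /set_mem/andP[z1 z2] := zA; rewrite [X in _ * (X * _) <= _]indicE zA mul1r.
have [u0|u0] := leP 0 (Re g.[toC z]).
  by rewrite /F theta_pos// expr0n/= mulr0 mulr_ge0// mulr_ge0// expR_ge0.
have zN : negset g (expR b) z.
  split => //; rewrite -(@ler_pXn2r _ 2)// ?nnegrE ?cabs_ge0 ?expR_ge0//.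
  by rewrite cabs_toC -expRM_natl.
rewrite indicE mem_set// mulr1 mulrC; apply: ler_pM; rewrite ?sqr_ge0 ?invr_ge0 ?nsq_ge0//.
  rewrite /F (_ : 4 = 2 ^+ 2); last by rewrite -natrX.
  by rewrite lerXn2r ?nnegrE ?theta_ge0 ?theta_le2.
by rewrite expRN lef_pV2// posrE ?expR_gt0// (lt_le_trans _ z1)// expR_gt0.
Qed.

(** Since e^(1/2) <= 2, about 2 (|ln A| + ln (2 + l)) doublings suffice; constants are absorbed
    through ln 2 <= ln (2 + l). *)
Lemma log_log_steps A : 0 < A -> exists2 C, 0 < C & forall l : R, 0 <= l ->
  exists J, A * (2 + l) <= 2 ^+ J.+1 /\ J.+1%:R <= C * ln (2 + l).
Proof.
move=> A0; have ln2 : 0 < ln 2 :> R by rewrite ln_gt0// ltr1n.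
have q0 : 0 <= (2 * `|ln A| + 1) / ln 2 by rewrite divr_ge0 ?(ltW ln2)// addr_ge0// mulr_ge0.
exists (2 + (2 * `|ln A| + 1) / ln 2) => [|l l0]; first by rewrite ltr_pwDl.
have p : 0 < 2 + l by rewrite ltr_pwDl.
have L2 : ln 2 <= ln (2 + l) by rewrite ler_ln ?posrE// lerDl.
pose Q := 2 * (`|ln A| + ln (2 + l)).
have Q0 : 0 <= Q by rewrite mulr_ge0// addr_ge0// (le_trans (ltW ln2)).
exists (Num.trunc Q); have /andP[J1 J2] := truncn_itv Q0; split.
  have -> : A * (2 + l) = expR (ln A + ln (2 + l)) by rewrite expRD !lnK.
  apply: le_trans (_ : expR (2^-1 * (Num.trunc Q).+1%:R) <= _).
    rewrite ler_expR; apply: le_trans (_ : 2^-1 * Q <= _); last by rewrite ler_wpM2l// ltW.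
    by rewrite /Q mulKf// lerD2r ler_norm.
  rewrite mulrC expRM_natl lerXn2r ?nnegrE ?expR_ge0//.
  have e0 : 0 < expR 2^-1 :> R by exact: expR_gt0.
  have h : 2^-1 <= (expR 2^-1)^-1 :> R.
    by rewrite -expRN; apply: le_trans (expR_ge1Dx _); lra.
  move: e0 h; move: (expR 2^-1) => e e0; rewrite lef_pV2 ?posrE//.
rewrite -natr1; apply: le_trans (_ : Q + 1 <= _); first by rewrite lerD2r.
have : (2 * `|ln A| + 1) / ln 2 * ln 2 <= (2 * `|ln A| + 1) / ln 2 * ln (2 + l).
  by rewrite ler_wpM2l.
rewrite divfK ?gt_eqF// /Q; set q := _ / ln 2; rewrite [(2 + q) * _]mulrDl.
by lra.
Qed.

Lemma ln2_le1 : ln 2 <= 1 :> R.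
Proof.
rewrite -[leRHS]expRK ler_ln ?posrE ?expR_gt0//.
by apply: le_trans (expR_ge1Dx 1); rewrite mulr2n.
Qed.

Lemma thr_ge1 : 1 <= thr R.
Proof. by rewrite /thr lerDr; apply: mulr_ge0. Qed.

Local Opaque Ym Th sq thr chain_const sub_const.

Lemma Ym_le g x B : (forall y, cabs g.[expi x y] <= B) -> Ym g x <= 2 * pi * lg (B ^+ 2).
Proof.
move=> gB; have B0 : 0 <= B by exact: le_trans (cabs_ge0 _) (gB 0).
have cl : continuous (fun y => lg (sq g x y)).
  apply: (@cont2_y _ (fun x y => lg (sq g x y)) x); apply: (@cont2_om _ (@lg R) g) => t t0.
  exact: is_derive_continuous (is_derive_lg t0).
apply: le_trans (_ : cint 0 (2 * pi) (fun=> lg (B ^+ 2)) <= _); last first.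
  by rewrite cint_cst ?subr0// pi2_ge0.
apply: le_cint => [|?|y _]; [exact: cl|exact: cvg_cst|].
apply: lg_homo; first exact: sq_ge0.
by rewrite sqE lerXn2r ?nnegrE ?cabs_ge0.
Qed.

(** f is rescaled to g = (K / m) f. Then [Ym] is at most 2 pi ln 2 on a tiny circle, at least [T]
    slightly beyond r0, and at most A (2 + ln M) further out, so [Th_chain] applies with J of order
    ln (2 + ln M). *)
Lemma negset_area_ge (r0 r1 : R) : 0 < r0 -> r0 < r1 ->
  exists k0 c : R, [/\ 0 < k0, 0 < c & forall f (m M : R), 0 < m -> 1 <= M ->
    (forall z : R[i], cabs z <= r0 -> cabs f.[z] <= m) ->
    (exists2 z : R[i], cabs z <= r0 & m / 2 <= cabs f.[z]) ->
    (forall z : R[i], cabs z <= r1 -> cabs f.[z] <= M * m) ->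
    cabs f.[0] <= k0 * m ->
    ((c / ln (2 + ln M))%:E <= mu2 (negset f r1))%E].
Proof.
move=> r00 r01; have r10 : 0 < r1 by exact: lt_trans r01.
have [s [s0 s1 s2]] : exists s : R, [/\ 0 < s, s <= 2^-1 & ln r0 + 2 * s <= ln r1].
  have l01 : ln r0 < ln r1 by rewrite ltr_ln.
  have [h|h] := leP ((ln r1 - ln r0) / 2) 2^-1.
    by exists ((ln r1 - ln r0) / 2); move: (ln r0) (ln r1) l01 h => *; split; lra.
  by exists 2^-1; move: (ln r0) (ln r1) l01 h => *; split; lra.
have C0 := sub_const_gt0 R.
(* Above the threshold of [Th_chain], and at least twice the value 2 pi ln 2 that bounds [Ym] where
   |g| <= 1. *)
pose T : R := thr R + 4 * pi * ln 2.
have thr0 := thr_ge1.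
have pl0 : 0 <= 4 * pi * ln 2 :> R by rewrite mulr_ge0 ?mulr_ge0 ?pi_ge0// ln_ge0// ler1n.
have T1 : thr R <= T by rewrite lerDl.
have T2 : 4 * pi * ln 2 <= T by rewrite lerDr (le_trans ler01).
have T0 : 0 <= T by exact: le_trans (le_trans ler01 thr0) T1.
(* K is so large that a single point with |g| >= K/2 forces [Ym] >= T through the sub-mean
   inequality. *)
have [K [K2 lK]] : exists K : R, 2 <= K /\ sub_const R / s * T <= lg ((K / 2) ^+ 2).
  exists (2 * expR (sub_const R * T / s / 2)).
  split.
    rewrite ler_pMr// -expR0 ler_expR; apply: divr_ge0 => //.
    by apply: divr_ge0 (ltW s0); exact: mulr_ge0 (ltW C0) T0.
  set e := expR _; rewrite [2 * e / 2]mulrAC divff ?mul1r ?pnatr_eq0//; have e0 : 0 < e by exact: expR_gt0.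
  apply: le_trans (_ : ln (e ^+ 2) <= _).
    by rewrite -expRM_natl expRK mulrCA divff// mulr1 mulrAC.
  by rewrite /lg ler_ln ?posrE ?lerDr// ?ltr_pwDl ?sqr_ge0// exprn_gt0.
have K0 : 0 < K by exact: lt_le_trans K2.
pose A : R := 2 * pi * (1 + 2 * ln K + 2).
have lnK0 : 0 <= ln K by rewrite ln_ge0// (le_trans _ K2)// ler1n.
have A0 : 0 < A by rewrite !mulr_gt0 ?pi_gt0//; move: lnK0; lra.
have [C C1 HJ] := log_log_steps A0.
have k1 := polar_const_gt0 R; have k2 := polar_const_lty R.
have [k [k3 kE]] : exists k : R, 0 < k /\ polar_const R = k%:E.
  move: k1 k2; case: (polar_const R) => [k| |]//; exists k; split => //.
(* On the circle of radius t r0, g differs from g(0) by at most 2 t K = 1/2, and |g(0)| <= 1/2 by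
   the choice of k0 = 1 / (2 K); hence |g| <= 1 there. *)
pose t : R := (4 * K)^-1.
have t0 : 0 < t by rewrite invr_gt0 mulr_gt0.
have t1 : t <= 2^-1.
  rewrite lef_pV2 ?posrE ?mulr_gt0 ?ltr0n//.
  by apply: le_trans K2 _; rewrite ler_peMl ?ler1n// ltW.
have t2 : t <= 1 by apply: le_trans t1 _; rewrite invf_le1// ler1n.
have tK : t * K = 4^-1 by rewrite /t; field; rewrite gt_eqF.
pose xL := ln (t * r0); pose x0 := ln r0 + s; pose xB := ln r0 + 2 * s.
have xL0 : xL <= x0.
  apply: le_trans (_ : ln r0 <= _); last by rewrite lerDl ltW.
  rewrite ler_ln ?posrE ?mulr_gt0//; exact: ler_piMl (ltW r00) t2.
have x0B : x0 <= xB by rewrite lerD2l ler_peMl ?(ltW s0)// ler1n.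
have dx : xB - x0 = s by rewrite /xB /x0; ring.
(* The second constant is solved from the chain bound and [Th_le_area], where t r0 is the inner
   radius and k the polar constant. *)
exists ((2 * K)^-1), (chain_const R * s ^+ 2 / C / k * (t * r0) ^+ 2 / 4); split.
- by rewrite invr_gt0 mulr_gt0.
- apply: mulr_gt0; last by rewrite invr_gt0.
  apply: mulr_gt0; last exact: exprn_gt0 (mulr_gt0 t0 r00).
  apply: mulr_gt0; last by rewrite invr_gt0.
  apply: mulr_gt0; last by rewrite invr_gt0.
  exact: mulr_gt0 (chain_const_gt0 R) (exprn_gt0 2 s0).
move=> f m M m0 M1 fr0 [z0 z0r fz0] fr1 f0.
pose g := ((K / m)%:C%C) *: f.
have gE (z : R[i]) : cabs g.[z] = K / m * cabs f.[z].
  by rewrite hornerZ cabsM cabs_real ger0_norm// divr_ge0 ?ltW.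
have Km : 0 < K / m by rewrite divr_gt0.
have gr0 (z : R[i]) : cabs z <= r0 -> cabs g.[z] <= K.
  by move=> /fr0 h; rewrite gE mulrAC (ler_pdivrMr _ _ m0); exact: (ler_wpM2l (ltW K0) h).
have gr1 (z : R[i]) : cabs z <= r1 -> cabs g.[z] <= K * M.
  by move=> /fr1 h; rewrite gE mulrAC (ler_pdivrMr _ _ m0) -mulrA; exact: (ler_wpM2l (ltW K0) h).
have g0 : cabs g.[0] <= 2^-1.
  rewrite gE; apply: le_trans (ler_wpM2l (ltW Km) f0) _.
  by rewrite le_eqVlt; apply/orP; left; apply/eqP; field; rewrite !gt_eqF.
have gz0 : K / 2 <= cabs g.[z0].
  rewrite gE; apply: le_trans (ler_wpM2l (ltW Km) fz0).
  by rewrite le_eqVlt; apply/orP; left; apply/eqP; field; rewrite gt_eqF.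
have z0n : z0 != 0.
  by apply/eqP => e; move: gz0 g0; rewrite e; move: K2; move: (cabs _) => *; lra.
have Y0 : T <= Ym g x0.
  have [x [y zE]] := expi_surj z0n.
  have xr : x <= ln r0 by rewrite -ler_expR lnK ?posrE// -(cabs_expi x y) -zE.
  apply: le_trans (Ym_homo g (_ : x + s <= x0)); last by rewrite lerD2r.
  have S := sub_constP g x y s0 s1.
  rewrite -(ler_pM2l (divr_gt0 C0 s0)); apply: le_trans S; apply: le_trans lK _.
  apply: lg_homo; first exact: sqr_ge0.
  by rewrite sqE -zE lerXn2r ?nnegrE ?cabs_ge0// divr_ge0 ?(ltW K0).
have YL : 2 * Ym g xL <= Ym g x0.
  apply: le_trans Y0; apply: le_trans T2.
  have -> : 4 * pi * ln 2 = 2 * (2 * pi * lg (1 ^+ 2)) :> R.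
    by rewrite /lg expr1n -[1 + 1]/(2%:R) !mulrA -natrM.
  apply: ler_wpM2l => //; apply: Ym_le => y.
  have cE : cabs (expi xL y) <= t * r0 by rewrite cabs_expi lnK// posrE mulr_gt0.
  have gr (z : R[i]) : cabs z = r0 -> cabs g.[z] <= K by move=> zr; apply: gr0; rewrite zr.
  have := horner_near0 r00 gr (ltW t0) t1 cE.
  have := cabsD (g.[expi xL y] - g.[0]) g.[0]; rewrite subrK.
  rewrite -mulrA tK; move: (cabs _) (cabs (_ - _)) (cabs g.[0]) g0 => a b c *; lra.
have YB : Ym g xB <= A * (2 + ln M).
  apply: le_trans (_ : 2 * pi * lg ((K * M) ^+ 2) <= _).
    apply: Ym_le => y; apply: gr1; rewrite cabs_expi.
    by rewrite -[leRHS](@lnK _ r1) ?posrE// ler_expR.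
  rewrite /A -(mulrA (2 * pi)); apply: ler_wpM2l; first exact: pi2_ge0.
  have M0 : 0 < M by exact: lt_le_trans M1.
  have KM : 1 <= K * M by rewrite mulr_ege1// (le_trans _ K2)// ler1n.
  apply: le_trans (_ : ln (2 * (K * M) ^+ 2) <= _).
    rewrite ler_ln ?posrE ?mulr_gt0 ?exprn_gt0 ?mulr_gt0// ?ltr_pwDl ?sqr_ge0//.
    by rewrite mulr_natl mulr2n lerD2r exprn_ege1.
  rewrite lnM ?posrE ?exprn_gt0 ?mulr_gt0// lnXn ?mulr_gt0// lnM ?posrE//.
  have ln21 := ln2_le1.
  have lM0 : 0 <= ln M by rewrite ln_ge0.
  move: ln21 lM0 lnK0; move: (ln 2) (ln M) (ln K) => a b c a1 b0 c0.
  have := mulr_ge0 b0 c0; clear -a1 b0 c0; rewrite mulr2n; nra.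
have lM0 : 0 <= ln M by rewrite ln_ge0.
have [J [J1 J2]] := HJ (ln M) lM0.
have Ythr : thr R <= Ym g x0 by exact: le_trans Y0.
have Y1 : 1 <= Ym g x0 by exact: le_trans Ythr.
have YBJ : Ym g xB <= 2 ^+ J.+1 * Ym g x0.
  apply: le_trans YB _; apply: le_trans J1 _; apply: ler_peMr; last exact: Y1.
  exact: exprn_ge0.
have d1 : xB - x0 <= 1 by rewrite dx; apply: le_trans s1 _; rewrite invf_le1 ?ltr0n ?ler1n.
have H := Th_chain xL0 x0B d1 YL Ythr YBJ; rewrite dx in H.
have U := Th_le_area g xL xB.
have L0 : 0 < ln (2 + ln M).
  by apply: ln_gt0; apply: (@lt_le_trans _ _ 2); [rewrite ltr1n|rewrite lerDl].
have U2 : (mu2 (negset g (expR xB)) <= mu2 (negset f r1))%E.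
  apply: le_measure; rewrite ?inE; [exact: measurable_negset|exact: measurable_negset|].
  move=> w [w1 w2]; split.
    by apply: le_trans w1 _; rewrite -[leRHS](@lnK _ r1) ?posrE// ler_expR.
  by move: w2; rewrite hornerZ cReM /= mul0r subr0 pmulr_rlt0.
have {}U : ((Th g xL xB)%:E <= k%:E * ((4 * expR (- (2 * xL)))%:E * mu2 (negset f r1)))%E.
  rewrite -kE; apply: le_trans U _; apply: lee_wpmul2l; first exact: ltW.
  by apply: lee_wpmul2l => //; rewrite lee_fin mulr_ge0// expR_ge0.
have E4 : expR (- (2 * xL)) = (t * r0) ^- 2.
  by rewrite expRN expRM_natl lnK// posrE mulr_gt0.
have tr : 0 < t * r0 by rewrite mulr_gt0.
move: U; rewrite muleA -EFinM E4; set a := k * _ => U.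
have a0 : 0 < a by rewrite !mulr_gt0// invr_gt0 exprn_gt0.
rewrite -(@lee_pmul2l _ a%:E)// -EFinM; apply: le_trans U; rewrite lee_fin.
apply: le_trans H.
apply: le_trans (_ : chain_const R * s ^+ 2 / (C * ln (2 + ln M)) <= _); last first.
  apply: ler_wpM2l; first exact: (mulr_ge0 (ltW (chain_const_gt0 R)) (sqr_ge0 s)).
  by rewrite lef_pV2 ?posrE ?ltr0n ?mulr_gt0.
rewrite le_eqVlt; apply/orP; left; apply/eqP; rewrite /a; field.
by rewrite !gt_eqF.
Qed.

End NegativeArea.

(** * Lower bound *)

Section LowerBound.
Variable R : realType.
Local Notation C := R[i].
Local Notation mu := (@lebesgue_measure R).
Local Notation mu2 := (mu \x mu)%E.
Implicit Types (f p : {poly C}) (z w : C) (a : seq C).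

(** m is the supremum of |f| on |z| <= r0, so L <= m <= U and U / m <= U / L. A point with |f| >=
    m/2 exists whether or not the supremum is attained. *)
Lemma negset_area_ge_bounds (r0 r1 : R) : 0 < r0 -> r0 < r1 ->
  exists k0 c : R, [/\ 0 < k0, 0 < c & forall f (L U : R), 0 < L ->
    (exists2 z : C, cabs z <= r0 & L <= cabs f.[z]) ->
    (forall z : C, cabs z <= r1 -> cabs f.[z] <= U) ->
    cabs f.[0] <= k0 * L ->
    ((c / ln (2 + ln (U / L)))%:E <= mu2 (negset f r1))%E].
Proof.
move=> r00 r01; have [k0 [c [k00 c0 H]]] := negset_area_ge r00 r01.
exists k0, c; split => // f L U L0 [z1 z1r Lz1] fU f0.
pose S := [set x | exists2 z : C, cabs z <= r0 & x = cabs f.[z]].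
have SU x : S x -> x <= U by move=> [z zr ->]; apply: fU; apply: le_trans zr (ltW r01).
have hS : has_sup S by split; [exists (cabs f.[z1]); exists z1|exists U => x /SU].
set m := sup S.
have Lm : L <= m by apply: le_trans Lz1 _; apply: ub_le_sup; [exact: hS.2|exists z1].
have m0 : 0 < m by exact: lt_le_trans Lm.
have mU : m <= U by apply: ge_sup; [exact: hS.1|exact: SU].
have m2 : m / 2 < m by rewrite ltr_pdivrMr// ltr_pMr// ltr1n.
have [_ [z2 z2r ->] mz2] := @sup_gt _ S (m / 2) hS.1 m2.
have UL : 1 <= U / m by rewrite ler_pdivlMr// mul1r.
have ULL : U / m <= U / L.
  apply: ler_wpM2l; first exact: le_trans (ltW m0) mU.
  by rewrite lef_pV2 ?posrE.
have l0 : 0 <= ln (U / m) by rewrite ln_ge0.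
have U0 : 0 < U / m by exact: lt_le_trans UL.
have ll : ln (U / m) <= ln (U / L) by rewrite ler_ln ?posrE// (lt_le_trans U0).
have p1 : 0 < ln (2 + ln (U / m)).
  by apply: ln_gt0; apply: (@lt_le_trans _ _ 2); [rewrite ltr1n|rewrite lerDl].
apply: le_trans (H f m (U / m) m0 UL _ _ _ _).
- rewrite lee_fin; apply: ler_wpM2l; first exact: ltW.
  have q1 : ln (2 + ln (U / m)) <= ln (2 + ln (U / L)).
    by rewrite ler_ln ?posrE ?lerD2l// ltr_pwDl// (le_trans l0).
  by rewrite lef_pV2 ?posrE// (lt_le_trans p1).
- by move=> z zr; apply: ub_le_sup; [exact: hS.2|exists z].
- by exists z2 => //; exact: ltW.
- by move=> z zr; rewrite divfK ?gt_eqF//; exact: fU.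
- by apply: le_trans f0 _; apply: ler_wpM2l => //; exact: ltW.
Qed.

Lemma blaschke_id z w :
  cabs (1 - conjc w * z) ^+ 2 - cabs (z - w) ^+ 2 = (1 - cabs z ^+ 2) * (1 - cabs w ^+ 2).
Proof. by rewrite !cabs_sqr; case: z w => [x y] [u v]; simpc => /=; ring. Qed.

Lemma blaschke_le z w : cabs z <= 1 -> cabs w <= 1 -> cabs (z - w) <= cabs (1 - conjc w * z).
Proof.
move=> z1 w1; rewrite -(@ler_pXn2r _ 2)// ?nnegrE ?cabs_ge0// -subr_ge0 blaschke_id.
by apply: mulr_ge0; rewrite subr_ge0 exprn_ile1// cabs_ge0.
Qed.

Definition rprod a : {poly C} := \prod_(w <- a) ('X - w%:P).
Definition recip a : {poly C} := \prod_(w <- a) (1 - conjc w *: 'X).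

Lemma rprod_horner a z : (rprod a).[z] = \prod_(w <- a) (z - w).
Proof. by rewrite horner_prod; apply: eq_bigr => w _; rewrite hornerXsubC. Qed.

Lemma recip_horner a z : (recip a).[z] = \prod_(w <- a) (1 - conjc w * z).
Proof. by rewrite horner_prod; apply: eq_bigr => w _; rewrite hornerD hornerN hornerZ hornerX hornerC. Qed.

Lemma monic_roots p n : p \is monic -> size p = n.+1 ->
  exists a, [/\ size a = n, p = rprod a & forall z, root p z = (z \in a)].
Proof.
move=> mp sp; have [a E] := closed_field_poly_normal p.
rewrite (monicP mp) scale1r in E; exists a; split => //.
  by have := size_prod_XsubC a id; rewrite -E sp => -[].
by move=> z; rewrite {1}E root_prod_XsubC.
Qed.

Definition in_disk a := forall w, w \in a -> cabs w <= 1.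

Lemma in_disk_cons w a : in_disk (w :: a) -> cabs w <= 1 /\ in_disk a.
Proof.
by move=> h; split => [|v va]; apply: h; rewrite inE ?eqxx// va orbT.
Qed.

Lemma rprod_le_recip a z : in_disk a -> cabs z <= 1 -> cabs (rprod a).[z] <= cabs (recip a).[z].
Proof.
move=> + z1; rewrite rprod_horner recip_horner.
elim: a => [|w a IH]; first by rewrite !big_nil.
move=> /in_disk_cons[w1 /IH h]; rewrite !big_cons !cabsM.
by apply: ler_pM h; rewrite ?cabs_ge0// blaschke_le.
Qed.

Lemma recip_bounds a z (r : R) : in_disk a -> r <= 1 -> cabs z <= r ->
  (1 - r) ^+ size a <= cabs (recip a).[z] <= (1 + r) ^+ size a.
Proof.
move=> + r1 zr; rewrite recip_horner; elim: a => [|w a IH].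
  by rewrite big_nil cabs1 !expr0 lexx.
move=> /in_disk_cons[w1 /IH/andP[h1 h2]]; rewrite big_cons cabsM !exprS.
have wz : cabs (conjc w * z) <= r.
  by rewrite cabsM cabs_conj; apply: le_trans zr; rewrite ler_piMl ?cabs_ge0.
have t1 := cabsD (1 - conjc w * z) (conjc w * z); rewrite subrK cabs1 in t1.
have t2 := cabsD 1 (- (conjc w * z)); rewrite cabsN cabs1 in t2.
have r0 : 0 <= r by exact: le_trans (cabs_ge0 _) zr.
by apply/andP; split; apply: ler_pM; rewrite ?cabs_ge0 ?exprn_ge0 ?subr_ge0//; lra.
Qed.

Lemma prod1_near (s : seq C) (d : R) : d <= 1 -> (forall u, u \in s -> cabs u <= d) ->
  cabs (\prod_(u <- s) (1 - u)) <= 2 ^+ size s /\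
  cabs (\prod_(u <- s) (1 - u) - 1) <= (size s)%:R * 2 ^+ size s * d.
Proof.
move=> d1; elim: s => [|u s IH] hs.
  by rewrite big_nil subrr cabs0 cabs1 expr0 !mul0r.
have ud : cabs u <= d by apply: hs; rewrite inE eqxx.
have d0 : 0 <= d by exact: le_trans (cabs_ge0 _) ud.
have [|IH1 IH2] := IH; first by move=> v vs; apply: hs; rewrite inE vs orbT.
rewrite big_cons; set P := \prod_(_ <- s) _ in IH1 IH2 *.
have t2 := cabsD 1 (- u); rewrite cabsN cabs1 in t2.
split.
  by rewrite cabsM exprS; apply: ler_pM; rewrite ?cabs_ge0//; lra.
have -> : (1 - u) * P - 1 = (P - 1) + - (u * P) by ring.
apply: le_trans (cabsD _ _) _; rewrite cabsN cabsM.
have h1 : cabs u * cabs P <= d * 2 ^+ size s by apply: ler_pM; rewrite ?cabs_ge0.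
have e0 : 0 <= 2 ^+ size s :> R by exact: exprn_ge0.
have h2 : 0 <= (size s)%:R * 2 ^+ size s * d by rewrite !mulr_ge0.
have h3 : 0 <= d * 2 ^+ size s by rewrite mulr_ge0.
rewrite [size (u :: s)]/= exprS -natr1.
move: h1 h2 h3 IH2; move: (cabs _ * _) (cabs (P - 1)) (2 ^+ _) (size s)%:R => A B E N.
by move=> *; nra.
Qed.

(** A polynomial approximate inverse of [recip a]: each 1 / (1 - conj(w) z) is cut off after K terms
    of its geometric series. *)
Definition geomq (K : nat) a : {poly C} := \prod_(w <- a) \sum_(k < K) (conjc w *: 'X) ^+ k.

Lemma geomq_recip K a z :
  (geomq K a).[z] * (recip a).[z] = \prod_(u <- [seq (conjc w * z) ^+ K | w <- a]) (1 - u).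
Proof.
rewrite /geomq horner_prod recip_horner -big_split/= big_map; apply: eq_bigr => w _.
rewrite horner_sum mulrC -opprB mulNr.
have -> : \sum_(i < K) ((conjc w *: 'X : {poly C}) ^+ i).[z] = \sum_(i < K) (conjc w * z) ^+ i.
  by apply: eq_bigr => i _; rewrite horner_exp hornerZ hornerX.
by rewrite -subrX1 opprB.
Qed.

Lemma geomq0 K a : (0 < K)%N -> (geomq K a).[0] = 1.
Proof.
move=> K0; have := geomq_recip K a 0; rewrite recip_horner.
have -> : \prod_(w <- a) (1 - conjc w * 0) = 1 :> C.
  by rewrite big1// => w _; rewrite mulr0 subr0.
rewrite mulr1 => ->; rewrite big_map big1// => w _.
by rewrite mulr0 expr0n eqn0Ngt K0 subr0.
Qed.

Lemma exists_expr_le (x d : R) : 0 <= x -> x < 1 -> 0 < d -> exists K, (0 < K)%N /\ x ^+ K <= d.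
Proof.
move=> x0 x1 d0; have nx : `|x| < 1 by rewrite ger0_norm.
have /cvgrPdist_lt/(_ d d0)[N _ h] := cvg_expr nx.
exists N.+1; split => //; apply: ltW.
by have := h N.+1 (leqnSn N); rewrite /= sub0r normrN ger0_norm// exprn_ge0.
Qed.

Lemma geomq_approx a (r d : R) : in_disk a -> 0 <= r -> r < 1 -> 0 < d ->
  exists K, (0 < K)%N /\ forall z, cabs z <= r -> cabs ((geomq K a).[z] * (recip a).[z] - 1) <= d.
Proof.
move=> ha r0 r1 d0; set M : R := (size a)%:R * 2 ^+ size a.
have M0 : 0 <= M by rewrite mulr_ge0// exprn_ge0.
have D0 : 0 < Num.min 1 (d / (M + 1)).
  by rewrite lt_min ltr01 divr_gt0// ltr_pwDr.
have [K [K0 hK]] := exists_expr_le r0 r1 D0.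
exists K; split => // z zr; rewrite geomq_recip.
move: hK; rewrite le_min => /andP[hK1 hK2].
have hu u : u \in [seq (conjc w * z) ^+ K | w <- a] -> cabs u <= r ^+ K.
  move=> /mapP[w wa ->]; rewrite cabsX lerXn2r ?nnegrE ?cabs_ge0//.
  by rewrite cabsM cabs_conj; apply: le_trans zr; rewrite ler_piMl ?cabs_ge0// ha.
have [_] := prod1_near hK1 hu; rewrite size_map -/M => h; apply: le_trans h _.
apply: le_trans (ler_wpM2l M0 hK2) _.
rewrite mulrCA ler_piMr ?(ltW d0)// ler_pdivrMr ?mul1r ?lerDl//.
by rewrite ltr_pwDr.
Qed.

Lemma area_ge_negset p f (r : R) : r <= 1 ->
  (forall z : C, cabs z <= r -> Re f.[z] < 0 -> cabs p.[z] < 1) ->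
  (mu2 (negset f r) <= area (lemniscate p 1))%E.
Proof.
move=> r1 h; apply: le_measure; rewrite ?inE; first exact: measurable_negset.
  rewrite (_ : [set _ | _] = [set w | cabs p.[toC w] \in `]-oo, 1[]).
    by apply: measurable_preimage_itv; exact: measurable_cabs.
  by apply/seteqP; split => w /=; rewrite /lemniscate/= in_itv.
by move=> w [w1 w2]; exact: h.
Qed.

(** The square [0, 1/2]^2 lies in the open unit disk. *)
Lemma area_disk_ge p : (forall z : C, cabs z < 1 -> cabs p.[z] < 1) ->
  ((4^-1)%:E <= area (lemniscate p 1))%E.
Proof.
move=> h; have -> : ((4^-1)%:E : \bar R) = mu2 (`[0, 2^-1]%classic `*` `[0, 2^-1]%classic).
  rewrite [RHS](_ : _ = (mu `[0%R, (2^-1)%R]%classic * mu `[0%R, (2^-1)%R]%classic)%E); last first.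
    by apply: (@product_measure1E _ _ _ _ _ mu mu); exact: measurable_itv.
  rewrite !lebesgue_measure_itv /= lte_fin invr_gt0 ltr0n -EFinD subr0.
  by rewrite -EFinM -invfM -natrM.
apply: le_measure; rewrite ?inE; first by apply: measurableX; exact: measurable_itv.
  rewrite (_ : [set _ | _] = [set w | cabs p.[toC w] \in `]-oo, 1[]).
    by apply: measurable_preimage_itv; exact: measurable_cabs.
  by apply/seteqP; split => w /=; rewrite /lemniscate/= in_itv.
move=> w [] /=; rewrite !in_itv/= => /andP[a0 a1] /andP[b0 b1]; apply: h.
rewrite -(@ltr_pXn2r _ 2)// ?nnegrE ?cabs_ge0// cabs_sqr/= expr1n.
have := ler_pM a0 a0 a1 a1; have := ler_pM b0 b0 b1 b1; rewrite -!expr2.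
by rewrite exprVn -natrX; lra.
Qed.

End LowerBound.

Section LowerBoundMain.
Variable R : realType.
Local Notation C := R[i].
Local Notation mu := (@lebesgue_measure R).
Local Notation mu2 := (mu \x mu)%E.
Implicit Types (f p : {poly C}) (z w : C) (a : seq C).

Lemma ln2_ge_half : 2^-1 <= ln 2 :> R.
Proof.
have h := expR_ge1Dx (- 2^-1 : R).
have : expR (- ln 2) <= expR (- 2^-1) :> R.
  by rewrite expRN lnK ?posrE//; apply: le_trans h; lra.
by rewrite ler_expR lerN2.
Qed.

Lemma ln_nat_ge_half n : (3 <= n)%N -> 2^-1 <= ln (n%:R : R).
Proof.
move=> n3; have n2 := ltnW n3; have n1 := ltnW n2.
by apply: le_trans ln2_ge_half _; rewrite ler_ln ?posrE ?ltr0n ?ler_nat.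
Qed.

Lemma recip_eq1 a : recip a = 1 -> forall w, w \in a -> w = 0.
Proof.
move=> b1 w wa; apply/eqP; apply/negPn/negP => w0.
have cw0 : conjc w != 0 by rewrite -cabs_gt0 cabs_conj cabs_gt0.
have : (recip a).[(conjc w)^-1] = 0.
  apply/eqP; rewrite recip_horner prodf_seq_eq0; apply/hasP; exists w => //.
  by rewrite divff// subrr eqxx.
by rewrite b1 hornerC => /eqP; rewrite oner_eq0.
Qed.

(** 2 + 240 n <= 243 n, and 243 = 3^5 <= n^5, so 2 + ln Q <= n^6. *)
Lemma lnln_le n : (3 <= n)%N -> forall Q : R, 1 <= Q -> Q <= 240 ^+ n -> ln (2 + ln Q) <= 6 * ln n%:R.
Proof.
move=> n3 Q Q1 Qn; have n0 : 0 < n%:R :> R by rewrite ltr0n; exact: leq_trans n3.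
have lQ : 0 <= ln Q by rewrite ln_ge0.
have h1 : ln Q <= 240 * n%:R.
  apply: le_trans (_ : ln (240 ^+ n) <= _).
    by rewrite ler_ln ?posrE ?exprn_gt0 ?ltr0n// (lt_le_trans ltr01).
  rewrite lnXn ?ltr0n// -(mulr_natr (ln _)); apply: ler_wpM2r; first exact: ltW.
  by apply: ltW; apply: ln_sublinear; rewrite ltr0n.
have n3R : 3 <= n%:R :> R by rewrite ler_nat.
have h2 : 2 + ln Q <= n%:R ^+ 6.
  apply: le_trans (_ : 243 * n%:R <= _); first by move: h1 n3R; move: (ln Q) n%:R => *; lra.
  have -> : 243 = 3 ^+ 5 :> R by rewrite -natrX.
  rewrite [leRHS]exprSr; apply: ler_wpM2r; first exact: ltW.
  by rewrite lerXn2r ?nnegrE ?ler0n.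
apply: le_trans (_ : ln (n%:R ^+ 6) <= _).
  by rewrite ler_ln ?posrE ?exprn_gt0// ltr_pwDl.
by rewrite lnXn// mulr_natl.
Qed.

(** f = 1 - [geomq] + kap is close to 1 - 1/b = B / b for b = [recip a]. Where Re f < 0 the shift
    forces |[geomq]| > 1 + kap, while |[geomq] b| <= 1 + d with d <= kap; hence |b| < 1, and |p| <=
    |b|. *)
Lemma lower_bound_const : exists2 c : R, 0 < c & forall n p, (3 <= n)%N ->
  monic_zeros_in n (@closed_disk R) p -> ((c / ln n%:R)%:E <= area (lemniscate p 1))%E.
Proof.
have r0 : 0 < 2^-1 :> R by rewrite invr_gt0.
have r01 : 2^-1 < 3 / 4 :> R by lra.
have [k0 [c [k00 c0 H]]] := negset_area_ge_bounds r0 r01.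
exists (Num.min (c / 6) 8^-1) => [|n p n3 [mp sp pz]].
  by rewrite lt_min divr_gt0//= invr_gt0.
have ln0 := ln_nat_ge_half n3.
have lnp : 0 < ln n%:R :> R by apply: lt_le_trans ln0.
have [a [sa pE pa]] := monic_roots mp sp.
have ha : in_disk a by move=> w wa; apply: pz; rewrite pa.
have [b1|bn1] := eqVneq (recip a) 1.
  apply: le_trans (area_disk_ge _); last first.
    move=> z z1; rewrite pE rprod_horner.
    have az := recip_eq1 b1; rewrite (eq_big_seq (fun=> z)); last first.
      by move=> w wa; rewrite (az w wa) subr0.
    rewrite big_const_seq count_predT sa iter_mulr_1 cabsX exprn_ilt1 ?cabs_ge0//.
    by case: (n) n3.
  rewrite lee_fin ler_pdivrMr//; apply: le_trans (_ : 8^-1 <= _); first by rewrite ge_min lexx orbT.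
  by move: ln0; move: (ln _) => x; lra.
pose B := recip a - 1.
have B0 : B != 0 by rewrite subr_eq0.
(* A common scale for both sides: |B| <= (3/2)^n S on |z| <= 3/4, and |B| > S / (2 (n + 1))
   somewhere on |z| = 1/2. *)
pose S : R := \sum_(k < n.+1) cabs B`_k * 2^-1 ^+ k.
have sb : (size (recip a) <= n.+1)%N.
  rewrite /recip -sa; elim: (a) => [|w s IH]; first by rewrite big_nil size_poly1.
  rewrite big_cons; apply: leq_trans (size_polyMleq _ _) _.
  have : (size (1 - conjc w *: 'X : {poly C})%R <= 2)%N.
    apply: leq_trans (size_polyD _ _) _; rewrite size_poly1 size_polyN geq_max /=.
    by apply: leq_trans (size_scale_leq _ _) _; rewrite size_polyX.
  by move=> h; rewrite -subn1 leq_subLR add1n; apply: leq_trans (leq_add h IH) _.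
have sB : (size B <= n.+1)%N.
  by apply: leq_trans (size_polyD _ _) _; rewrite geq_max sb size_polyN size_poly1.
have h20 : 0 <= 2^-1 :> R by exact: ltW.
have S0 : 0 < S.
  rewrite lt_neqAle sumr_ge0 ?andbT; last by move=> k _; rewrite mulr_ge0 ?cabs_ge0 ?exprn_ge0.
  apply/negP => /eqP/esym/eqP; rewrite psumr_eq0; last first.
    by move=> k _; rewrite mulr_ge0 ?cabs_ge0 ?exprn_ge0.
  move=> /allP hB; case/negP: B0; apply/eqP/polyP => k; rewrite coef0.
  have [kn|kn] := ltnP k n.+1; last by rewrite nth_default//; exact: leq_trans kn.
  have := hB (Ordinal kn) (mem_index_enum _); rewrite mulf_eq0 expf_eq0 invr_eq0 pnatr_eq0 andbF orbF.
  by rewrite cabs_eq0 => /eqP.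
have nn0 : 0 < n.+1%:R :> R by rewrite ltr0n.
pose L0 := S / (2 * n.+1%:R).
have L00 : 0 < L0 by rewrite divr_gt0// mulr_gt0.
have [z0 z0r Bz0] : exists2 z : C, cabs z = 2^-1 & L0 < cabs B.[z].
  apply: contrapT => hn.
  have hB z : cabs z = 2^-1 -> cabs B.[z] <= L0.
    by move=> zr; rewrite leNgt; apply/negP => h; apply: hn; exists z.
  (* Otherwise [coef_le] bounds each of the n + 1 terms of S by [L0]. *)
  have : S <= S / 2.
    apply: le_trans (_ : \sum_(k < n.+1) L0 <= _).
      by apply: ler_sum => k _; exact: coef_le h20 hB.
    rewrite sumr_const card_ord -(mulr_natl L0) /L0 le_eqVlt; apply/orP; left; apply/eqP.
    by move: nn0; move: n.+1%:R => x x0; field; rewrite gt_eqF.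
  by rewrite leNgt ltr_pdivrMr// ltr_pMr// ltr1n.
have Bup z : cabs z <= 3 / 4 -> cabs B.[z] <= (3 / 2) ^+ n * S.
  move=> zr; rewrite (horner_coef_wide z sB); apply: le_trans (cabs_sum _ _ _) _.
  rewrite /S big_distrr/=; apply: ler_sum => k _; rewrite cabsM cabsX mulrCA.
  apply: ler_wpM2l; first exact: cabs_ge0.
  apply: le_trans (_ : (3 / 4) ^+ k <= _); first by rewrite lerXn2r ?nnegrE ?cabs_ge0//; lra.
  have -> : 3 / 4 = 3 / 2 * 2^-1 :> R by lra.
  rewrite exprMn; apply: ler_wpM2r; first exact: exprn_ge0.
  by apply: ler_weXn2l; [lra|rewrite -ltnS].
(* At z0 one has |b| <= (3/2)^n <= 2^n, hence |B / b| >= 4 L; an error of 2 L still leaves |f| >=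
   L. *)
pose L := L0 / 2 ^+ n / 4.
have e2 : 0 < 2 ^+ n :> R by exact: exprn_gt0.
have e4 : 0 < 4 ^+ n :> R by exact: exprn_gt0.
have Lp : 0 < L by rewrite divr_gt0// divr_gt0.
(* f(0) is exactly kap, so kap <= k0 L is the smallness at the centre; kap <= L keeps f within 2 L
   of B / b. *)
pose kap := Num.min k0 1 * L.
have kap0 : 0 < kap by rewrite mulr_gt0// lt_min k00 ltr01.
have kapk : kap <= k0 * L by apply: ler_wpM2r; [exact: ltW|rewrite ge_min lexx].
have kapL : kap <= L by rewrite -[leRHS]mul1r; apply: ler_wpM2r; [exact: ltW|rewrite ge_min lexx orbT].
(* Division by b costs a factor 4^n, because |b| >= 4^(-n) on |z| <= 3/4. *)
pose d := Num.min kap (L / 4 ^+ n).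
have d0 : 0 < d by rewrite lt_min kap0 divr_gt0.
have dk : d <= kap by rewrite ge_min lexx.
have dL : d * 4 ^+ n <= L by rewrite -ler_pdivlMr// ge_min lexx orbT.
have r34 : 0 <= 3 / 4 :> R by [].
have r341 : 3 / 4 < 1 :> R by lra.
have [K [K0 hK]] := geomq_approx ha r34 r341 d0.
pose f := 1 - geomq K a + (kap%:C%C)%:P.
have fE z : f.[z] = 1 - (geomq K a).[z] + kap%:C%C.
  by rewrite /f !hornerE.
have Bb z : (recip a).[z] = 1 + B.[z] by rewrite /B hornerD hornerN hornerC addrC subrK.
have blow z : cabs z <= 3 / 4 -> 4 ^- n <= cabs (recip a).[z].
  move=> zr; have /andP[h _] := recip_bounds ha (ltW r341) zr.
  by move: h; rewrite sa (_ : 1 - 3 / 4 = 4^-1 :> R) ?exprVn//; lra.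
have fnear z : cabs z <= 3 / 4 -> cabs (f.[z] - B.[z] / (recip a).[z]) <= 2 * L.
  move=> zr; have bz := blow z zr.
  have b0 : 0 < cabs (recip a).[z] by apply: lt_le_trans bz; rewrite invr_gt0.
  have bn0 : (recip a).[z] != 0 by rewrite -cabs_gt0.
  have -> : f.[z] - B.[z] / (recip a).[z] =
      - (((geomq K a).[z] * (recip a).[z] - 1) / (recip a).[z]) + kap%:C%C.
    have -> : B.[z] = (recip a).[z] - 1 by rewrite Bb addrAC subrr add0r.
    by rewrite fE; move: bn0; move: ((recip a).[z]) ((geomq K a).[z]) kap%:C%C => x y k x0; field.
  apply: le_trans (cabsD _ _) _; rewrite cabsN cabsM cabsV cabs_real gtr0_norm//.
  have h : cabs ((geomq K a).[z] * (recip a).[z] - 1) / cabs (recip a).[z] <= L.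
    apply: le_trans dL; apply: ler_pM; rewrite ?cabs_ge0 ?invr_ge0 ?cabs_ge0 ?hK//.
    by rewrite -[leRHS]invrK lef_pV2 ?posrE ?invr_gt0.
  by apply: le_trans (lerD h kapL) _; rewrite mulr_natl mulr2n.
have r012 : 2^-1 <= 3 / 4 :> R by exact: ltW.
apply: le_trans (area_ge_negset (ltW r341) (_ : forall z : C, cabs z <= 3 / 4 -> Re f.[z] < 0 -> cabs p.[z] < 1)); last first.
  move=> z zr fz; have z1 : cabs z <= 1 by apply: le_trans zr (ltW r341).
  rewrite pE; apply: le_lt_trans (rprod_le_recip ha z1) _.
  have h1 := hK z zr.
  have h2 : cabs ((geomq K a).[z] * (recip a).[z]) <= 1 + d.
    have := cabsD ((geomq K a).[z] * (recip a).[z] - 1) 1; rewrite subrK cabs1 addrC.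
    by move=> h; apply: le_trans h _; rewrite lerD2l.
  have h3 : 1 + kap < cabs (geomq K a).[z].
    apply: lt_le_trans (Re_le_cabs _).
    by move: fz; rewrite fE !cReD cReN /=; move: (Re _) => x; lra.
  rewrite cabsM in h2; have p1 : 0 < 1 + kap by rewrite ltr_pwDl// ltW.
  have b0 := cabs_ge0 (recip a).[z].
  have aux (x y k e : R) : e <= k -> x * y <= 1 + e -> 1 + k < x -> 0 < 1 + k -> y < 1.
    move=> ek xy kx k1; rewrite ltNge; apply/negP => y1.
    have : x * 1 <= x * y by apply: ler_wpM2l => //; exact: ltW (lt_trans k1 kx).
    by rewrite mulr1; lra.
  exact: (aux _ _ _ _ dk h2 h3 p1).
pose U := (4 ^+ n * ((3 / 2) ^+ n * S)) + 2 * L.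
have UL : U / L = 8 * n.+1%:R * 12 ^+ n + 2.
  have -> : 12 ^+ n = 4 ^+ n * (3 / 2) ^+ n * 2 ^+ n :> R.
    by rewrite -!exprMn; congr (_ ^+ n); lra.
  have aux (x y t N s : R) : 0 < s -> 0 < N -> 0 < t -> (x * (y * s) + 2 * (s / (2 * N) / t / 4)) /
      (s / (2 * N) / t / 4) = 8 * N * (x * y * t) + 2.
    by move=> *; field; rewrite !gt_eqF.
  exact: aux.
have h12 : 1 <= 12 ^+ n :> R by apply: exprn_ege1; rewrite ler1n.
have UL1 : 1 <= U / L.
  rewrite UL; apply: (@le_trans _ _ 2); first by rewrite ler1n.
  by rewrite lerDr !mulr_ge0 ?ler0n// (le_trans ler01).
have nle : n.+1%:R <= 2 ^+ n :> R by rewrite -natrX ler_nat; exact: ltn_expl.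
(* By n + 1 <= 2^n the ratio is at most 10 * 24^n. *)
have UL2 : U / L <= 240 ^+ n.
  rewrite UL; apply: (@le_trans _ _ (10 * 24 ^+ n)).
    have -> : 24 ^+ n = 2 ^+ n * 12 ^+ n :> R by rewrite -exprMn; congr (_ ^+ n); lra.
    have N1 : 1 <= n.+1%:R :> R by rewrite ler1n.
    move: N1 nle h12; move: (2 ^+ n) (12 ^+ n) n.+1%:R => x y N *.
    have : N * y <= x * y by apply: ler_wpM2r => //; lra.
    have : 1 <= x * y by apply: mulr_ege1 => //; lra.
    by rewrite -mulrA; lra.
  have -> : 240 = 10 * 24 :> R by rewrite -natrM.
  rewrite exprMn; apply: ler_wpM2r; first by rewrite exprn_ge0 ?ler0n.
  rewrite -[leLHS]expr1; apply: ler_weXn2l; [by rewrite ler1n|exact: leq_trans n3].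
have l0 : 0 <= ln (U / L) by rewrite ln_ge0.
have lp : 0 < ln (2 + ln (U / L)).
  by apply: ln_gt0; apply: (@lt_le_trans _ _ 2); [rewrite ltr1n|rewrite lerDl].
apply: le_trans (H f L U Lp _ _ _).
- have h6 := lnln_le n3 UL1 UL2.
  rewrite lee_fin; apply: le_trans (_ : c / 6 / ln n%:R <= _).
    by apply: ler_wpM2r; [rewrite invr_ge0 ltW|rewrite ge_min lexx].
  rewrite -mulrA -invfM; apply: ler_wpM2l; first exact: ltW.
  by rewrite lef_pV2 ?posrE ?mulr_gt0.
- exists z0; first by rewrite z0r.
  have zr : cabs z0 <= 3 / 4 by rewrite z0r.
  have h1 := fnear z0 zr.
  have h2 : 4 * L <= cabs (B.[z0] / (recip a).[z0]).
    rewrite cabsM cabsV.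
    have z0r' : cabs z0 <= 2^-1 by rewrite z0r.
    have h1' : 2^-1 <= 1 :> R by lra.
    have /andP[_ bu] := recip_bounds ha h1' z0r'.
    have bz := blow z0 zr.
    have b0 : 0 < cabs (recip a).[z0] by apply: lt_le_trans bz; rewrite invr_gt0.
    have -> : 4 * L = L0 / 2 ^+ n by rewrite /L mulrCA divff ?mulr1// pnatr_eq0.
    apply: ler_pM; [exact: ltW|by rewrite invr_ge0 ltW|exact: ltW|].
    rewrite lef_pV2 ?posrE//; apply: le_trans bu _; rewrite sa lerXn2r ?nnegrE//; lra.
  have h3 := cabsD (B.[z0] / (recip a).[z0] - f.[z0]) f.[z0].
  rewrite subrK cabsB in h3.
  have aux (x y t l : R) : 0 < l -> x <= 2 * l -> 4 * l <= y -> y <= x + t -> l <= t by move=> *; lra.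
  exact: aux Lp h1 h2 h3.
- move=> z zr; have h1 := fnear z zr; have bz := blow z zr.
  have b0 : 0 < cabs (recip a).[z] by apply: lt_le_trans bz; rewrite invr_gt0.
  have h3 := cabsD (f.[z] - B.[z] / (recip a).[z]) (B.[z] / (recip a).[z]).
  rewrite subrK in h3; apply: le_trans h3 _; rewrite addrC; apply: lerD => //.
  rewrite cabsM cabsV mulrC; apply: ler_pM; rewrite ?invr_ge0 ?cabs_ge0 ?Bup//.
  by rewrite -[leRHS]invrK lef_pV2 ?posrE ?invr_gt0.
- by rewrite fE geomq0// subrr add0r cabs_real gtr0_norm.
Qed.

End LowerBoundMain.

(** * Upper bound *)

Section SelfInversive.
Variable R : realType.
Local Notation C := R[i].
Implicit Types (f g p : {poly C}) (z w c : C) (a : seq C).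

Lemma size_lead_recip a : (forall w, w \in a -> w != 0) ->
  size (recip a) = (size a).+1 /\ lead_coef (recip a) = \prod_(w <- a) (- conjc w).
Proof.
elim: a => [|w a IH] ha; first by rewrite /recip !big_nil size_poly1 lead_coef1.
have w0 : conjc w != 0 by rewrite -cabs_gt0 cabs_conj cabs_gt0 ha// inE eqxx.
have [|s1 l1] := IH; first by move=> v va; apply: ha; rewrite inE va orbT.
have sw : size (1 - conjc w *: 'X : {poly C}) = 2.
  rewrite addrC size_polyDl; first by rewrite size_polyN size_scale// size_polyX.
  by rewrite size_polyN size_scale// size_polyX size_poly1.
have lw : lead_coef (1 - conjc w *: 'X : {poly C}) = - conjc w.
  by rewrite lead_coefE sw coefD coefN coefZ coefX coef1 sub0r mulr1.
have rn : recip a != 0 by rewrite -size_poly_eq0 s1.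
have wn : (1 - conjc w *: 'X : {poly C}) != 0 by rewrite -size_poly_eq0 sw.
rewrite /recip !big_cons -/(recip a); split.
  by rewrite size_mul// sw s1.
by rewrite lead_coefM lw l1.
Qed.

Lemma conjc_prod (I : Type) (r : seq I) (F : I -> C) :
  conjc (\prod_(i <- r) F i) = \prod_(i <- r) conjc (F i).
Proof. exact: (rmorph_prod (@conjc R)). Qed.

Lemma conjc1 : conjc (1 : C) = 1.
Proof. exact: rmorph1. Qed.

Lemma conjcM z w : conjc (z * w) = conjc z * conjc w.
Proof. exact: rmorphM. Qed.

Lemma conjcB z w : conjc (z - w) = conjc z - conjc w.
Proof. exact: rmorphB. Qed.

(** The zeros of g lie outside the closed disk, so reversed Blaschke factors give |q| <= |z|^(n -
    deg g) |g| inside, strictly less than |g|. Hence p = g + q has no zero inside, and the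
    reflection symmetry excludes zeros outside. *)
Lemma exists_self_inversive g n : g.[0] = 1 -> (forall z, cabs z <= 1 -> g.[z] != 0) ->
  (size g <= n)%N -> exists p, [/\ monic_zeros_in n (@circle R) p,
    forall z, cabs z <= 1 -> cabs g.[z] * (1 - cabs z ^+ (n - (size g).-1)) <= cabs p.[z] &
    forall z, z != 0 -> cabs p.[z] = cabs z ^+ n * cabs p.[(conjc z)^-1]].
Proof.
move=> g0 gz sg.
have gn0 : g != 0 by apply/eqP => e; move: g0; rewrite e horner0 => /esym/eqP; rewrite oner_eq0.
have [a gE] := closed_field_poly_normal g; set c := lead_coef g in gE.
have cn0 : c != 0 by rewrite lead_coef_eq0.
have sa : size g = (size a).+1 by rewrite gE size_scale// size_prod_XsubC.
have gH z : g.[z] = c * \prod_(w <- a) (z - w) by rewrite {1}gE hornerZ -/(rprod a) rprod_horner.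
have a1 w : w \in a -> 1 < cabs w.
  move=> wa; rewrite ltNge; apply/negP => w1; move: (gz w w1); rewrite gH mulf_eq0 negb_or => /andP[_].
  by rewrite prodf_seq_eq0 => /negP; apply; apply/hasP; exists w; rewrite ?subrr ?eqxx.
have a0 w : w \in a -> w != 0 by move=> /a1 h; rewrite -cabs_gt0 (lt_trans ltr01).
have [sr lr] := size_lead_recip a0.
set m := size a in sa sr; rewrite sa in sg *; rewrite [m.+1.-1]/=.
(* This is z^n conj(g (1 / conj z)); its leading coefficient is conj(g(0)) = 1, which makes p
   monic. *)
pose q := conjc c *: ('X^(n - m) * recip a).
have ccn0 : conjc c != 0 by rewrite -cabs_gt0 cabs_conj cabs_gt0.
have rn0 : recip a != 0 by rewrite -size_poly_eq0 sr.
have sq : size q = n.+1.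
  rewrite size_scale// mulrC size_mulXn// sr addnS subnK//; exact: ltnW.
have lq : lead_coef q = 1.
  rewrite lead_coefZ lead_coefM lead_coefXn mul1r lr.
  have := g0; rewrite gH => /(congr1 conjc); rewrite [RHS]conjc1 conjcM conjc_prod => h; rewrite -[RHS]h; congr (_ * _).
  by apply: eq_bigr => w _; rewrite sub0r rmorphN.
have sgq : (size g < size q)%N by rewrite sa sq ltnS.
have qH z : q.[z] = conjc c * (z ^+ (n - m) * \prod_(w <- a) (1 - conjc w * z)).
  by rewrite hornerZ hornerM hornerXn recip_horner.
have qle z : cabs z <= 1 -> cabs q.[z] <= cabs z ^+ (n - m) * cabs g.[z].
  move=> z1; rewrite qH gH !cabsM cabs_conj cabsX mulrCA ler_wpM2l ?exprn_ge0 ?cabs_ge0//.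
  rewrite ler_wpM2l ?cabs_ge0//; elim: (a) a1 => [|w s IH] h; first by rewrite !big_nil.
  rewrite !big_cons !cabsM; apply: ler_pM; rewrite ?cabs_ge0//; last first.
    by apply: IH => v vs; apply: h; rewrite inE vs orbT.
  have w1 : 1 < cabs w by apply: h; rewrite inE eqxx.
  rewrite -(@ler_pXn2r _ 2)// ?nnegrE ?cabs_ge0// -subr_le0 blaschke_id.
  by rewrite mulr_ge0_le0// ?subr_ge0 ?subr_le0 ?exprn_ile1 ?exprn_ege1 ?cabs_ge0// ltW.
exists (g + q).
have plow z : cabs z <= 1 -> cabs g.[z] * (1 - cabs z ^+ (n - m)) <= cabs (g + q).[z].
  move=> z1; have h := qle z z1; have := cabsD (g.[z] + q.[z]) (- q.[z]).
  by rewrite addrK cabsN hornerD mulrBr mulr1 lerBlDr mulrC => /le_trans; apply; rewrite lerD2l.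
(* Reflection in the circle exchanges g and q up to the factor z^n. *)
have prefl z : z != 0 -> cabs (g + q).[z] = cabs z ^+ n * cabs (g + q).[(conjc z)^-1].
  move=> z0; rewrite -cabsX -(cabs_conj (g + q).[(conjc z)^-1]) -cabsM; congr cabs.
  rewrite !hornerD rmorphD /= mulrDr addrC.
  have nm : z ^+ n = z ^+ (n - m) * z ^+ m by rewrite -exprD subnK// ltnW.
  have zz (F : C -> C) : z ^+ m * \prod_(w <- a) F w = \prod_(w <- a) (z * F w).
    by rewrite big_split/= big_const_seq count_predT iter_mulr_1.
  have cz : conjc (conjc z)^-1 = z^-1 by rewrite fmorphV /= conjcK.
  congr (_ + _).
    rewrite qH gH conjcM conjc_prod nm [RHS]mulrCA -(mulrA (z ^+ (n - m))); congr (_ * (_ * _)).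
    by rewrite zz; apply: eq_bigr => w _; rewrite conjcB cz mulrBr divff// mulrC.
  rewrite qH gH !conjcM conjc_prod conjcK rmorphXn /= cz nm.
  rewrite [RHS]mulrCA; congr (_ * _); rewrite mulrACA -exprMn divff// expr1n mul1r zz.
  apply: eq_bigr => w _; rewrite conjcB conjcM conjc1 conjcK cz mulrBr mulr1.
  by rewrite mulrCA divff// mulr1.
split => //; split.
- by rewrite monicE addrC lead_coefDl// lq.
- by rewrite addrC size_polyDl.
- move=> z; rewrite /root => /eqP pz0; rewrite /circle /=.
  have inside w : cabs w < 1 -> (g + q).[w] != 0.
    move=> w1; rewrite -cabs_gt0; apply: lt_le_trans (plow w (ltW w1)).
    by rewrite mulr_gt0 ?cabs_gt0 ?gz ?(ltW w1)// subr_gt0 exprn_ilt1 ?cabs_ge0// subn_eq0 -ltnNge.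
  apply/eqP; rewrite eq_le !leNgt; apply/andP; split; apply/negP => h.
    have z0 : z != 0 by rewrite -cabs_gt0 (lt_trans ltr01).
    have := prefl z z0; rewrite pz0 cabs0 => /esym/eqP; rewrite mulf_eq0 expf_eq0 cabs_eq0 (negbTE z0) andbF orFb.
    rewrite cabs_eq0 => /negPn/negP; apply; apply: inside.
    by rewrite cabsV cabs_conj invf_lt1// (lt_trans ltr01).
  by have := inside z h; rewrite pz0 eqxx.
Qed.

End SelfInversive.

Section UpperBound.
Variable R : realType.
Local Notation C := R[i].
Local Notation mu := (@lebesgue_measure R).
Local Notation mu2 := (mu \x mu)%E.
Implicit Types (f g p : {poly C}) (z w c : C).

(** With m = 16^(4k+1) bounding the degree of g, the margin n - m >= 2 k (m + 2) makes e^(-(n - m) /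
    k) at most e^(-2 (m + 2)) <= 4^(-(m + 2)), below the perturbation [dl] used in
    [exists_strip_lemniscate]. *)
Lemma degree_budget k n : (0 < k)%N -> (16 ^ (16 * k) <= n)%N ->
  (16 ^ (4 * k).+1 + 2 * k * ((16 ^ (4 * k).+1) + 2) <= n)%N.
Proof.
move=> k0; apply: leq_trans; set m := (16 ^ (4 * k).+1)%N.
have m2 : (2 <= m)%N by rewrite /m expnS (@leq_trans (16 * 1))// leq_mul2l expn_gt0.
have kk : (2 * k <= 16 ^ k)%N.
  apply: (@leq_trans (2 ^ k.+1)); first by rewrite expnS leq_mul2l ltnW// ltn_expl.
  apply: (@leq_trans (4 ^ k)); last by rewrite leq_exp2r.
  by rewrite -[4%N]/(2 ^ 2)%N -expnM leq_exp2l// mul2n -addnn -addn1 leq_add2l.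
apply: (@leq_trans (16 * (16 ^ k * m))); last first.
  by rewrite /m -expnD -expnS leq_exp2l//; move: k0; clear; lia.
have e1 : (1 <= 16 ^ k)%N by rewrite expn_gt0.
apply: (@leq_trans (16 ^ k * m + 16 ^ k * (m + m))).
  by apply: leq_add; [rewrite leq_pmull|apply: leq_mul; rewrite ?leq_add2l].
by rewrite mulnDr; move: (16 ^ k * m)%N; clear; lia.
Qed.

Lemma exists_strip_lemniscate k n : (0 < k)%N -> (16 ^ (16 * k) <= n)%N ->
  exists p, monic_zeros_in n (@circle R) p /\ forall z, cabs p.[z] < 1 ->
    expR (- k%:R^-1) <= cabs z <= expR k%:R^-1 \/ cabs z <= 1 /\ `|Im z| < 16 * k%:R^-1.
Proof.
have aux1 (x : R) : 1 <= x -> (2 * (1 + x))^-1 * (1 + x) = 2^-1.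
  by move=> x1; field; rewrite gt_eqF//; lra.
have aux2 (x : R) : 1 <= x -> (2 * (1 + x))^-1 / 4 = (8 * (1 + x))^-1.
  by move=> x1; field; rewrite gt_eqF//; lra.
have aux3 (x : R) : 0 < x -> x <= 4^-1 -> 1 <= (1 + x / 2) * (1 - x / 4) by move=> *; nra.
have aux4 (x : R) : 0 < x -> x <= 4^-1 -> 0 <= 1 + x / 2 /\ 0 <= 1 - x / 4.
  by move=> *; split; lra.
have aux5 (x y : R) : y <= x / 4 -> x <= 4^-1 -> 2^-1 <= 1 - y by move=> *; lra.
have aux6 (x : R) : x <= 4^-1 -> x / 4 <= 4^-1 by move=> *; lra.
have aux7 : 4^-1 = 2^-1 * 2^-1 :> R by lra.
have half0 : 0 <= 2^-1 :> R by [].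
move=> k0 kn; have [H [H0 sH nH Hs]] := strip_polynomial R k0.
have budget := degree_budget k0 kn.
set m := (16 ^ (4 * k).+1)%N in sH nH budget.
pose M : R := 4 ^+ m; have M1 : 1 <= M by rewrite exprn_ege1// ler1n.
(* M bounds |H| on the closed disk, so this keeps |g - 1| <= 1/2 there and g has no zero. *)
pose dl : R := (2 * (1 + M))^-1.
have dl0 : 0 < dl by rewrite invr_gt0; lra.
have dlM : dl * (1 + M) = 2^-1.
  exact: aux1.
have dl1 : dl <= 4^-1 by rewrite lef_pV2 ?posrE; lra.
pose g := 1 + dl%:C%C *: (1 - H).
have gH z : g.[z] = 1 + dl%:C%C * (1 - H.[z]) by rewrite /g !hornerE.
have g0 : g.[0] = 1 by rewrite gH H0 subrr mulr0 addr0.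
have Hle z : cabs z <= 1 -> cabs (dl%:C%C * (1 - H.[z])) <= 2^-1.
  move=> z1; rewrite cabsM cabs_real gtr0_norm// -dlM ler_pM2l//.
  apply: le_trans (cabsD _ _) _; rewrite cabs1 cabsN lerD2l.
  exact: le_trans (cabs_horner_le _ z1) nH.
have glow z : cabs z <= 1 -> 2^-1 <= cabs g.[z].
  move=> z1; have := cabsD g.[z] (- (dl%:C%C * (1 - H.[z]))); have := Hle z z1.
  by rewrite cabsN gH addrK cabs1; move: (cabs _) (cabs _) => x y; lra.
have gz z : cabs z <= 1 -> g.[z] != 0.
  by move=> /glow h; rewrite -cabs_gt0; apply: lt_le_trans h.
have sg : (size g <= m.+1)%N.
  apply: leq_trans (size_polyD _ _) _; rewrite size_poly1 geq_max /=.
  apply: leq_trans (size_scale_leq _ _) _; apply: leq_trans (size_polyD _ _) _.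
  by rewrite size_poly1 size_polyN geq_max /= sH.
have mn : (m < n)%N.
  apply: leq_trans budget; rewrite -addn1 leq_add2l !muln_gt0 k0 /= addn2.
  by [].
have [p [pm plow prefl]] := exists_self_inversive g0 gz (leq_trans sg mn).
exists p; split => //.
set d := k%:R^-1; have d0 : 0 < d by rewrite invr_gt0 ltr0n.
set m' := (size g).-1 in plow.
have m'm : (m' <= m)%N by rewrite /m' -ltnS; apply: leq_trans sg; rewrite ltn_predL lt0n size_poly_eq0;
  apply/eqP => e; move: (gz 0); rewrite e horner0 cabs0 ler01 eqxx => /(_ isT).
have X : expR (- (d * (n - m)%:R)) <= dl / 4.
  have -> : dl / 4 = (8 * (1 + M))^-1.
    exact: aux2.
  rewrite expRN lef_pV2 ?posrE ?expR_gt0//; last by lra.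
  apply: (@le_trans _ _ (4 ^+ (m + 2))).
    by rewrite exprD -/M expr2; lra.
  have e4 : 4 <= expR 2 :> R.
    have -> : 4 = 2 ^+ 2 :> R by rewrite -natrX.
    rewrite -[X in expR X]mulr1 expRM_natl lerXn2r ?nnegrE ?expR_ge0//.
    by apply: le_trans (expR_ge1Dx 1); rewrite mulr2n.
  apply: (@le_trans _ _ (expR 2 ^+ (m + 2))).
    by rewrite lerXn2r ?nnegrE ?expR_ge0.
  rewrite -expRM_natl ler_expR mulrC ler_pdivlMl ?ltr0n//.
  have hb : (2 * k * (m + 2) <= n - m)%N by rewrite leq_subRL// ltnW.
  rewrite -(ler_nat R) !natrM in hb; apply: le_trans hb.
  by rewrite le_eqVlt; apply/orP; left; apply/eqP; ring.
have small z : cabs z <= expR (- d) -> cabs z ^+ (n - m') <= dl / 4.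
  move=> zd; apply: le_trans X.
  have -> : expR (- (d * (n - m)%:R)) = expR (- d) ^+ (n - m) by rewrite -mulNr mulrC expRM_natl.
  have e1 : expR (- d) <= 1 by rewrite -expR0 ler_expR oppr_le0 ltW.
  apply: (@le_trans _ _ (expR (- d) ^+ (n - m'))).
    by rewrite lerXn2r ?nnegrE ?cabs_ge0 ?expR_ge0.
  by apply: ler_wiXn2l; rewrite ?expR_ge0//; exact: leq_sub2l.
have ed1 : expR (- d) <= 1 by rewrite -expR0 ler_expR oppr_le0 ltW.
move=> z pz1; have [zl|zl] := ltP (cabs z) (expR (- d)).
  have z1 : cabs z <= 1 by exact: le_trans (ltW zl) ed1.
  right; split => //; rewrite ltNge; apply/negP => iz.
  have Hz := Hs z z1 iz.
  (* Off the strip |H| <= 1/2 pushes Re g above 1 by dl / 2, which outweighs the relative loss dl /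
     4 caused by the reflected term. *)
  have gre : 1 + dl / 2 <= cabs g.[z].
    apply: le_trans (Re_le_cabs _); rewrite gH cReD cReM /= mul0r subr0.
    rewrite lerD2l ler_pM2l//; have := Re_le_cabs H.[z]; rewrite cReD cReN /=.
    by move: Hz; move: (cabs _) (Re _) => x y; lra.
  have h := plow z z1; have s := small z (ltW zl).
  move: pz1; rewrite ltNge => /negP; apply; apply: le_trans h.
  apply: (@le_trans _ _ ((1 + dl / 2) * (1 - dl / 4))); first exact: aux3.
  have [p1 p2] := aux4 _ dl0 dl1.
  by apply: (ler_pM p1 p2 gre); rewrite lerD2l lerN2.
have [zu|zu] := leP (cabs z) (expR d); first by left; apply/andP; split.
have z0 : 0 < cabs z by apply: lt_trans zu; exact: expR_gt0.
have zn0 : z != 0 by rewrite -cabs_gt0.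
(* Beyond radius e^d the reflected point has modulus at most e^(-d), where |p| >= 1/4, and the
   factor |z|^n >= 4 compensates. *)
set w := (conjc z)^-1.
have wl : cabs w <= expR (- d).
  by rewrite cabsV cabs_conj expRN lef_pV2 ?posrE ?expR_gt0// ltW.
have w1 : cabs w <= 1 by exact: le_trans wl ed1.
have h := plow w w1; have s := small w wl.
have h2 : 4^-1 <= cabs p.[w].
  apply: le_trans h; rewrite aux7.
  exact: (ler_pM half0 half0 (glow w w1) (aux5 _ _ s dl1)).
have h3 : 4 <= cabs z ^+ n.
  apply: (@le_trans _ _ (expR d ^+ n)); last by rewrite lerXn2r ?nnegrE ?cabs_ge0 ?expR_ge0// ltW.
  apply: (@le_trans _ _ (expR d ^+ (n - m))).
    have -> : expR d ^+ (n - m) = (expR (- (d * (n - m)%:R)))^-1 by rewrite mulrC expRN invrK expRM_natl.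
    rewrite -[leLHS]invrK lef_pV2 ?posrE ?invr_gt0 ?expR_gt0//.
    exact: le_trans X (aux6 _ dl1).
  by apply: ler_weXn2l; [rewrite -expR0 ler_expR ltW|exact: leq_subr].
move: pz1; rewrite (prefl z zn0) ltNge => /negP; case.
have -> : 1 = 4 * 4^-1 :> R by rewrite divff// pnatr_eq0.
by apply: (ler_pM _ _ h3 h2); rewrite ?invr_ge0 ler0n.
Qed.

End UpperBound.

Section UpperBoundArea.
Variable R : realType.
Local Notation C := R[i].
Local Notation mu := (@lebesgue_measure R).
Local Notation mu2 := (mu \x mu)%E.
Implicit Types (f g p : {poly C}).

Lemma measurable_lemniscate p (t : R) : measurable [set xy : R * R | lemniscate p t (xy.1 +i* xy.2)%C].
Proof.
rewrite (_ : [set _ | _] = [set w | cabs p.[toC w] \in `]-oo, t[]).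
  by apply: measurable_preimage_itv; exact: measurable_cabs.
by apply/seteqP; split => w /=; rewrite /lemniscate/= in_itv.
Qed.

(** The polar integral of the annulus is 4 pi d, and the density 1 / |z|^2 is at least e^(-2d)
    there. *)
Lemma area_annulus_le : exists2 K : R, 0 < K & forall d : R, 0 < d -> d <= 1 ->
  (mu2 (ann (- d) d) <= (K * d)%:E)%E.
Proof.
have k1 := polar_const_gt0 R; have k2 := polar_const_lty R.
have [k [k3 kE]] : exists k : R, 0 < k /\ polar_const R = k%:E.
  by move: k1 k2; case: (polar_const R) => [k| |]//; exists k.
exists (4 * pi * expR 2 / k); first by rewrite divr_gt0// !mulr_gt0 ?pi_gt0 ?expR_gt0.
move=> d d0 d1; set A := ann (- d) d.
have mA : measurable A by exact: measurable_ann.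
have mI : measurable_fun [set: R * R] (fun z => (\1_A z * (1 : R))%:E).
  by apply/measurable_EFinP; apply: measurable_funM; [exact: measurable_indic|exact: measurable_cst].
have I0 z : (0 <= (\1_A z * (1 : R))%:E)%E by rewrite lee_fin mulr1.
have c2 : cont2 (fun x y : R => 1) by exact: cont2_cst.
have P := @polar_annulus R (fun=> 1) (- d) d c2; rewrite (polarE mI I0) kE in P.
have dd : - d <= d by rewrite (@le_trans _ _ 0)// ?oppr_le0 ltW.
have e1 : cint (- d) d (fun=> cint 0 (2 * pi) (fun=> 1)) = 4 * pi * d :> R.
  rewrite (cint_cst _ dd) (cint_cst _ (pi2_ge0 R)) subr0 mulr1.
  by move: (pi : R) => x; ring.
rewrite e1 in P.
have E : (k%:E * ((expR (- (2 * d)))%:E * mu2 A) <= (4 * pi * d)%:E)%E.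
  rewrite -P; apply: lee_wpmul2l; first by rewrite lee_fin ltW.
  have -> : mu2 A = (\int[mu2]_z (\1_A z)%:E)%E by rewrite integral_indic// setIT.
  rewrite -ge0_integral2Zl; first last.
  - by rewrite lee_fin expR_ge0.
  - by move=> z; rewrite lee_fin.
  - by apply/measurable_EFinP; exact: measurable_indic.
  apply: ge0_le_integral.
  - exact: measurableT.
  - by move=> z _; rewrite mule_ge0// lee_fin expR_ge0.
  - apply: emeasurable_funM; [exact: measurable_cst|].
    by apply/measurable_EFinP; exact: measurable_indic.
  - by apply: emeasurable_funM; [exact: measurable_nsqV|exact: mI].
  move=> z _; rewrite -!EFinM lee_fin mulr1.
  have [zA|zA] := boolP (z \in A); last by rewrite indicE (negbTE zA) !mulr0.
  rewrite indicE zA !mulr1; have /set_mem/andP[z1 z2] := zA.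
  rewrite expRN lef_pV2// posrE ?expR_gt0//; apply: lt_le_trans z1; exact: expR_gt0.
have a0 : 0 < k * expR (- (2 * d)) by rewrite mulr_gt0 ?expR_gt0.
rewrite -(@lee_pmul2l _ (k * expR (- (2 * d)))%:E)// EFinM -muleA; apply: le_trans E _.
rewrite -EFinM -EFinM lee_fin.
have -> : k * expR (- (2 * d)) * (4 * pi * expR 2 / k * d) = 4 * pi * d * (expR 2 * expR (- (2 * d))).
  by move: (expR _) (expR _) (pi : R) => x y q; field; rewrite gt_eqF.
rewrite -[leLHS]mulr1; apply: ler_wpM2l.
  by rewrite !mulr_ge0 ?pi_ge0// ltW.
by rewrite -expRD -expR0 ler_expR subr_ge0 ler_piMr.
Qed.

Lemma area_box (x y : R) : 0 < x -> 0 < y ->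
  mu2 (`[- x, x]%classic `*` `[- y, y]%classic) = ((2 * x) * (2 * y))%:E.
Proof.
move=> x0 y0.
rewrite [LHS](_ : _ = (mu `[(- x)%R, x]%classic * mu `[(- y)%R, y]%classic)%E); last first.
  by apply: (@product_measure1E _ _ _ _ _ mu mu); exact: measurable_itv.
rewrite !lebesgue_measure_itv /= !lte_fin !gtrN// -!EFinD -EFinM.
by congr EFin; ring.
Qed.

Lemma area_lemniscate_le : exists2 K : R, 0 < K & forall k n, (0 < k)%N ->
  (16 ^ (16 * k) <= n)%N -> exists2 p, monic_zeros_in n (@circle R) p &
  (area (lemniscate p 1) <= (K / k%:R)%:E)%E.
Proof.
(* 64 / k is the area of the box [-1, 1] x [-16/k, 16/k]. *)
have [K K0 HK] := area_annulus_le; exists (K + 64) => [|k n k0 kn]; first by rewrite addr_gt0.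
have [p [pm hp]] := exists_strip_lemniscate R k0 kn; exists p => //.
set d := k%:R^-1 in hp *; have d0 : 0 < d by rewrite invr_gt0 ltr0n.
have d1 : d <= 1 by rewrite invf_le1 ?ltr0n ?ler1n.
pose B : set (R * R) := `[- 1, 1]%classic `*` `[- (16 * d), 16 * d]%classic.
have mB : measurable B by apply: measurableX; exact: measurable_itv.
have mA := @measurable_ann R (- d) d.
have d16 : 0 < 16 * d by rewrite mulr_gt0.
apply: le_trans (_ : (mu2 (ann (- d) d `|` B) <= _)%E).
  apply: le_measure; rewrite ?inE; [exact: measurable_lemniscate|exact: measurableU|].
  move=> [x y] /= /hp[/andP[h1 h2]|[h1 h2]].
    by left; rewrite /ann /= -cabs_toC ![expR (2 * _)]expRM_natl !lerXn2r ?nnegrE ?cabs_ge0 ?expR_ge0.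
  right; split => /=; rewrite in_itv/= -ler_norml; last exact: ltW.
  exact: le_trans (normRe_le_cabs (x +i* y)%C) h1.
apply: le_trans (measureU2 mu2 mA mB) _.
apply: le_trans (leeD (HK d d0 d1) (lexx _)) _; rewrite [X in (_ + X)%E](area_box ltr01 d16).
by rewrite -EFinD lee_fin le_eqVlt; apply/orP; left; apply/eqP; ring.
Qed.

(** For degrees too small for the strip construction. |z| > 2 forces |z^n - 1| >= 1, so the
    lemniscate lies in a square of side 4. *)
Lemma area_Xn_sub1 n : (0 < n)%N -> exists2 p, monic_zeros_in n (@circle R) p &
  (area (lemniscate p 1) <= 16%:E)%E.
Proof.
move=> n0; exists ('X^n - 1).
  split; [exact: monicXnsubC|exact: size_XnsubC|].
  move=> z; rewrite /root !hornerE subr_eq0 => /eqP /(congr1 (@cabs R)).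
  by rewrite cabsX cabs1 => /eqP; rewrite pexpr_eq1 ?cabs_ge0// => /eqP.
have h2 : 0 < 2 :> R by rewrite ltr0n.
pose B : set (R * R) := `[- 2, 2]%classic `*` `[- 2, 2]%classic.
apply: (@le_trans _ _ (mu2 B)); last first.
  by rewrite (area_box h2 h2) lee_fin -!natrM.
apply: le_measure; rewrite ?inE; [exact: measurable_lemniscate|by apply: measurableX; exact: measurable_itv|].
move=> [x y] /=; rewrite /lemniscate /= !hornerE; set z := (x +i* y)%C => h.
have z2 : cabs z <= 2.
  rewrite leNgt; apply/negP => zz.
  have t := cabsD (z ^+ n - 1) 1; rewrite subrK cabs1 cabsX in t.
  have : 2 <= cabs z ^+ n.
    apply: le_trans (ltW zz) _; rewrite -[leLHS]expr1; apply: ler_weXn2l => //.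
    by apply: le_trans (ltW zz); rewrite ler1n.
  by move: t h; move: (cabs _) (cabs _ ^+ _) => a b; lra.
split => /=; rewrite in_itv/= -ler_norml.
  exact: le_trans (normRe_le_cabs z) z2.
exact: le_trans (normIm_le_cabs z) z2.
Qed.

(** k is a sixteenth of log_16 n, rounded down, so that 16^(16k) <= n while 1/k is O(1 / ln n). When
    k = 0, ln n is bounded and ['X^n - 1] suffices. *)
Lemma upper_bound_const : exists2 K : R, 0 < K & forall n, (3 <= n)%N ->
  exists2 p, monic_zeros_in n (@circle R) p & (area (lemniscate p 1) <= (K / ln n%:R)%:E)%E.
Proof.
have [K K0 HK] := area_lemniscate_le.
have aux1 (x y : R) : 0 < x -> 0 < y -> 16 * (16 * x) <= 32 * x * (y + 8).
  by move=> x0 y0; have := mulr_gt0 x0 y0; nra.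
have aux2 (x y z : R) : 0 < x -> 0 < y -> 0 < z -> y * (32 * z * x) <= 32 * x * (y + 8) * z.
  by move=> x0 y0 z0; have := mulr_gt0 x0 z0; nra.
have l16 : 0 < ln 16 :> R by rewrite ln_gt0// ltr1n.
exists (32 * ln 16 * (K + 8)) => [|n n3]; first by rewrite !mulr_gt0// addr_gt0.
have n0 : (0 < n)%N by exact: leq_trans n3.
have lnp : 0 < ln n%:R :> R by apply: lt_le_trans (ln_nat_ge_half R n3).
set T := trunc_log 16 n; pose k := (T %/ 16)%N.
have lnT : ln n%:R <= T.+1%:R * ln 16 :> R.
  rewrite mulr_natl -lnXn// ler_ln ?posrE ?ltr0n ?exprn_gt0// -natrX ler_nat.
  by apply: ltnW; exact: trunc_log_ltn.
have Tk : (T.+1 <= 16 * k.+1)%N.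
  by rewrite /k; lia.
have [k0|k0] := posnP k.
  have [p pm ap] := area_Xn_sub1 n0; exists p => //; apply: le_trans ap _.
  rewrite lee_fin ler_pdivlMr//; apply: le_trans (ler_wpM2l _ lnT) _ => //.
  have : T.+1%:R <= 16 :> R by rewrite ler_nat; move: Tk; rewrite k0 muln1.
  move=> h; apply: (@le_trans _ _ (16 * (16 * ln 16))).
    by apply: ler_wpM2l => //; apply: ler_wpM2r => //; exact: ltW.
  exact: aux1.
have kn : (16 ^ (16 * k) <= n)%N.
  apply: leq_trans (_ : 16 ^ T <= n)%N; last exact: trunc_logP.
  by rewrite leq_exp2l// mulnC leq_divM.
have [p pm ap] := HK k n k0 kn; exists p => //; apply: le_trans ap _.
rewrite lee_fin ler_pdivlMr// mulrAC ler_pdivrMr ?ltr0n//.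
have h : ln n%:R <= 32 * k%:R * ln 16 :> R.
  apply: le_trans lnT _; apply: ler_wpM2r; first exact: ltW.
  rewrite -natrM ler_nat; apply: leq_trans Tk _; rewrite mulnS.
  by move: k0; clear; lia.
apply: le_trans (ler_wpM2l (ltW K0) h) _.
have k0R : 0 < k%:R :> R by rewrite ltr0n.
exact: aux2.
Qed.

End UpperBoundArea.

(** * Interior bound *)

Section SupBound.
Variable R : realType.
Local Notation C := R[i].
Implicit Types (f g p : {poly C}) (z w u : C) (a : seq C) (t : R).

(** The Taylor polynomial of ln (1 - u) at 0. *)
Definition tlog (K : nat) u : C := - \sum_(k < K) (k.+1%:R^-1)%:C%C * u ^+ k.+1.

Lemma is_derive_expr k t : is_derive t 1 (fun s : R => s ^+ k.+1) (k.+1%:R * t ^+ k).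
Proof.
elim: k => [|k IH].
  rewrite expr0 mulr1 (_ : (fun _ => _) = fun s => s); first exact: is_derive_id'.
  by apply/funext => s; rewrite expr1.
rewrite (_ : (fun _ => _) = fun s => s * s ^+ k.+1); last by apply/funext => s; rewrite -exprS.
apply: is_derive_eq' (is_deriveM' (is_derive_id' t) IH) _.
by rewrite -(natr1 k.+1) exprS; ring.
Qed.

Let nv u t : R := (1 - t * Re u) * (1 - t * Re u) + (t * Im u) * (t * Im u).

Let vv u t : C := 1 - t%:C%C * u.

Let nvE u t : nv u t = cabs (vv u t) ^+ 2.
Proof. by rewrite cabs_sqr /nv /vv; case: u => x y; simpc => /=; ring. Qed.

Let is_derive_nv u t : is_derive t 1 (nv u)
  (2 * (1 - t * Re u) * (- Re u) + 2 * (t * Im u) * Im u).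
Proof.
have d0 := is_deriveM' (is_derive_id' t) (is_derive_cst' (Re u) t).
have d1 := is_deriveD' (is_derive_cst' 1 t) (is_deriveN' d0).
have d2 := is_deriveM' (is_derive_id' t) (is_derive_cst' (Im u) t).
by apply: is_derive_eq' (is_deriveD' (is_deriveM' d1 d1) (is_deriveM' d2 d2)) _; ring.
Qed.

Let is_derive_tlog K u t : is_derive t 1 (fun s : R => Re (tlog K (s%:C%C * u)))
  (- Re (\sum_(k < K) u ^+ k.+1 * t%:C%C ^+ k)).
Proof.
elim: K => [|K IH].
  rewrite big_ord0 /= oppr0 (_ : (fun _ => _) = fun=> 0); first exact: is_derive_cst'.
  by apply/funext => s; rewrite /tlog big_ord0 /= oppr0.
have e : (fun s : R => Re (tlog K.+1 (s%:C%C * u))) =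
    (fun s : R => Re (tlog K (s%:C%C * u)) + s ^+ K.+1 * (- (K.+1%:R^-1 * Re (u ^+ K.+1)))).
  apply/funext => s; rewrite /tlog big_ord_recr/= opprD cReD; congr (_ + _).
  by rewrite cReN exprMn -rmorphXn !cReM /= !mul0r !subr0; ring.
rewrite e big_ord_recr/= cReD opprD.
have dX := is_derive_expr K t.
apply: is_derive_eq' (is_deriveD' IH (is_deriveM' dX (is_derive_cst' _ t))) _.
rewrite -rmorphXn cReM /= !mulr0 subr0 ?add0r ?addr0; congr (_ + _).
move: (Re _) (t ^+ K) => x y; have k0 : K.+1%:R != 0 :> R by rewrite pnatr_eq0.
by move: K.+1%:R k0 => n n0; field.
Qed.

Let vv_ge u t (r : R) : r < 1 -> cabs u <= r -> 0 <= t <= 1 -> 1 - r <= cabs (vv u t).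
Proof.
move=> r1 ur /andP[t0 t1]; have := cabsD (vv u t) (t%:C%C * u).
rewrite /vv subrK cabs1 cabsM cabs_real ger0_norm//.
have : t * cabs u <= r by apply: le_trans ur; rewrite ler_piMl ?cabs_ge0.
by move: (cabs _) (t * _) => x y; lra.
Qed.

(** Mean value theorem for t -> ln |1 - t u| - Re [tlog] (t u), whose derivative is - Re (u (t u)^K
    / (1 - t u)): all earlier terms of the geometric series cancel. *)
Lemma tlog_approx K u (r : R) : r < 1 -> cabs u <= r ->
  `|ln (cabs (1 - u)) - Re (tlog K u)| <= r ^+ K.+1 / (1 - r).
Proof.
move=> r1 ur; have r0 : 0 <= r by exact: le_trans (cabs_ge0 _) ur.
have r10 : 0 < 1 - r by rewrite subr_gt0.
pose D t := (2 * (1 - t * Re u) * (- Re u) + 2 * (t * Im u) * Im u) / nv u t / 2.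
pose phi t := ln (nv u t) / 2 - Re (tlog K (t%:C%C * u)).
pose dphi t := D t + Re (\sum_(k < K) u ^+ k.+1 * t%:C%C ^+ k).
have v0 t : 0 <= t <= 1 -> 0 < cabs (vv u t) by move=> ht; apply: lt_le_trans (vv_ge r1 ur ht).
have n0 t : 0 <= t <= 1 -> 0 < nv u t by move=> ht; rewrite nvE exprn_gt0// v0.
have dp t : 0 <= t <= 1 -> is_derive t 1 phi (dphi t).
  move=> ht; have np := n0 t ht.
  have d1 := is_deriveM' (@is_derive_comp' R (@ln R) (nv u) t _ _ (is_derive1_ln np) (is_derive_nv u t)) (is_derive_cst' 2^-1 t).
  apply: is_derive_eq' (is_deriveD' d1 (is_deriveN' (is_derive_tlog K u t))) _.
  rewrite opprK /dphi; congr (_ + _); rewrite mulr0 addr0 /D; congr (_ / _).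
  by rewrite mulrC.
have cphi : {within `[0, 1], continuous phi}.
  apply: continuous_in_subspaceT => t; rewrite inE/= in_itv/= => ht.
  exact: is_derive_continuous (dp t ht).
have dp' t : t \in `]0, 1[ -> is_derive t 1 phi (dphi t).
  by rewrite in_itv/= => /andP[t0 t1]; apply: dp; rewrite !ltW.
have [c] := @MVT R phi dphi 0 1 ltr01 dp' cphi.
rewrite in_itv/= subr0 mulr1 => /andP[c0 c1].
have p0 : phi 0 = 0.
  rewrite /phi /nv !mul0r subr0 mulr1 addr0 ln1 mul0r sub0r.
  rewrite /tlog big1 ?oppr0//= ?oppr0// => k _.
  by rewrite expr0n/= mulr0.
have p1 : phi 1 = ln (cabs (1 - u)) - Re (tlog K u).
  have h01 : is_true (0 <= (1 : R) <= 1) by rewrite ler01 lexx.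
  have e1 : vv u 1 = 1 - u by rewrite /vv mul1r.
  have := v0 1 h01; rewrite /phi mul1r nvE e1 => c1'.
  by rewrite lnXn// -(mulr_natl (ln _)) mulrAC divff ?mul1r ?pnatr_eq0.
rewrite p0 subr0 p1 => ->.
have hc : 0 <= c <= 1 by rewrite !ltW.
have vc := v0 c hc; have vr := vv_ge r1 ur hc; set v := vv u c in vc vr.
pose w := c%:C%C * u; pose S := \sum_(k < K) u ^+ k.+1 * c%:C%C ^+ k.
have Sv : S * v = u * (1 - w ^+ K).
  have -> : S = u * \sum_(k < K) w ^+ k.
    rewrite /S big_distrr/=; apply: eq_bigr => k _.
    by rewrite exprS exprMn -mulrA [u ^+ k * _]mulrC.
  have vE : v = 1 - w by [].
  by rewrite -mulrA; congr (_ * _); rewrite vE mulrC -[1 - w]opprB mulNr -subrX1 opprB.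
have Dn : D c * cabs v ^+ 2 = - Re (u * conjc v).
  rewrite /D -nvE; have := n0 c hc; rewrite /v /vv /nv.
  case: (u) => x y; simpc => /= np.
  by field; rewrite gt_eqF.
have Sn : Re S * cabs v ^+ 2 = Re (u * (1 - w ^+ K) * conjc v).
  rewrite -Sv; case: (S) => x y; rewrite cabs_sqr; case: (v) => x' y'; simpc => /=.
  by ring.
(* Multiplication by |v|^2 replaces division by v = 1 - c u with multiplication by its conjugate. *)
have key : dphi c * cabs v ^+ 2 = - Re (u * w ^+ K * conjc v).
  rewrite /dphi mulrDl Dn -/S Sn mulrBr mulr1 mulrBl cReD cReN.
  by rewrite addrA addNr add0r.
have wr : cabs w <= r.
  rewrite cabsM cabs_real ger0_norm ?(ltW c0)//; apply: le_trans ur.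
  by rewrite ler_piMl ?cabs_ge0// ltW.
have K2 : `|dphi c| * cabs v ^+ 2 <= r ^+ K.+1 * cabs v.
  rewrite -[X in _ * X](@ger0_norm _ (cabs v ^+ 2)) ?sqr_ge0// -normrM key normrN.
  apply: le_trans (normRe_le_cabs _) _; rewrite !cabsM cabs_conj cabsX exprS.
  apply: ler_wpM2r; first exact: ltW.
  by apply: ler_pM; rewrite ?cabs_ge0 ?exprn_ge0 ?cabs_ge0// lerXn2r ?nnegrE ?cabs_ge0.
rewrite expr2 mulrA ler_pM2r// in K2.
rewrite ler_pdivlMr//; apply: le_trans K2; apply: ler_wpM2l => //.
Qed.

Definition ptlog (K : nat) w : {poly C} := - \sum_(k < K) (k.+1%:R^-1)%:C%C *: (w *: 'X) ^+ k.+1.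

Lemma ptlog_horner K w z : (ptlog K w).[z] = tlog K (w * z).
Proof.
rewrite /ptlog hornerN horner_sum /tlog; congr (- _); apply: eq_bigr => k _.
by rewrite hornerZ horner_exp hornerZ hornerX.
Qed.

Lemma cabs_tlog_le K u (r : R) : r < 1 -> cabs u <= r -> cabs (tlog K u) <= (1 - r)^-1.
Proof.
move=> r1 ur; have r0 : 0 <= r by exact: le_trans (cabs_ge0 _) ur.
rewrite /tlog cabsN; apply: le_trans (cabs_sum _ _ _) _.
apply: (@le_trans _ _ (\sum_(k < K) r ^+ k)).
  apply: ler_sum => k _; rewrite cabsM cabsX cabs_real ger0_norm ?invr_ge0 ?ler0n//.
  apply: (@le_trans _ _ (cabs u ^+ k.+1)).
    by apply: ler_piMl; [rewrite exprn_ge0 ?cabs_ge0|rewrite invf_le1 ?ltr0n ?ler1n].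
  apply: (@le_trans _ _ (r ^+ k.+1)); first by rewrite lerXn2r ?nnegrE ?cabs_ge0.
  by apply: ler_wiXn2l => //; exact: ltW.
rewrite -[leRHS]mul1r ler_pdivlMr ?subr_gt0// mulrC -opprB mulNr -subrX1 opprB.
by rewrite gerBl exprn_ge0.
Qed.

Lemma tlog_sum_approx K (s : seq C) (r : R) : r < 1 -> (forall u, u \in s -> cabs u <= r) ->
  0 < cabs (\prod_(u <- s) (1 - u)) /\
  `|ln (cabs (\prod_(u <- s) (1 - u))) - Re (\sum_(u <- s) tlog K u)| <=
    (size s)%:R * (r ^+ K.+1 / (1 - r)) /\
  cabs (\sum_(u <- s) tlog K u) <= (size s)%:R * (1 - r)^-1.
Proof.
move=> r1; elim: s => [|u s IH] hs.
  by rewrite !big_nil cabs1 cabs0 ln1 /= subrr normr0 !mul0r lexx ltr01.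
have ur : cabs u <= r by apply: hs; rewrite inE eqxx.
have [|h0 [h1 h2]] := IH; first by move=> v vs; apply: hs; rewrite inE vs orbT.
have u0 : 0 < cabs (1 - u).
  by have := cabsD (1 - u) u; rewrite subrK cabs1; move: (cabs _) ur => x *; lra.
rewrite !big_cons cabsM [size _]/= -natr1 !mulrDl !mul1r; split; first exact: mulr_gt0.
split; last by rewrite [leRHS]addrC; apply: le_trans (cabsD _ _) (lerD (cabs_tlog_le K r1 ur) h2).
rewrite lnM ?posrE// cReD opprD addrACA [leRHS]addrC.
apply: le_trans (ler_normD _ _) _; apply: lerD h1; exact: tlog_approx.
Qed.

Local Notation mu2 := ((@lebesgue_measure R) \x (@lebesgue_measure R))%E.

(** ln (e y) < e y with e = c / (2 K) uses up only half of c x. *)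
Lemma ln_lt_linear (c K B : R) : 0 < c -> 0 < K -> exists x0 : R, forall x, x0 < x -> 0 <= x -> 1 <= B + x ->
  K * ln (B + x) < c * x.
Proof.
move=> c0 K0; pose e := c / (2 * K); have e0 : 0 < e by rewrite divr_gt0// mulr_gt0.
exists ((c * `|B| / 2 + K * `|ln e|) * 2 / c) => x hx x0 y1.
have y0 : 0 < B + x by exact: lt_le_trans y1.
have h1 : ln (B + x) <= e * (B + x) - ln e.
  rewrite lerBrDr -lnM ?posrE// mulrC; apply: ltW; apply: ln_sublinear.
  exact: mulr_gt0.
apply: le_lt_trans (ler_wpM2l (ltW K0) h1) _.
rewrite ltr_pdivrMr// in hx.
have -> : K * (e * (B + x) - ln e) = c * B / 2 + c * x / 2 - K * ln e.
  by rewrite /e; move: (ln _) => l; field; rewrite gt_eqF.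
have h2 : c * B <= c * `|B| by apply: ler_wpM2l; [exact: ltW|exact: ler_norm].
have h3 : - (K * ln e) <= K * `|ln e|.
  by rewrite -mulrN; apply: ler_wpM2l; [exact: ltW|rewrite -normrN ler_norm].
move: hx h2 h3; rewrite [x * c]mulrC; move: (c * _) (c * _) (c * _) (K * _) (K * _) => *.
by lra.
Qed.

(** f is a truncated logarithm of p shifted so that Re f >= ln |p|; hence Re f < 0 gives |p| < 1,
    and |p(z)| > e gives |f(z)| >= 1. As |f| <= A n on |z| <= r', the area is at least c / ln (2 +
    ln (A n)), too much for K / ln n when n is large. *)
Lemma sup_le_expR1 (K r : R) : 0 < K -> 0 < r -> r < 1 -> exists N, forall n p, (N <= n)%N ->
  monic_zeros_in n (@circle R) p -> (area (lemniscate p 1) <= (K / ln n%:R)%:E)%E ->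
  forall z, cabs z <= r -> cabs p.[z] <= expR 1.
Proof.
move=> K0 r0 r1; pose r' := (1 + r) / 2.
have rr' : r < r' by rewrite /r'; lra.
have r'1 : r' < 1 by rewrite /r'; lra.
have r'0 : 0 < r' by exact: lt_trans rr'.
have ir0 : 0 < (1 - r')^-1 by rewrite invr_gt0 subr_gt0.
have [k0 [c [k00 c0 H]]] := negset_area_ge_bounds r0 rr'.
pose A := (1 - r')^-1 + 1; have A1 : 1 <= A by rewrite lerDr ltW.
have [x0 hx0] := ln_lt_linear (2 + ln A) c0 K0.
exists (maxn 3 (Num.trunc (expR x0)).+1) => n p; rewrite geq_max => /andP[n3 nx].
move=> [mp sp pz] ap z zr; rewrite leNgt; apply/negP => pe.
have n0 : (0 < n)%N by exact: leq_trans n3.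
have nR : 0 < n%:R :> R by rewrite ltr0n.
have lnp : 0 < ln n%:R :> R by apply: lt_le_trans (ln_nat_ge_half R n3).
have xn : x0 < ln n%:R.
  rewrite -ltr_expR lnK ?posrE//; apply: lt_le_trans (truncnS_gt _) _.
  by rewrite ler_nat.
have lA : 0 <= ln A by rewrite ln_ge0.
have y1 : 1 <= 2 + ln A + ln n%:R.
  by rewrite -addrA (@le_trans _ _ 2) ?ler1n// lerDl addr_ge0// ltW.
have hlt := hx0 _ xn (ltW lnp) y1.
have [a [sa pE pa]] := monic_roots mp sp.
have a1 w : w \in a -> cabs w = 1 by rewrite -pa => /pz.
(* Large enough to cover the truncation error for a suitable J, and small enough as the value f(0),
   with L = 1. *)
pose kap := Num.min k0 1.
have kap0 : 0 < kap by rewrite lt_min k00 ltr01.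
have d0 : 0 < kap * (1 - r') / n%:R by rewrite divr_gt0// mulr_gt0// subr_gt0.
have [J [_ hJ]] := exists_expr_le (ltW r'0) r'1 d0.
have err : n%:R * (r' ^+ J.+1 / (1 - r')) <= kap.
  rewrite mulrA ler_pdivrMr ?subr_gt0//.
  rewrite mulrC -ler_pdivlMr//; apply: le_trans hJ; rewrite exprS ler_piMl//; last exact: ltW.
  by rewrite exprn_ge0// ltW.
pose f := \sum_(w <- a) ptlog J (conjc w) + (kap%:C%C)%:P.
pose us v : seq C := [seq conjc w * v | w <- a].
have fE v : f.[v] = \sum_(u <- us v) tlog J u + kap%:C%C.
  rewrite hornerD hornerC horner_sum big_map; congr (_ + _).
  by apply: eq_bigr => w _; rewrite ptlog_horner.
(* For |w| = 1 one has |v - w| = |1 - conj(w) v|, so |p| is the product of the factors |1 - u|. *)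
have pv v : cabs p.[v] = cabs (\prod_(u <- us v) (1 - u)).
  rewrite pE rprod_horner big_map !cabs_prod.
  apply: eq_big_seq => w wa; apply/eqP; rewrite -(@eqrXn2 _ 2)// ?cabs_ge0// -subr_eq0.
  by rewrite -oppr_eq0 opprB blaschke_id (a1 w wa) expr1n subrr mulr0.
have hus v : cabs v <= r' -> forall u, u \in us v -> cabs u <= r'.
  by move=> vr u /mapP[w wa ->]; rewrite cabsM cabs_conj (a1 w wa) mul1r.
have main v : cabs v <= r' -> [/\ 0 < cabs p.[v], ln (cabs p.[v]) <= Re f.[v] & cabs f.[v] <= A * n%:R].
  move=> vr; have [h0 [h1 h2]] := tlog_sum_approx J r'1 (hus v vr).
  rewrite size_map sa in h1 h2; rewrite pv fE; split => //.
    rewrite cReD /=; have := ler_norm (ln (cabs (\prod_(u <- us v) (1 - u))) - Re (\sum_(u <- us v) tlog J u)).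
    move/le_trans => /(_ _ h1)/le_trans => /(_ _ err).
    by rewrite lerBlDl.
  apply: le_trans (cabsD _ _) _; rewrite /A mulrDl mul1r cabs_real gtr0_norm//.
  apply: lerD; first by rewrite mulrC.
  by apply: (@le_trans _ _ 1); [rewrite ge_min lexx orbT|rewrite ler1n].
have B1 := H f 1 (A * n%:R) ltr01.
have {}B1 : ((c / ln (2 + ln (A * n%:R / 1)))%:E <= mu2 (negset f r'))%E.
  apply: B1.
  - exists z => //; have [p0 h1 _] := main z (le_trans zr (ltW rr')).
    apply: le_trans (Re_le_cabs _); apply: le_trans h1.
    by rewrite -[leLHS]expRK ler_ln ?posrE ?expR_gt0// ltW.
  - by move=> v /main[].
  - rewrite fE big_map big1 => [|w _]; last first.
      by rewrite mulr0 /tlog big1 ?oppr0// => k _; rewrite expr0n mulr0.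
    by rewrite add0r cabs_real gtr0_norm// mulr1 ge_min lexx.
have B2 : (mu2 (negset f r') <= area (lemniscate p 1))%E.
  apply: area_ge_negset; first exact: ltW.
  move=> v vr fv; have [p0 h1 _] := main v vr.
  by rewrite -ltr_ln ?posrE// ln1; apply: le_lt_trans fv.
have := le_trans B1 (le_trans B2 ap).
have A0 : 0 < A by exact: lt_le_trans A1.
rewrite divr1 lnM ?posrE// addrA lee_fin.
have ly : 0 < ln (2 + ln A + ln n%:R).
  by apply: ln_gt0; rewrite -addrA; apply: (@lt_le_trans _ _ 2); [rewrite ltr1n|rewrite lerDl addr_ge0// ltW].
rewrite ler_pdivrMr// mulrAC ler_pdivlMr// leNgt => /negP; apply.
exact: hlt.
Qed.

End SupBound.

(** * Normality *)

Section Montel.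
Variable R : realType.
Local Notation C := R[i].
Implicit Types (f g p h : {poly C}) (z w : C).

(** Compactness gives a cluster point L. If the set of indices with |a k - L| < e were not in U, its
    complement would be, contradicting clustering at L. *)
Lemma ultra_limit (U : set_system nat) (a : nat -> R) (M : R) : UltraFilter U ->
  (forall k, `|a k| <= M) -> exists L, forall e : R, 0 < e -> U [set k | `|a k - L| < e].
Proof.
move=> UU aM; have PU := @ultra_proper _ _ UU.
have UA : (a @ U) `[- M, M]%classic.
  have Uk : U [set k | - M <= a k <= M] by apply: filterS filterT => k _; rewrite /= -ler_norml aM.
  have Uk' : U [set k | a k \in `[- M, M]] by apply: filterS Uk => k; rewrite /= in_itv.
  exact: Uk'.
have [L [_ cL]] := @segment_compact R (- M) M (a @ U) (fmap_proper_filter a PU) UA.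
exists L => e e0; have [//|Uc] := in_ultra_setVsetC [set k | `|a k - L| < e] UU.
have [x [/= x1 x2]] := cL [set x | ~ `|x - L| < e] (ball L e) Uc (nbhsx_ballx L e e0).
by case: x1; rewrite distrC.
Qed.

Lemma ultra_climit (U : set_system nat) (a : nat -> C) (M : R) : UltraFilter U ->
  (forall k, cabs (a k) <= M) -> exists L : C, forall e : R, 0 < e -> U [set k | cabs (a k - L) < e].
Proof.
move=> UU aM; have PU := @ultra_proper _ _ UU.
have [x hx] := ultra_limit UU (fun k => le_trans (normRe_le_cabs (a k)) (aM k)).
have [y hy] := ultra_limit UU (fun k => le_trans (normIm_le_cabs (a k)) (aM k)).
exists (x +i* y)%C => e e0; have e2 : 0 < e / 2 by rewrite divr_gt0.
apply: filterS2 (hx _ e2) (hy _ e2) => k /= h1 h2.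
apply: le_lt_trans (cabs_le_ReIm _) _; rewrite cReD cImD cReN cImN /= [e]splitr.
exact: ltrD.
Qed.

(** Coefficients up to k are bounded by eta. Beyond k, the Cauchy estimate on radius r' gives M
    tau^(2j) <= M tau^k tau^j, and the remaining tau^j makes the sum converge. *)
Lemma cabs_horner_bound h (r r' tau M eta : R) k z : 0 < r' -> 0 <= r -> r < 1 -> 0 < tau -> tau < 1 ->
  r <= tau ^+ 2 * r' -> 0 <= eta -> (forall z, cabs z <= r' -> cabs h.[z] <= M) ->
  (forall j, (j <= k)%N -> cabs h`_j <= eta) -> cabs z <= r ->
  cabs h.[z] <= eta / (1 - r) + M * tau ^+ k / (1 - tau).
Proof.
move=> r'0 r0 r1 t0 t1 rt eta0 hM hj zr.
have M0 : 0 <= M by apply: le_trans (cabs_ge0 _) (hM 0 _); rewrite cabs0 ltW.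
have geo (x : R) n : 0 <= x -> x < 1 -> \sum_(j < n) x ^+ j <= (1 - x)^-1.
  move=> x0 x1; rewrite -[leRHS]mul1r ler_pdivlMr ?subr_gt0// mulrC -opprB mulNr -subrX1 opprB.
  by rewrite gerBl exprn_ge0.
have cj j : cabs h`_j * r' ^+ j <= M.
  by apply: coef_le => [|w wr]; [exact: ltW|apply: hM; rewrite wr].
rewrite horner_coef; apply: le_trans (cabs_sum _ _ _) _.
apply: (@le_trans _ _ (\sum_(j < size h) (eta * r ^+ j + M * tau ^+ k * tau ^+ j))); last first.
  rewrite big_split/= -!big_distrr/=; apply: lerD; apply: ler_wpM2l => //; last exact: geo (ltW t0) t1.
    exact: geo.
  by rewrite mulr_ge0// exprn_ge0// ltW.
apply: ler_sum => j _; rewrite cabsM cabsX.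
have e1 : 0 <= eta * r ^+ j by rewrite mulr_ge0// exprn_ge0.
have e2 : 0 <= M * tau ^+ k * tau ^+ j by rewrite !mulr_ge0// exprn_ge0// ltW.
have zj : cabs z ^+ j <= r ^+ j by rewrite lerXn2r ?nnegrE ?cabs_ge0.
have [jk|kj] := leqP j k.
  apply: (@le_trans _ _ (eta * r ^+ j)); last by rewrite lerDl.
  by apply: ler_pM; rewrite ?cabs_ge0 ?exprn_ge0 ?cabs_ge0 ?hj.
apply: (@le_trans _ _ (M * tau ^+ k * tau ^+ j)); last by rewrite lerDr.
apply: (@le_trans _ _ (cabs h`_j * (tau ^+ 2 * r') ^+ j)).
  apply: ler_wpM2l; [exact: cabs_ge0|apply: le_trans zj _].
  by rewrite lerXn2r ?nnegrE// mulr_ge0 ?exprn_ge0 ?(ltW r'0)// ltW.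
rewrite exprMn mulrCA mulrC -[leRHS]mulrA -exprD; apply: ler_pM => //.
- by rewrite mulr_ge0 ?cabs_ge0// exprn_ge0// ltW.
- by rewrite exprn_ge0// exprn_ge0// ltW.
- rewrite -exprM; apply: ler_wiXn2l; [exact: ltW|exact: ltW|].
  by rewrite mul2n -addnn leq_add2r ltnW.
Qed.

(* Limits of the coefficients along one ultrafilter replace the diagonal
   extraction of subsequences. *)
Lemma montel_polynomials (q : nat -> {poly C}) :
  (forall r : R, r < 1 -> exists M : R, forall k z, cabs z <= r -> cabs (q k).[z] <= M) ->
  exists (s : nat -> nat) (g : C -> C), (forall i j, (i < j)%N -> (s i < s j)%N) /\
    forall r e : R, 0 < r -> r < 1 -> 0 < e -> exists N, forall k, (N <= k)%N ->
      forall z, cabs z <= r -> cabs ((q (s k)).[z] - g z) <= e.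
Proof.
move=> qM; have [U [UU Usub]] := @ultraFilterLemma nat \oo _.
have PU := @ultra_proper _ _ UU.
have bounded_coef j : exists M : R, forall k, cabs (q k)`_j <= M.
  have h1 : 2^-1 < 1 :> R by rewrite invf_lt1// ltr1n.
  have [M hM] := qM _ h1; exists (M * 2 ^+ j) => k.
  have h0 : 0 <= 2^-1 :> R by rewrite invr_ge0.
  have hq z : cabs z = 2^-1 -> cabs (q k).[z] <= M by move=> zr; apply: hM; rewrite zr.
  by have := coef_le j h0 hq; rewrite exprVn ler_pdivrMr ?exprn_gt0.
have [L hL] : {L : nat -> C & forall j (e : R), 0 < e -> U [set k | cabs ((q k)`_j - L j) < e]}.
  apply: (@choice _ _ (fun j L => forall e : R, 0 < e -> U [set k | cabs ((q k)`_j - L) < e])) => j.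
  by have [M hM] := bounded_coef j; exact: ultra_climit hM.
have [g hg] : {g : C -> C & forall z, cabs z < 1 -> forall e : R, 0 < e -> U [set k | cabs ((q k).[z] - g z) < e]}.
  apply: (@choice _ _ (fun z L => cabs z < 1 -> forall e : R, 0 < e -> U [set k | cabs ((q k).[z] - L) < e])) => z.
  have [z1|] := ltP (cabs z) 1; last by exists 0.
  have [M hM] := qM _ z1; have [L' hL'] := @ultra_climit U (fun k => (q k).[z]) M UU (fun k => hM k z (lexx _)).
  by exists L'.
(* Indices whose first k + 1 coefficients are within 1 / (k + 1) of their limits. *)
pose G k := [set l | forall j, (j <= k)%N -> cabs ((q l)`_j - L j) < k.+1%:R^-1].
have UG k : U (G k).
  have : forall m, U [set l | forall j, (j <= m)%N -> cabs ((q l)`_j - L j) < k.+1%:R^-1].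
    have k0 : 0 < k.+1%:R^-1 :> R by rewrite invr_gt0 ltr0n.
    elim=> [|m IH].
      by apply: filterS (hL 0%N _ k0) => l hl j; rewrite leqn0 => /eqP->.
    apply: filterS2 IH (hL m.+1 _ k0) => l h1 h2 j.
    by rewrite leq_eqVlt => /predU1P[->//|]; rewrite ltnS; exact: h1.
  exact.
have next k N : exists l, (N < l)%N /\ G k l.
  (* U refines the filter at infinity, so its members contain arbitrarily large indices and [s] can
     increase. *)
  have I : U ([set l | (N < l)%N] `&` G k).
    by apply: filterI; [exact: (Usub _ (nbhs_infty_gt N))|exact: UG].
  have [l [h1 h2]] := filter_ex I.
  by exists l.
have [nx hnx] : {nx : nat * nat -> nat & forall kN, (kN.2 < nx kN)%N /\ G kN.1 (nx kN)}.
  by apply: (@choice _ _ (fun kN l => (kN.2 < l)%N /\ G kN.1 l)) => -[k N]; exact: next.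
pose s := fix s k := if k is k'.+1 then nx (k, s k') else nx (0%N, 0%N).
have sG k : G k (s k) by case: k => [|k]; [exact: (hnx (0, 0)%N).2|exact: (hnx (k.+1, s k)).2].
have sS k : (s k < s k.+1)%N by exact: (hnx (k.+1, s k)).1.
exists s, g; split.
  by move=> i j; elim: j => // j IH; rewrite ltnS leq_eqVlt => /predU1P[->//|/IH h]; exact: ltn_trans h (sS j).
move=> r e r0 r1 e0; pose r' := (1 + r) / 2.
have rr' : r < r' by rewrite /r'; lra.
have r'1 : r' < 1 by rewrite /r'; lra.
have r'0 : 0 < r' by exact: lt_trans rr'.
(* The arithmetic mean of 1 and r / r' is at least the geometric one, so r <= tau^2 r', while tau <
   1. *)
pose tau := (1 + r / r') / 2.
have t1 : r / r' < 1 by rewrite ltr_pdivrMr// mul1r.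
have t0 : 0 < r / r' by rewrite divr_gt0.
have tau0 : 0 < tau by rewrite /tau; lra.
have tau1 : tau < 1 by rewrite /tau; lra.
have rt : r <= tau ^+ 2 * r'.
  rewrite -ler_pdivrMr//; have := sqr_ge0 (1 - r / r'); rewrite /tau expr2; move: (r / r') => x; nra.
have [M hM] := qM r' r'1.
have M0 : 0 <= M by apply: le_trans (cabs_ge0 _) (hM 0%N 0 _); rewrite cabs0 ltW.
have B0 : 0 < e * (1 - r) / 8 by rewrite divr_gt0// mulr_gt0// subr_gt0.
have D0 : 0 < e * (1 - tau) / (8 * (M + 1)).
  by rewrite divr_gt0// mulr_gt0// ?subr_gt0// ltr_wpDl.
have [K [_ hK]] := exists_expr_le (ltW tau0) tau1 D0.
pose N0 := (Num.trunc (e * (1 - r) / 8)^-1).+1.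
exists (maxn K N0) => k; rewrite geq_max => /andP[Kk Nk] z zr.
have z1 : cabs z < 1 by exact: le_lt_trans zr r1.
have e2 : 0 < e / 2 by rewrite divr_gt0.
(* The comparison index [l] may depend on z, but the bounds on q (s k) - q l do not; this gives
   uniformity. *)
have I : U (G k `&` [set l | cabs ((q l).[z] - g z) < e / 2]).
  by apply: filterI; [exact: UG|exact: hg].
have [l [h1 h2]] := filter_ex I.
have kinv : k.+1%:R^-1 <= e * (1 - r) / 8.
  rewrite -[leRHS]invrK lef_pV2 ?posrE ?invr_gt0 ?ltr0n//.
  apply: le_trans (ltW (truncnS_gt _)) _; rewrite ler_nat; exact: leqW.
have eta0 : 0 <= 2 * k.+1%:R^-1 :> R by rewrite mulr_ge0// invr_ge0.
have hq v : cabs v <= r' -> cabs (q (s k) - q l).[v] <= 2 * M.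
  move=> vr; rewrite hornerD hornerN; apply: le_trans (cabsD _ _) _; rewrite cabsN.
  by apply: le_trans (lerD (hM (s k) v vr) (hM l v vr)) _; rewrite mulr_natl mulr2n.
have hc j : (j <= k)%N -> cabs (q (s k) - q l)`_j <= 2 * k.+1%:R^-1.
  move=> jk; rewrite coefB.
  have -> : (q (s k))`_j - (q l)`_j = ((q (s k))`_j - L j) + - ((q l)`_j - L j) by ring.
  apply: le_trans (cabsD _ _) _; rewrite cabsN mulr_natl mulr2n.
  by apply: lerD; apply: ltW; [exact: sG|exact: h1].
have Hb := cabs_horner_bound r'0 (ltW r0) r1 tau0 tau1 rt eta0 hq hc zr.
have -> : (q (s k)).[z] - g z = (q (s k) - q l).[z] + ((q l).[z] - g z).
  by rewrite hornerD hornerN; ring.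
apply: le_trans (cabsD _ _) _; rewrite [leRHS]splitr; apply: lerD; last exact: ltW.
apply: le_trans Hb _.
have q1 : 2 * k.+1%:R^-1 / (1 - r) <= e / 4.
  rewrite ler_pdivrMr ?subr_gt0//; move: kinv; move: (_^-1) => x; lra.
have q2 : 2 * M * tau ^+ k / (1 - tau) <= e / 4.
  rewrite ler_pdivrMr ?subr_gt0//.
  have hk : tau ^+ k <= e * (1 - tau) / (8 * (M + 1)).
    by apply: le_trans hK; apply: ler_wiXn2l => //; exact: ltW.
  rewrite ler_pdivlMr in hk; last by rewrite mulr_gt0// ltr_wpDl.
  have tk : 0 <= tau ^+ k by rewrite exprn_ge0// ltW.
  move: hk tk; move: (tau ^+ k) => x hk tk; have := mulr_ge0 M0 tk; nra.
by move: q1 q2; move: (_ / (1 - r)) (_ / (1 - tau)) => x y; lra.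
Qed.

End Montel.

Section MinimizerFamily.
Variable R : realType.
Local Notation C := R[i].
Implicit Types (f g p : {poly C}).

Lemma continuous_cabs : continuous (fun z : Cplx R => cabs z : R).
Proof.
move=> z; apply/(@cvgrPdist_lt _ _ _ (nbhs z) (nbhs_filter z)) => e e0; apply/nbhs_ballP.
exists (e%:C%C : C); first by rewrite /= ltcR.
move=> w; rewrite -ball_normE /= normC_cabs ltcR => h.
apply: le_lt_trans h; rewrite ler_norml; apply/andP; split.
  by rewrite lerNl opprB lerBlDr; have := cabsD (w - z) z; rewrite subrK cabsB.
by rewrite lerBlDr; have := cabsD (z - w) w; rewrite subrK.
Qed.

Lemma compact_in_disk (K : set (Cplx R)) : compact K -> K `<=` @disk R ->
  exists2 r : R, 0 < r < 1 & forall z, K z -> cabs z <= r.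
Proof.
move=> cK Kd; have [K0|K0] := pselect (K !=set0); last first.
  exists 2^-1; first by rewrite invr_gt0 ltr0n invf_lt1 ?ltr0n// ltr1n.
  by move=> z Kz; case: K0; exists z.
have cc : {within K, continuous (fun z : Cplx R => cabs z : R)}.
  by apply: continuous_subspaceT; exact: continuous_cabs.
have [c cKc hc] := compact_EVT_max K0 cK cc.
have c1 : cabs c < 1 by apply: Kd; rewrite inE in cKc.
exists (Num.max (cabs c) 2^-1).
  by rewrite lt_max gt_max c1 invr_gt0 ltr0n orbT invf_lt1 ?ltr0n// ltr1n.
by move=> z Kz; rewrite le_max hc// inE.
Qed.

Lemma circle_bound n p (z : C) : monic_zeros_in n (@circle R) p -> cabs z <= 1 -> cabs p.[z] <= 2 ^+ n.
Proof.
move=> [mp sp pz] z1; have [a [sa pE pa]] := monic_roots mp sp.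
have a1 w : w \in a -> cabs w = 1 by rewrite -pa => /pz.
rewrite pE rprod_horner -sa; elim: (a) a1 => [|w s IH] h; first by rewrite big_nil cabs1.
rewrite big_cons cabsM exprS; apply: ler_pM; rewrite ?cabs_ge0//.
  have w1 : cabs w = 1 by apply: h; rewrite inE eqxx.
  by apply: le_trans (cabsD _ _) _; rewrite cabsN w1 mulr2n lerD2r.
by apply: IH => v vs; apply: h; rewrite inE vs orbT.
Qed.

Variables (K : R) (p : nat -> {poly C}).
Hypothesis K0 : 0 < K.
Hypothesis p_monic : forall n, (1 <= n)%N -> monic_zeros_in n (@circle R) (p n).
Hypothesis p_area : forall n, (3 <= n)%N -> (area (lemniscate (p n) 1) <= (K / ln n%:R)%:E)%E.

Lemma eventually_le_expR1 (r : R) : 0 < r -> r < 1 -> exists N, forall n, (N <= n)%N ->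
  forall z : C, cabs z <= r -> cabs (p n).[z] <= expR 1.
Proof.
move=> r0 r1; have [N hN] := sup_le_expR1 K0 r0 r1.
exists (maxn N 3) => n; rewrite geq_max => /andP[Nn n3] z zr.
have n1 : (1 <= n)%N by exact: leq_trans n3.
exact: hN Nn (p_monic n1) (p_area n3) z zr.
Qed.

(** The finitely many degrees below N are covered by the crude bound 2^n on the disk. *)
Lemma minimizers_bounded (r : R) : r < 1 -> exists M : R, forall n, (1 <= n)%N ->
  forall z : C, cabs z <= r -> cabs (p n).[z] <= M.
Proof.
move=> r1; pose r' := Num.max r 2^-1.
have r'0 : 0 < r' by rewrite lt_max invr_gt0 ltr0n orbT.
have r'1 : r' < 1 by rewrite gt_max r1 invf_lt1 ?ltr0n// ltr1n.
have [N hN] := eventually_le_expR1 r'0 r'1.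
exists (Num.max (expR 1) (2 ^+ N)) => n n1 z zr.
have zr' : cabs z <= r' by rewrite le_max zr.
rewrite le_max; have [Nn|nN] := leqP N n; first by rewrite hN.
apply/orP; right; apply: le_trans (circle_bound (p_monic n1) (le_trans zr' (ltW r'1))) _.
by apply: ler_weXn2l; [rewrite ler1n|exact: ltnW].
Qed.

Lemma minimizers_locally_bounded :
  locally_bounded_in (@disk R) [set poly_fun (p n) | n in [set n : nat | (1 <= n)%N]].
Proof.
move=> A cA Ad; have [r /andP[_ r1] hr] := compact_in_disk cA Ad.
have [M hM] := minimizers_bounded r1.
by exists M => _ [n n1 <-] z Az; apply: hM => //; exact: hr.
Qed.

Lemma minimizers_normal :
  normal_family_in (@disk R) [set poly_fun (p n) | n in [set n : nat | (1 <= n)%N]].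
Proof.
move=> f fF.
have [m hm] : {m : nat -> nat & forall k, (1 <= m k)%N /\ poly_fun (p (m k)) = f k}.
  by apply: (@choice _ _ (fun k n => (1 <= n)%N /\ poly_fun (p n) = f k)) => k; have [n n1 <-] := fF k; exists n.
have [|s [g [sS hg]]] := @montel_polynomials R (fun k => p (m k)).
  move=> r r1; have [M hM] := minimizers_bounded r1; exists M => k z zr.
  exact: hM (hm k).1 z zr.
exists s, g; split => // A cA Ad P /uniform_nbhs[E [entE EP]].
have [r /andP[r0 r1] hr] := compact_in_disk cA Ad.
move: entE; rewrite -entourage_ballE => -[e /= e0 eE].
have e1 : 0 < Re e by move: e0; rewrite ltcE => /andP[].
(* The entourage radius lives in R[i], where a positive element is real. *)
have eR : e = (Re e)%:C%C by move: e0; case: (e) => x y; rewrite ltcE /= => /andP[/eqP->].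
have e2 : 0 < Re e / 2 by rewrite divr_gt0.
have [N hN] := hg r (Re e / 2) r0 r1 e2.
exists N => // k Nk; apply: EP => z Az; apply: eE; rewrite /= -ball_normE /= normC_cabs.
rewrite eR ltcR -(hm (s k)).2 cabsB; apply: le_lt_trans (hN k Nk z (hr z Az)) _.
by rewrite ltr_pdivrMr// ltr_pMr// ltr1n.
Qed.

End MinimizerFamily.

Theorem theorem1p1 (R : realType) :
  (exists c C : R, [/\ 0 < c, 0 < C &
    forall n : nat, (3 <= n)%N ->
      [/\ ((c / ln n%:R)%:E <= kappa n (@closed_disk R) 1)%E,
          (kappa n (@closed_disk R) 1 <= kappa n (@circle R) 1)%E &
          (kappa n (@circle R) 1 <= (C / ln n%:R)%:E)%E]])
  /\
  (forall p : nat -> {poly R[i]},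
    (forall n : nat, (1 <= n)%N -> is_minimizer n (@circle R) 1 (p n)) ->
    [/\ forall r : R, 0 < r -> r < 1 ->
          exists n_r : nat, forall n : nat, (1 <= n)%N -> (n_r <= n)%N ->
            (ereal_sup [set (cabs (p n).[z])%:E | z in [set z : R[i] | (cabs z <= r)%R]]
               <= (expR 1)%:E)%E,
        locally_bounded_in (@disk R)
          [set poly_fun (p n) | n in [set n : nat | (1 <= n)%N]] &
        normal_family_in (@disk R)
          [set poly_fun (p n) | n in [set n : nat | (1 <= n)%N]]]).
Proof.
have [K K0 up] := upper_bound_const R; split.
  have [c c0 low] := lower_bound_const R; exists c, K; split => // n n3; split.
  - by apply: le_ereal_inf_tmp => _ [p pm <-]; exact: low.
  - apply: ereal_inf_le_tmp => _ [p [mp sp pz] <-]; exists p => //; split => // z /pz.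
    by rewrite /circle /closed_disk /= => ->.
  - have [p pm ap] := up n n3; apply: le_trans ap.
    by apply: ereal_inf_lbound; exists p.
move=> p pmin; have pm n : (1 <= n)%N -> monic_zeros_in n (@circle R) (p n) by move=> /pmin[].
have pa n : (3 <= n)%N -> (area (lemniscate (p n) 1) <= (K / ln n%:R)%:E)%E.
  move=> n3; have [q qm aq] := up n n3; apply: le_trans aq.
  have n1 : (1 <= n)%N by exact: leq_trans n3.
  exact: (pmin n n1).2.
split; first last.
- exact: minimizers_normal K0 pm pa.
- exact: minimizers_locally_bounded K0 pm pa.
move=> r r0 r1; have [N hN] := eventually_le_expR1 K0 pm pa r0 r1.
exists N => n n1 Nn; apply: ge_ereal_sup => _ [z zr <-].
by rewrite lee_fin; exact: hN.
Qed.
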